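(* Let $1<p\le 2$, let $\Gamma=\Gamma_p$, and let $f\in C^1(\Gamma)$ be a symmetric real-valued function satisfying $\partial_{\lambda_i} f>0$ in $\Gamma$ for $i=1,2$. Assume that $u\in C^2(\mathbb{R}^2)$ is a real-valued function such that $\lambda(A^u)\in\Gamma$ and $$f(\lambda(A^u))=1$$ at every point of $\mathbb{R}^2$. Then there exist $x_0\in\mathbb{R}^2$ and constants $a,b>0$ satisfying $\left(\tfrac{1}{2}a^{-2}b,\tfrac{1}{2}a^{-2}b\right)\in\Gamma$ and $f\left(\tfrac{1}{2}a^{-2}b,\tfrac{1}{2}a^{-2}b\right)=1$ such that $$u(x)=2\ln\frac{8a}{8|x-x_0|^2+b}\qquad\text{for all }x\in\mathbb{R}^2.$$
   Context: For $1\le p\le 2$, $\Gamma_p=\{(\lambda_1,\lambda_2)\in\mathbb{R}^2:\ \lambda_2>(p-2)\lambda_1,\ \lambda_1>(p-2)\lambda_2\}$. A function $f$ on $\Gamma$ is symmetric if $f(\lambda_1,\lambda_2)=f(\lambda_2,\lambda_1)$ for all $(\lambda_1,\lambda_2)\in\Gamma$. For a $C^2$ function $u$ on an open subset of $\mathbb{R}^2$, $A^u$ is the $2\times 2$ symmetric-matrix-valued function $$A^u=-e^{-u}\nabla^2u+\frac12 e^{-u}\,du\otimes du-\frac14 e^{-u}|\nabla u|^2 I,$$ where $\nabla^2u$ is the Hessian matrix, $(du\otimes du)_{ij}=\partial_iu\,\partial_ju$, and $I$ is the $2\times2$ identity matrix. For a real symmetric $2\times 2$ matrix $M$, $\lambda(M)=(\lambda_1(M),\lambda_2(M))$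 denotes its eigenvalues, counted with multiplicity; their order is immaterial because $\Gamma$ and $f$ are symmetric. *)

(* Defs.v *)
From HB Require Import structures.
From mathcomp Require Import all_boot all_order all_algebra.
From mathcomp Require Import all_classical all_reals all_analysis.
Set Implicit Arguments.
Unset Strict Implicit.
Unset Printing Implicit Defensive.
Import Order.TTheory GRing.Theory Num.Theory.
Import numFieldNormedType.Exports.
Local Open Scope classical_set_scope.
Local Open Scope ring_scope.

(* Points of the plane, and pairs of eigenvalues, are row vectors 'rV[R]_2. The
   library norm on 'rV[R]_2 is the max norm: it induces the usual topology, but
   Euclidean lengths are written with [sqr_enorm]. *)

Definition sqr_enorm (R : realType) (v : 'rV[R]_2) : R :=
  \sum_(i < 2) v 0 i ^+ 2.

Definition partial (R : realType) (i : 'I_2) (g : 'rV[R]_2 -> R)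
    (x : 'rV[R]_2) : R :=
  'D_(delta_mx 0 i) g x.

(* Meant for open D: the values of g outside D are then irrelevant. *)
Definition C1_on (R : realType) (D : set 'rV[R]_2) (g : 'rV[R]_2 -> R) : Prop :=
  forall (i : 'I_2) (x : 'rV[R]_2), D x ->
    derivable g x (delta_mx 0 i) /\ {for x, continuous (partial i g)}.

Definition C2_on (R : realType) (D : set 'rV[R]_2) (g : 'rV[R]_2 -> R) : Prop :=
  C1_on D g /\ forall i : 'I_2, C1_on D (partial i g).

Definition gradient (R : realType) (g : 'rV[R]_2 -> R) (x : 'rV[R]_2) :
    'rV[R]_2 :=
  \row_i partial i g x.

Definition hessian (R : realType) (g : 'rV[R]_2 -> R) (x : 'rV[R]_2) :
    'M[R]_2 :=
  \matrix_(i, j) partial i (partial j g) x.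

Definition Amx (R : realType) (u : 'rV[R]_2 -> R) (x : 'rV[R]_2) : 'M[R]_2 :=
  - (expR (- u x) *: hessian u x)
  + (2^-1 * expR (- u x)) *: ((gradient u x)^T *m gradient u x)
  - (4^-1 * expR (- u x) * sqr_enorm (gradient u x)) *: 1%:M.

(* l lists the eigenvalues of M with multiplicity, in either order. *)
Definition eigenvalues_of (R : realType) (M : 'M[R]_2) (l : 'rV[R]_2) : Prop :=
  char_poly M = \prod_(i < 2) ('X - (l 0 i)%:P).

Definition Gamma (R : realType) (p : R) : set 'rV[R]_2 :=
  [set l | (p - 2) * l 0 0 < l 0 1 /\ (p - 2) * l 0 1 < l 0 0].

Definition symmetric_on (R : realType) (D : set 'rV[R]_2) (f : 'rV[R]_2 -> R) :
    Prop :=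
  forall l : 'rV[R]_2, D l -> f (xcol 0 1 l) = f l.

(* Main.v *)
(* With w = exp(-u/2) the matrix A^u is 2 w D^2 w - |D w|^2 I, and it is covariant under
   the Kelvin transform v(z) = |z|^2 w(z/|z|^2), so v solves the same equation away from
   the origin. As p > 1, the cone Gamma_p forbids v to blow up at the origin (barrier
   (ln (|z|^2/rho))^-m), that is w = O(|z|^2) at infinity; this starts the method of
   moving spheres around every centre. At a critical radius (normalised to 1) we have
   v <= w in the unit disc; if v is not w, then v < w strictly inside and to first order
   on the circle (Hopf barrier), and w - v stays away from 0 at the origin: comparison
   with the cone w - eps |z| gives v <= w - eps |z|, and the subharmonicity of ln v
   improves this to a uniform gap. Hence the radius can be increased. So around each
   centre either every radius is admissible or w is its own Kelvin transform for some
   radius. If all centres are of the first kind, then (y - x).Dw(y) <= w(y) for all x, y,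
   so w is constant, which contradicts the equation. Otherwise all centres are of the
   second kind, and comparing the expansions at infinity from two centres shows that
   Dw(x) - 2 al x is constant: w is al |x - x0|^2 + c. *)

Require Import Defs.
From HB Require Import structures.
From mathcomp Require Import all_boot all_order all_algebra.
From mathcomp Require Import all_classical all_reals all_analysis.
From mathcomp Require Import perm ring lra.
Import Order.TTheory GRing.Theory Num.Theory.
Import numFieldNormedType.Exports.
Local Open Scope classical_set_scope.
Local Open Scope ring_scope.

(** The function f is merely C^1 on an open cone, so w and its Kelvin transform v are not compared
    through a linearised equation, whose coefficients would involve the second derivatives of v,
    uncontrolled at the puncture. Every comparison takes place at one touching point, where D^2 v
    lies below the Hessian of w minus a barrier. The matrix of w serves as reference: w is C^2
    across the origin, so on a compact set its eigenvalues stay where the derivatives of f are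
    pinched between positive constants, while the matrix of v only has to be admissible. This
    asymmetry dictates the form of [comparison_local]: a barrier works as soon as the error that it
    creates is at most s (I - K e e^T) for one unit vector e. The Hopf barrier takes e radial, the
    cone at the puncture takes e tangential. With q = 2 - p, the hypothesis p > 1 reads q < 1; it
    enters through the cone inequality for the diagonal entries in an arbitrary orthonormal frame
    and through the exponent m of the logarithmic barrier. *)

(* Differentiability along all curves, with gradient [(a, b)]: every chain rule then
   reduces to the one-variable [is_derive]. *)
Definition grad_at {R : realType} (F : R * R -> R) (p : R * R) (a b : R) : Prop :=
  forall (x y : R -> R) (s dx dy : R), x s = p.1 -> y s = p.2 ->
    is_derive s (1 : R) x dx -> is_derive s (1 : R) y dy ->
    is_derive s (1 : R) (fun t => F (x t, y t)) (a * dx + b * dy).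

(** * Chain rules along curves and the one-variable second derivative test *)

Section GradAt.
Context {R : realType}.
Implicit Types (F G : R * R -> R) (p : R * R).

Lemma is_derive1_continuous (f : R -> R) (s d : R) :
  is_derive s (1 : R) f d -> {for s, continuous f}.
Proof. by move=> [df _]; apply: differentiable_continuous; apply/derivable1_diffP. Qed.

Lemma for_continuous_pair (T : topologicalType) (x y : T -> R) (s : T) :
  {for s, continuous x} -> {for s, continuous y} ->
  {for s, continuous (fun t => (x t, y t))}.
Proof. by move=> cx cy; have := cvg_pair cx cy; rewrite /continuous_at; apply. Qed.

Lemma for_continuous_comp2 (T : topologicalType) F (x y : T -> R) (s : T) :
  {for s, continuous x} -> {for s, continuous y} ->
  {for (x s, y s), continuous F} -> {for s, continuous (fun t => F (x t, y t))}.
Proof.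
move=> cx cy cF; have cxy := for_continuous_pair _ _ _ _ cx cy.
exact: (@continuous_comp _ _ _ (fun t => (x t, y t)) F s cxy cF).
Qed.

Lemma grad_at_eq F p a b a' b' :
  grad_at F p a b -> a = a' -> b = b' -> grad_at F p a' b'.
Proof. by move=> h <- <-. Qed.

Lemma grad_at_cst (c : R) p : grad_at (fun=> c) p 0 0.
Proof.
move=> x y s dx dy _ _ _ _; rewrite !mul0r addr0; exact: is_derive_cst.
Qed.

Lemma grad_at_fst p : grad_at fst p 1 0.
Proof. by move=> x y s dx dy _ _ hx _ /=; rewrite mul1r mul0r addr0. Qed.

Lemma grad_at_snd p : grad_at snd p 0 1.
Proof. by move=> x y s dx dy _ _ _ hy /=; rewrite mul1r mul0r add0r. Qed.

Lemma grad_atD F G p a b c d : grad_at F p a b -> grad_at G p c d ->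
  grad_at (fun q => F q + G q) p (a + c) (b + d).
Proof.
move=> hF hG x y s dx dy xs ys hx hy.
apply: (@is_derive_eq _ _ _ _ _ _ _ _
  (is_deriveD (hF x y s dx dy xs ys hx hy) (hG x y s dx dy xs ys hx hy))).
ring.
Qed.

Lemma grad_atM F G p a b c d : grad_at F p a b -> grad_at G p c d ->
  grad_at (fun q => F q * G q) p (F p * c + G p * a) (F p * d + G p * b).
Proof.
move=> hF hG x y s dx dy xs ys hx hy.
apply: (@is_derive_eq _ _ _ _ _ _ _ _
  (is_deriveM (hF x y s dx dy xs ys hx hy) (hG x y s dx dy xs ys hx hy))).
rewrite /= xs ys -surjective_pairing /GRing.scale /=; ring.
Qed.

Lemma grad_at_comp1 (k : R -> R) (dk : R) F p a b :
  is_derive (F p) (1 : R) k dk -> grad_at F p a b ->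
  grad_at (fun q => k (F q)) p (dk * a) (dk * b).
Proof.
move=> hk hF x y s dx dy xs ys hx hy.
have := hF x y s dx dy xs ys hx hy; move=> hFc.
have hk' : is_derive (F (x s, y s)) (1 : R) k dk by rewrite xs ys -surjective_pairing.
apply: (@is_derive_eq _ _ _ _ _ _ _ _
  (@is_derive1_comp _ k (fun t => F (x t, y t)) s _ _ hk' hFc)).
ring.
Qed.

Lemma grad_at_comp2 F (Z1 Z2 : R * R -> R) p a b a1 b1 a2 b2 :
  grad_at F (Z1 p, Z2 p) a b -> grad_at Z1 p a1 b1 -> grad_at Z2 p a2 b2 ->
  grad_at (fun q => F (Z1 q, Z2 q)) p (a * a1 + b * a2) (a * b1 + b * b2).
Proof.
move=> hF h1 h2 x y s dx dy xs ys hx hy.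
have k1 := h1 x y s dx dy xs ys hx hy.
have k2 := h2 x y s dx dy xs ys hx hy.
have e1 : Z1 (x s, y s) = (Z1 p, Z2 p).1 by rewrite xs ys -surjective_pairing.
have e2 : Z2 (x s, y s) = (Z1 p, Z2 p).2 by rewrite xs ys -surjective_pairing.
apply: (@is_derive_eq _ _ _ _ _ _ _ _ (hF _ _ s _ _ e1 e2 k1 k2)).
ring.
Qed.

Lemma grad_at_line F p a b (d : R * R) : grad_at F p a b ->
  is_derive (0 : R) (1 : R) (fun t => F (p.1 + t * d.1, p.2 + t * d.2))
    (a * d.1 + b * d.2).
Proof.
have aux (c e : R) : is_derive (0 : R) (1 : R) (fun t : R => c + t * e) e.
  have h := is_deriveD (is_derive_cst c (0 : R) (1 : R))
    (is_deriveM (is_derive_id (0 : R) (1 : R)) (is_derive_cst e (0 : R) (1 : R))).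
  by apply: (is_derive_eq h); rewrite /GRing.scale /=; ring.
move=> hF.
by apply: (hF (fun t => p.1 + t * d.1) (fun t => p.2 + t * d.2) 0 d.1 d.2);
  rewrite ?mul0r ?addr0.
Qed.

Lemma MVT_between (f df : R -> R) (a b : R) :
  (forall x, is_derive x (1 : R) f (df x)) ->
  exists2 c, `|c - a| <= `|b - a| & f b - f a = df c * (b - a).
Proof.
move=> hf.
have cf c d : {within `[c, d], continuous f}.
  by apply: derivable_within_continuous => x _; apply: ex_derive.
have [ab|ba|->] := ltgtP a b.
- have [c + h] := MVT ab (fun x _ => hf x) (cf a b).
  rewrite in_itv /= => /andP[ac cb]; exists c => //.
  by rewrite !gtr0_norm ?subr_gt0 // lerD2r ltW.
- have [c + h] := MVT ba (fun x _ => hf x) (cf b a).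
  rewrite in_itv /= => /andP[ac cb]; exists c => //.
    rewrite !ltr0_norm ?subr_lt0 // lerN2 lerD2r ltW //.
  by rewrite -[LHS]opprB h; ring.
- by exists b => //; rewrite !subrr mulr0.
Qed.

(** The increment is split at the corner (p.1, y t) and each leg is a mean value. The intermediate
    points [xi t] and [et t] are no farther from [p] than the curve, hence converge to it, and the
    two terms assemble into a Caratheodory slope. *)
Lemma grad_at_C1 F F1 F2 p :
  (forall q : R * R, is_derive q.1 (1 : R) (fun t => F (t, q.2)) (F1 q)) ->
  (forall q : R * R, is_derive q.2 (1 : R) (fun t => F (q.1, t)) (F2 q)) ->
  {for p, continuous F1} -> {for p, continuous F2} ->
  grad_at F p (F1 p) (F2 p).
Proof.
move=> h1 h2 c1 c2 x y s dx dy xs ys hx hy.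
have /choice[xi Hxi] : forall t, exists c, `|c - p.1| <= `|x t - p.1| /\
    F (x t, y t) - F (p.1, y t) = F1 (c, y t) * (x t - p.1).
  move=> t; have [c] := @MVT_between (fun z => F (z, y t)) (fun z => F1 (z, y t))
     p.1 (x t) (fun z => h1 (z, y t)).
  by exists c.
have /choice[et Het] : forall t, exists c, `|c - p.2| <= `|y t - p.2| /\
    F (p.1, y t) - F (p.1, p.2) = F2 (p.1, c) * (y t - p.2).
  move=> t; have [c] := @MVT_between (fun z => F (p.1, z)) (fun z => F2 (p.1, z))
     p.2 (y t) (fun z => h2 (p.1, z)).
  by exists c.
have cx := is_derive1_continuous _ _ _ hx; have cy := is_derive1_continuous _ _ _ hy.
have squeeze (z g : R -> R) (c : R) : z s = c -> {for s, continuous z} ->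
    (forall t, `|g t - c| <= `|z t - c|) -> g @ s --> c.
  move=> zs cz hg; apply/cvgrPdist_le => e e0.
  move/cvgrPdist_le : cz => /(_ e e0); rewrite zs; apply: filterS => t.
  by rewrite distrC => h; rewrite distrC; apply: le_trans (hg t) h.
have cxi : xi @ s --> p.1 by apply: (squeeze x) => // t; case: (Hxi t).
have cet : et @ s --> p.2 by apply: (squeeze y) => // t; case: (Het t).
move/is_derive1_caratheodory : hx => [hx [Ex chx hxs]].
move/is_derive1_caratheodory : hy => [hy [Ey chy hys]].
have xis : xi s = p.1.
  have [+ _] := Hxi s; rewrite xs subrr normr0 normr_le0 subr_eq0 => /eqP //.
have ets : et s = p.2.
  have [+ _] := Het s; rewrite ys subrr normr0 normr_le0 subr_eq0 => /eqP //.
apply/is_derive1_caratheodory.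
exists (fun t => F1 (xi t, y t) * hx t + F2 (p.1, et t) * hy t); split.
- move=> t; rewrite xs ys.
  have [_ e1] := Hxi t; have [_ e2] := Het t.
  transitivity ((F (x t, y t) - F (p.1, y t)) + (F (p.1, y t) - F (p.1, p.2))).
    ring.
  rewrite e1 e2 -xs -ys Ex Ey; ring.
- have pE : p = (xi s, y s) by rewrite xis ys -surjective_pairing.
  have pE' : p = (p.1, et s) by rewrite ets -surjective_pairing.
  have k1 : {for s, continuous (fun t => F1 (xi t, y t))}.
    apply: (for_continuous_comp2 _ F1 xi y) => //; last by rewrite -pE.
    by rewrite /prop_for /continuous_at xis; exact: cxi.
  have k2 : {for s, continuous (fun t => F2 (p.1, et t))}.
    apply: (for_continuous_comp2 _ F2 (fun=> p.1)) => //; last by rewrite -pE'.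
    - exact: cst_continuous.
    - by rewrite /prop_for /continuous_at ets; exact: cet.
  by apply: cvgD; apply: cvgM.
- by rewrite xis ets ys -surjective_pairing hxs hys.
Qed.

(** If [d2] were negative, the Caratheodory slope of [df] at 0 would be negative nearby, so
    [df c < 0] for small [c > 0]; the mean value theorem on [0, t] would then contradict
    minimality. *)
Lemma second_derivative_at_min (f df : R -> R) (d2 : R) :
  (\forall t \near (0 : R), is_derive t (1 : R) f (df t)) ->
  is_derive (0 : R) (1 : R) df d2 ->
  (\forall t \near (0 : R), f 0 <= f t) ->
  df 0 = 0 /\ 0 <= d2.
Proof.
move=> hf hdf hmin.
have /nbhs_ballP[e /= e0 He] : \forall t \near (0 : R),
   is_derive t (1 : R) f (df t) /\ f 0 <= f t by near=> t; split; near: t.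
have inball t : - e < t < e -> ball (0 : R) e t.
  by move=> /andP[h1 h2]; rewrite /ball /= sub0r normrN ltr_norml h1 h2.
have df0 : df 0 = 0.
  have /inball/He[hd _] : - e < 0 < e by rewrite oppr_lt0 e0.
  have h : is_derive (0 : R) (1 : R) f 0.
    apply: (@derive1_at_min R f (- e) e 0).
    - by rewrite ltW // (lt_trans _ e0) ?oppr_lt0.
    - by move=> t; rewrite in_itv /= => /inball /He [[]].
    - by rewrite in_itv /= oppr_lt0 e0.
    - by move=> t; rewrite in_itv /= => /inball /He [].
  by case: hd => _ <-; case: h.
split => //; rewrite leNgt; apply/negP => d2neg.
have /is_derive1_caratheodory[h [Eh ch h0]] := hdf.
have : \forall t \near (0 : R), h t < 0.
  by move/cvgr_lt : ch => /(_ 0); rewrite h0 => /(_ d2neg); exact.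
move=> /nbhs_ballP[e' /= e'0 He'].
pose t := Num.min e e' / 2.
have m0 : 0 < Num.min e e' by rewrite lt_min e0 e'0.
have t0 : 0 < t by rewrite /t divr_gt0.
have : t < Num.min e e' by rewrite /t ltr_pdivrMr // ltr_pMr // ltr1n.
rewrite lt_min => /andP[te te'].
have der z : 0 <= z <= t -> is_derive z (1 : R) f (df z).
  move=> /andP[z0 zt]; have /inball/He[] // : - e < z < e.
  by rewrite (le_lt_trans zt te) (lt_le_trans _ z0) // oppr_lt0.
have der' z : z \in `]0, t[%R -> is_derive z (1 : R) f (df z).
  by rewrite in_itv /= => /andP[/ltW z0 /ltW zt]; apply: der; rewrite z0.
have cont : {within `[0, t], continuous f}.
  by apply: derivable_within_continuous => z; rewrite in_itv /= => /der [].
have [c] := MVT t0 der' cont.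
rewrite in_itv /= => /andP[c0 ct] Hc.
have /inball/He[_ h1] : - e < t < e by rewrite te (lt_trans _ t0) // oppr_lt0.
have hc : h c < 0.
  apply: He'; rewrite /ball /= sub0r normrN gtr0_norm //; exact: lt_trans te'.
have dfc : df c < 0.
  have := Eh c; rewrite df0 !subr0 => ->; rewrite pmulr_llt0 //.
have : 0 <= df c * (t - 0) by rewrite -Hc subr_ge0.
by rewrite subr0 pmulr_lge0 // leNgt dfc.
Unshelve. all: by end_near. Qed.

End GradAt.

(** * Second-order jets and touching *)

Section Jets.
Context {R : realType}.
Implicit Types (F G : R * R -> R) (p q d : R * R).

(** Second derivatives are asked at [p] only and the gradient only near [p]: this is what a touching
    test consumes, and it suits functions that are singular elsewhere. The shared [h12] builds in
    the symmetry of the Hessian. *)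
Definition jet2 F F1 F2 p (h11 h12 h22 : R) : Prop :=
  [/\ \forall q \near p, grad_at F q (F1 q) (F2 q),
      grad_at F1 p h11 h12 & grad_at F2 p h12 h22].

Lemma grad_at_axis1 F p a b : grad_at F p a b ->
  is_derive p.1 (1 : R) (fun t => F (t, p.2)) a.
Proof.
move=> h; have := h id (fun=> p.2) p.1 1 0 erefl erefl (is_derive_id _ _) (is_derive_cst _ _ _).
by move=> /is_derive_eq; apply; ring.
Qed.

Lemma grad_at_axis2 F p a b : grad_at F p a b ->
  is_derive p.2 (1 : R) (fun t => F (p.1, t)) b.
Proof.
move=> h; have := h (fun=> p.1) id p.2 0 1 erefl erefl (is_derive_cst _ _ _) (is_derive_id _ _).
by move=> /is_derive_eq; apply; ring.
Qed.

Lemma for_continuous_line p d : {for (0 : R), continuous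
  (fun t : R => (p.1 + t * d.1, p.2 + t * d.2))}.
Proof.
apply: for_continuous_pair; apply: cvgD; try exact: cst_continuous;
  (apply: cvgM; [exact: cvg_id | exact: cst_continuous]).
Qed.

Lemma near_line p d (P : R * R -> Prop) : (\forall q \near p, P q) ->
  \forall t \near (0 : R), P (p.1 + t * d.1, p.2 + t * d.2).
Proof.
move=> hP; have c := for_continuous_line p d.
have hP' : nbhs (p.1 + 0 * d.1, p.2 + 0 * d.2) P.
  by rewrite !mul0r !addr0 -surjective_pairing; exact: hP.
exact: (c _ hP').
Qed.

Lemma grad_at_line_at F p a b d (t : R) :
  grad_at F (p.1 + t * d.1, p.2 + t * d.2) a b ->
  is_derive t (1 : R) (fun t => F (p.1 + t * d.1, p.2 + t * d.2)) (a * d.1 + b * d.2).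
Proof.
have aux (c e : R) : is_derive t (1 : R) (fun t : R => c + t * e) e.
  have h := is_deriveD (is_derive_cst c t (1 : R))
    (is_deriveM (is_derive_id t (1 : R)) (is_derive_cst e t (1 : R))).
  by apply: (is_derive_eq h); rewrite /GRing.scale /=; ring.
by move=> hF;
  apply: (hF (fun t => p.1 + t * d.1) (fun t => p.2 + t * d.2) t d.1 d.2).
Qed.

(** The one-variable test is applied on every line through [p]. *)
Lemma jet2_min F F1 F2 p h11 h12 h22 : jet2 F F1 F2 p h11 h12 h22 ->
  (\forall q \near p, F p <= F q) ->
  [/\ F1 p = 0, F2 p = 0 &
    forall a b, 0 <= h11 * a ^+ 2 + 2 * h12 * (a * b) + h22 * b ^+ 2].
Proof.
move=> [hF hF1 hF2] hmin.
have key d : F1 p * d.1 + F2 p * d.2 = 0 /\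
  0 <= h11 * d.1 ^+ 2 + 2 * h12 * (d.1 * d.2) + h22 * d.2 ^+ 2.
  pose l (t : R) := (p.1 + t * d.1, p.2 + t * d.2).
  have l0 : l 0 = p by rewrite /l !mul0r !addr0 -surjective_pairing.
  have hd2 : is_derive (0 : R) (1 : R) (fun t => F1 (l t) * d.1 + F2 (l t) * d.2)
      ((h11 * d.1 + h12 * d.2) * d.1 + (h12 * d.1 + h22 * d.2) * d.2).
    have h1 := grad_at_line F1 p _ _ d hF1.
    have h2 := grad_at_line F2 p _ _ d hF2.
    have h := is_deriveD (is_deriveM h1 (is_derive_cst d.1 (0 : R) (1 : R)))
      (is_deriveM h2 (is_derive_cst d.2 (0 : R) (1 : R))).
    by apply: (is_derive_eq h); rewrite /GRing.scale /=; ring.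
  have [] := second_derivative_at_min (fun t => F (l t))
    (fun t => F1 (l t) * d.1 + F2 (l t) * d.2) _ _ hd2.
  - have := near_line p d _ hF; apply: filterS => t; exact: grad_at_line_at.
  - have := near_line p d _ hmin; apply: filterS => t; by rewrite l0.
  rewrite l0 => e1 e2; split => //.
  by move: e2; congr (0 <= _); ring.
split.
- by have [+ _] := key (1, 0); rewrite /= mulr1 mulr0 addr0.
- by have [+ _] := key (0, 1); rewrite /= mulr1 mulr0 add0r.
- by move=> a b; have [_] := key (a, b).
Qed.

Lemma jet2B F F1 F2 G G1 G2 p h11 h12 h22 k11 k12 k22 :
  jet2 F F1 F2 p h11 h12 h22 -> jet2 G G1 G2 p k11 k12 k22 ->
  jet2 (fun q => F q - G q) (fun q => F1 q - G1 q) (fun q => F2 q - G2 q) p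
    (h11 - k11) (h12 - k12) (h22 - k22).
Proof.
have gB A B q a b c e : grad_at A q a b -> grad_at B q c e ->
    grad_at (fun q => A q - B q) q (a - c) (b - e).
  move=> hA hB; have := grad_atD _ _ _ _ _ _ _ hA
    (grad_atM _ _ _ _ _ _ _ (grad_at_cst (-1) q) hB).
  have -> : (fun q => A q + -1 * B q) = (fun q => A q - B q).
    by apply/funext => z; rewrite mulN1r.
  by move=> h; apply: (grad_at_eq _ _ _ _ _ _ h); ring.
move=> [hF hF1 hF2] [hG hG1 hG2]; split; try exact: gB.
near=> q; apply: gB; near: q; assumption.
Unshelve. all: by end_near. Qed.

Lemma jet2_touch F F1 F2 G G1 G2 p h11 h12 h22 k11 k12 k22 :
  jet2 F F1 F2 p h11 h12 h22 -> jet2 G G1 G2 p k11 k12 k22 ->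
  (\forall q \near p, F p - G p <= F q - G q) ->
  [/\ F1 p = G1 p, F2 p = G2 p &
    forall a b, k11 * a ^+ 2 + 2 * k12 * (a * b) + k22 * b ^+ 2 <=
      h11 * a ^+ 2 + 2 * h12 * (a * b) + h22 * b ^+ 2].
Proof.
move=> hF hG hmin; have [e1 e2 e3] := jet2_min _ _ _ _ _ _ _ (jet2B _ _ _ _ _ _ _ _ _ _ _ _ _ hF hG) hmin.
split; try by apply/eqP; rewrite -subr_eq0; apply/eqP.
by move=> a b; rewrite -subr_ge0; have := e3 a b; congr (0 <= _); ring.
Qed.

(** Schwarz's theorem: the second difference over a square of side [h] equals h^2 times [F12] at one
    nearby point and h^2 times [F21] at another. [C2_on] provides the two mixed partials separately,
    whereas [jet2] wants them equal. *)
Lemma mixed_partials_eq F F1 F2 F11 F12 F21 F22 p :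
  (forall q, grad_at F q (F1 q) (F2 q)) ->
  (forall q, grad_at F1 q (F11 q) (F12 q)) ->
  (forall q, grad_at F2 q (F21 q) (F22 q)) ->
  {for p, continuous F12} -> {for p, continuous F21} -> F12 p = F21 p.
Proof.
move=> hF hF1 hF2 c12 c21.
have dB (f g : R -> R) (s a b : R) : is_derive s (1 : R) f a ->
    is_derive s (1 : R) g b -> is_derive s (1 : R) (fun t => f t - g t) (a - b).
  by move=> h1 h2; exact: is_deriveB.
have key (h : R) : h != 0 -> exists q q',
    [/\ `|q.1 - p.1| <= `|h|, `|q.2 - p.2| <= `|h|, `|q'.1 - p.1| <= `|h|,
        `|q'.2 - p.2| <= `|h| & F12 q = F21 q'].
  move=> h0.
  have [c1] := MVT_between (fun s => F (s, p.2 + h) - F (s, p.2))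
    (fun s => F1 (s, p.2 + h) - F1 (s, p.2)) p.1 (p.1 + h)
    (fun s => dB _ _ _ _ _ (grad_at_axis1 _ _ _ _ (hF (s, p.2 + h)))
                (grad_at_axis1 _ _ _ _ (hF (s, p.2)))).
  rewrite [p.1 + h - p.1]addrAC subrr add0r => hc1 E1.
  have [c2] := MVT_between (fun s => F1 (c1, s)) (fun s => F12 (c1, s)) p.2 (p.2 + h)
    (fun s => grad_at_axis2 _ _ _ _ (hF1 (c1, s))).
  rewrite [p.2 + h - p.2]addrAC subrr add0r => hc2 E2.
  have [e2] := MVT_between (fun s => F (p.1 + h, s) - F (p.1, s))
    (fun s => F2 (p.1 + h, s) - F2 (p.1, s)) p.2 (p.2 + h)
    (fun s => dB _ _ _ _ _ (grad_at_axis2 _ _ _ _ (hF (p.1 + h, s)))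
                (grad_at_axis2 _ _ _ _ (hF (p.1, s)))).
  rewrite [p.2 + h - p.2]addrAC subrr add0r => he2 E3.
  have [e1] := MVT_between (fun s => F2 (s, e2)) (fun s => F21 (s, e2)) p.1 (p.1 + h)
    (fun s => grad_at_axis1 _ _ _ _ (hF2 (s, e2))).
  rewrite [p.1 + h - p.1]addrAC subrr add0r => he1 E4.
  exists (c1, c2), (e1, e2); split => //.
  have : F12 (c1, c2) * h * h = F21 (e1, e2) * h * h.
    rewrite -E2 -E1 -E4 -E3; ring.
  by move=> /(mulIf h0) /(mulIf h0).
apply/eqP; rewrite -subr_eq0 -normr_le0 leNgt; apply/negP => e0.
set e := `|_| in e0.
have e3 : 0 < e / 2 by rewrite divr_gt0.
have near_both : \forall q \near p, `|F12 p - F12 q| < e / 2 /\ `|F21 p - F21 q| < e / 2.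
  move/cvgrPdist_lt : c12 => /(_ _ e3) c12; move/cvgrPdist_lt : c21 => /(_ _ e3) c21.
  by near=> q; split; near: q; assumption.
have /nbhs_ballP[r /= r0 Hr] := near_both.
have r2 : r / 2 != 0 by rewrite gt_eqF // divr_gt0.
have [q [q' [a1 a2 a3 a4 E]]] := key (r / 2) r2.
have small (z c : R) : `|z - c| <= `|r / 2| -> ball c r z.
  move=> h; rewrite /ball /= distrC (le_lt_trans h) // gtr0_norm ?divr_gt0 //.
  by rewrite ltr_pdivrMr // ltr_pMr // ltr1n.
have [b1 _] := Hr q (conj (small _ _ a1) (small _ _ a2)).
have [_ b2] := Hr q' (conj (small _ _ a3) (small _ _ a4)).
have : e < e / 2 + e / 2.
  apply: le_lt_trans (ltrD b1 b2).
  have -> : e = `|(F12 p - F12 q) - (F21 p - F21 q')| by rewrite /e E; congr `|_|; ring.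
  exact: ler_normB.
by rewrite -splitr ltxx.
Unshelve. all: by end_near. Qed.

End Jets.

(** * Symmetric 2 x 2 matrices and the comparison principle *)

Section QuadraticForms.
Context {R : realType}.
Implicit Types (a b c m n s : R).

Definition qf m11 m12 m22 a b : R := m11 * a ^+ 2 + 2 * m12 * (a * b) + m22 * b ^+ 2.

Lemma psd_det m11 m12 m22 : (forall a b, 0 <= qf m11 m12 m22 a b) ->
  0 <= m11 + m22 /\ 0 <= m11 * m22 - m12 ^+ 2.
Proof.
move=> h; have h1 := h 1 0; have h2 := h 0 1; rewrite /qf in h1 h2.
have p1 : 0 <= m11 by nra.
have p2 : 0 <= m22 by nra.
split; first by lra.
have [m20|m20] := ltrP 0 m22.
  have := h m22 (- m12); rewrite /qf => h3.
  have : 0 <= m22 * (m11 * m22 - m12 ^+ 2) by move: h3; congr (0 <= _); ring.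
  by rewrite pmulr_rge0.
have m2 : m22 = 0 by lra.
have m1 : m12 = 0.
  have [//|/eqP m10] := eqVneq m12 0.
  (* With [m22 = 0] the form at (1, b) is affine in b; this b gives the value -1. *)
  have := h 1 (- (m11 + 1) / (2 * m12)); rewrite /qf m2.
  have -> : m11 * 1 ^+ 2 + 2 * m12 * (1 * (- (m11 + 1) / (2 * m12))) +
    0 * (- (m11 + 1) / (2 * m12)) ^+ 2 = -1 by field; apply/eqP.
  by lra.
by rewrite m1 m2 expr0n /= mulr0 subr0.
Qed.

Lemma det_psd m11 m12 m22 : 0 <= m11 + m22 -> 0 <= m11 * m22 - m12 ^+ 2 ->
  forall a b, 0 <= qf m11 m12 m22 a b.
Proof.
move=> ht hd a b; rewrite /qf.
have p12 : 0 <= m11 * m22 by have := sqr_ge0 m12; lra.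
have p1 : 0 <= m11 by nra.
have p2 : 0 <= m22 by nra.
have h1 : 0 <= m11 * (m11 * a ^+ 2 + 2 * m12 * (a * b) + m22 * b ^+ 2).
  have -> : m11 * (m11 * a ^+ 2 + 2 * m12 * (a * b) + m22 * b ^+ 2) =
   (m11 * a + m12 * b) ^+ 2 + (m11 * m22 - m12 ^+ 2) * b ^+ 2 by ring.
  by rewrite addr_ge0 ?sqr_ge0 // mulr_ge0 ?sqr_ge0.
have [m0|m0] := ltrP 0 m11; first by move: h1; rewrite pmulr_rge0.
have m1 : m11 = 0 by lra.
have m2 : m12 = 0.
  by apply/eqP; rewrite -sqrf_eq0 eq_le sqr_ge0 andbT; rewrite m1 in hd; lra.
by rewrite m1 m2 !(mul0r, mulr0, add0r) mulr_ge0 ?sqr_ge0.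
Qed.

Lemma roots_ge0 (x y : R) : 0 <= x + y -> 0 <= x * y -> 0 <= x /\ 0 <= y.
Proof. by move=> h1 h2; split; nra. Qed.

(** Eigenvalues are carried by trace and determinant, so that no eigenvector or diagonalisation is
    ever needed. *)
Definition eig m11 m12 m22 (l1 l2 : R) :=
  l1 + l2 = m11 + m22 /\ l1 * l2 = m11 * m22 - m12 ^+ 2.

(** Weyl's monotonicity without eigenvectors. As l1 I - M and N - k2 I are nonnegative, so are (l1 +
    s) I - N and M + (s - k2) I; their determinants factor as (l1 + s - k1)(l1 + s - k2) and (l1 -
    k2 + s)(l2 - k2 + s), and with the traces this gives the sign of each factor. *)
Lemma weyl m11 m12 m22 n11 n12 n22 l1 l2 k1 k2 s :
  eig m11 m12 m22 l1 l2 -> l2 <= l1 -> eig n11 n12 n22 k1 k2 -> k2 <= k1 ->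
  (forall a b, qf n11 n12 n22 a b <= qf m11 m12 m22 a b + s * (a ^+ 2 + b ^+ 2)) ->
  k1 <= l1 + s /\ k2 <= l2 + s.
Proof.
move=> [mt md] l21 [nt nd] k21 h.
have A : forall a b, 0 <= qf (l1 - m11) (- m12) (l1 - m22) a b.
  apply: det_psd; first by lra.
  have -> : (l1 - m11) * (l1 - m22) - (- m12) ^+ 2 =
    l1 ^+ 2 - l1 * (m11 + m22) + (m11 * m22 - m12 ^+ 2) by ring.
  by rewrite -mt -md; have -> : l1 ^+ 2 - l1 * (l1 + l2) + l1 * l2 = 0 by ring.
have B : forall a b, 0 <= qf (n11 - k2) n12 (n22 - k2) a b.
  apply: det_psd; first by lra.
  have -> : (n11 - k2) * (n22 - k2) - n12 ^+ 2 =
    k2 ^+ 2 - k2 * (n11 + n22) + (n11 * n22 - n12 ^+ 2) by ring.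
  by rewrite -nt -nd; have -> : k2 ^+ 2 - k2 * (k1 + k2) + k1 * k2 = 0 by ring.
have A' : forall a b, 0 <= qf (l1 + s - n11) (- n12) (l1 + s - n22) a b.
  move=> a b; apply: le_trans (A a b) _; rewrite -subr_ge0.
  have := h a b; rewrite -subr_ge0; congr (0 <= _); rewrite /qf; ring.
have B' : forall a b, 0 <= qf (m11 - k2 + s) m12 (m22 - k2 + s) a b.
  move=> a b; apply: le_trans (B a b) _; rewrite -subr_ge0.
  have := h a b; rewrite -subr_ge0; congr (0 <= _); rewrite /qf; ring.
have [At Ad] := psd_det _ _ _ A'; have [Bt Bd] := psd_det _ _ _ B'.
have [+ _] : 0 <= l1 + s - k1 /\ 0 <= l1 + s - k2.
  apply: roots_ge0; first by lra.
  have -> : (l1 + s - k1) * (l1 + s - k2) =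
    (l1 + s) ^+ 2 - (l1 + s) * (k1 + k2) + k1 * k2 by ring.
  by rewrite nt nd; move: Ad; congr (0 <= _); ring.
have [_ +] : 0 <= l1 - k2 + s /\ 0 <= l2 - k2 + s.
  apply: roots_ge0; first by lra.
  have -> : (l1 - k2 + s) * (l2 - k2 + s) =
    (k2 - s) ^+ 2 - (k2 - s) * (l1 + l2) + l1 * l2 by ring.
  by rewrite mt md; move: Bd; congr (0 <= _); ring.
by move=> h1 h2; lra.
Qed.

End QuadraticForms.

Section Elliptic.
Context {R : realType}.

Lemma MVT_seg (f df : R -> R) (a b : R) : a <= b ->
  (forall x, a <= x <= b -> is_derive x (1 : R) f (df x)) ->
  exists2 c, a <= c <= b & f b - f a = df c * (b - a).
Proof.
move=> ab h.
have h' x : x \in `]a, b[%R -> is_derive x (1 : R) f (df x).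
  by rewrite in_itv /= => /andP[/ltW h1 /ltW h2]; apply: h; rewrite h1.
have c : {within `[a, b], continuous f}.
  by apply: derivable_within_continuous => x; rewrite in_itv /= => /h [].
by have [z] := MVT_segment ab h' c; rewrite in_itv /= => zab E; exists z.
Qed.

(* The cone [Gamma_p], with [q = 2 - p]. *)
Definition cone (q : R) (l : R * R) : Prop := 0 < l.2 + q * l.1 /\ 0 < l.1 + q * l.2.

Record elliptic (q : R) (G G1 G2 : R * R -> R) : Prop := Elliptic {
  ell_q0 : 0 <= q;
  ell_q1 : q < 1;
  ell_sym : forall x y : R, cone q (x, y) -> G (y, x) = G (x, y);
  ell_d1 : forall l, cone q l -> is_derive l.1 (1 : R) (fun t => G (t, l.2)) (G1 l);
  ell_d2 : forall l, cone q l -> is_derive l.2 (1 : R) (fun t => G (l.1, t)) (G2 l);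
  ell_pos : forall l, cone q l -> 0 < G1 l /\ 0 < G2 l;
  ell_cont : forall l, cone q l -> {for l, continuous G1} /\ {for l, continuous G2}
}.

Context {q : R} {G G1 G2 : R * R -> R} (ell : elliptic q G G1 G2).

(** The equation as a property of a symmetric matrix, expressed by invariants only; hence it is
    stable under orthogonal conjugation. *)
Definition good (m11 m12 m22 : R) : Prop :=
  exists l : R * R, [/\ eig m11 m12 m22 l.1 l.2, cone q l & G l = 1].

Lemma good_ordered m11 m12 m22 : good m11 m12 m22 ->
  exists l1 l2 : R, [/\ eig m11 m12 m22 l1 l2, l2 <= l1, cone q (l1, l2) & G (l1, l2) = 1].
Proof.
move=> [[x y] /= [[h1 h2] hc hG]].
have [yx|/ltW xy] := lerP y x; first by exists x, y.
exists y, x; split=> //; last by rewrite (ell_sym _ _ _ _ ell).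
- by split; lra.
- by case: hc => /= c1 c2; split => /=.
Qed.

Lemma cone_mono (x y x' y' : R) : cone q (x, y) -> x <= x' -> y <= y' -> cone q (x', y').
Proof. by have q0 := ell_q0 _ _ _ _ ell => -[/= h1 h2] xx yy; split => /=; nra. Qed.

Lemma cone_trace (x y : R) : cone q (x, y) -> 0 < x + y.
Proof.
have q0 := ell_q0 _ _ _ _ ell; move=> [/= h1 h2].
have : 0 < (1 + q) * (x + y) by lra.
by rewrite pmulr_rgt0 //; lra.
Qed.

(** The path runs along one axis and then along the other; both legs stay in the cone because the
    cone is closed under increasing either coordinate. *)
Lemma ell_mono (x y x' y' : R) : cone q (x, y) -> x <= x' -> y <= y' -> G (x, y) <= G (x', y').
Proof.
move=> c xx yy; apply: (@le_trans _ _ (G (x', y))).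
  have [t /andP[t1 t2]] := MVT_seg (fun t => G (t, y)) (fun t => G1 (t, y)) x x' xx
    (fun t ht => ell_d1 _ _ _ _ ell (t, y)
       (cone_mono _ _ _ _ c (proj1 (andP ht)) (lexx y))).
  rewrite -subr_ge0 => ->; rewrite mulr_ge0 ?subr_ge0 // ltW //.
  by have [] := ell_pos _ _ _ _ ell (t, y) (cone_mono _ _ _ _ c t1 (lexx y)).
have c' := cone_mono _ _ _ _ c xx (lexx y).
have [t /andP[t1 t2]] := MVT_seg (fun t => G (x', t)) (fun t => G2 (x', t)) y y' yy
    (fun t ht => ell_d2 _ _ _ _ ell (x', t)
       (cone_mono _ _ _ _ c' (lexx x') (proj1 (andP ht)))).
rewrite -subr_ge0 => ->; rewrite mulr_ge0 ?subr_ge0 // ltW //.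
by have [] := ell_pos _ _ _ _ ell (x', t) (cone_mono _ _ _ _ c' (lexx x') t1).
Qed.

Lemma ell_box (l : R * R) : cone q l -> exists r a b : R, [/\ 0 < r, 0 < a &
  forall x y : R, `|x - l.1| < r -> `|y - l.2| < r ->
    [/\ cone q (x, y), a <= G1 (x, y) <= b & a <= G2 (x, y) <= b]].
Proof.
move=> c; have [p1 p2] := ell_pos _ _ _ _ ell l c.
have [k1 k2] := ell_cont _ _ _ _ ell l c.
have q0 := ell_q0 _ _ _ _ ell; have q1 := ell_q1 _ _ _ _ ell.
pose a := Num.min (G1 l) (G2 l) / 2; pose b := Num.max (G1 l) (G2 l) + 1.
have a0 : 0 < a by rewrite /a divr_gt0 // lt_min p1 p2.
have ha : a < G1 l /\ a < G2 l.
  have h1 : Num.min (G1 l) (G2 l) <= G1 l by rewrite ge_min lexx.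
  have h2 : Num.min (G1 l) (G2 l) <= G2 l by rewrite ge_min lexx orbT.
  by rewrite /a; rewrite /a in a0; split; lra.
have hb : G1 l < b /\ G2 l < b.
  have h1 : G1 l <= Num.max (G1 l) (G2 l) by rewrite le_max lexx.
  have h2 : G2 l <= Num.max (G1 l) (G2 l) by rewrite le_max lexx orbT.
  by rewrite /b; split; lra.
have near_ab : \forall z \near l, [/\ a < G1 z, a < G2 z, G1 z < b & G2 z < b].
  move: (k1) => /cvgr_lt /(_ _ (proj1 hb)) n1; move: (k1) => /cvgr_gt /(_ _ (proj1 ha)) n2.
  move: (k2) => /cvgr_lt /(_ _ (proj2 hb)) n3; move: (k2) => /cvgr_gt /(_ _ (proj2 ha)) n4.
  by near=> z; split; near: z; assumption.
have /nbhs_ballP[r0 /= r00 Hr0] := near_ab.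
case: c => c1 c2.
(* On a box of half-side r each linear form defining the cone moves by less than (1 + q) r, which is
   at most 2 r; hence the halves. *)
pose r := Num.min r0 (Num.min ((l.2 + q * l.1) / 2) ((l.1 + q * l.2) / 2)).
exists r, a, b; split => //.
  by rewrite /r !lt_min r00 !divr_gt0.
move=> x y; rewrite /r !lt_min => /and3P[x1 x2 x3] /and3P[y1 y2 y3].
have [g1 g2 g3 g4] : [/\ a < G1 (x, y), a < G2 (x, y), G1 (x, y) < b & G2 (x, y) < b].
  by apply: Hr0; split; rewrite /= /ball /= distrC.
split; last 2 first.
- by rewrite !ltW.
- by rewrite !ltW.
move: x1 x2 x3 y1 y2 y3; rewrite !ltr_norml.
move=> /andP[? ?] /andP[? ?] /andP[? ?] /andP[? ?] /andP[? ?] /andP[? ?].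
by split => /=; nra.
Unshelve. all: by end_near. Qed.

Lemma qf_close (m11 m12 m22 n11 n12 n22 e : R) :
  `|m11 - n11| <= e -> `|m12 - n12| <= e -> `|m22 - n22| <= e ->
  forall a b, qf m11 m12 m22 a b <= qf n11 n12 n22 a b + 2 * e * (a ^+ 2 + b ^+ 2).
Proof.
rewrite !ler_norml => /andP[h1 h2] /andP[h3 h4] /andP[h5 h6] a b; rewrite /qf.
have k1 : (m11 - n11) * a ^+ 2 <= e * a ^+ 2 by rewrite ler_wpM2r ?sqr_ge0.
have k2 : (m22 - n22) * b ^+ 2 <= e * b ^+ 2 by rewrite ler_wpM2r ?sqr_ge0.
have k3 : 2 * (m12 - n12) * (a * b) <= e * (a ^+ 2 + b ^+ 2).
  have e1 : 0 <= (e - (m12 - n12)) * (a + b) ^+ 2.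
    by rewrite mulr_ge0 ?sqr_ge0 // subr_ge0.
  have e2 : 0 <= (e + (m12 - n12)) * (a - b) ^+ 2.
    by rewrite mulr_ge0 ?sqr_ge0 //; lra.
  nra.
lra.
Qed.

Lemma dist_lt_of_bounds (z r x : R) : z - r < x -> x < z + r -> `|x - z| < r.
Proof. by move=> ? ?; rewrite ltr_norml; apply/andP; split; lra. Qed.

Section Tradeoff.
Variables (z1 z2 r mm MM k : R).
Hypothesis box : forall x y : R, `|x - z1| < r -> `|y - z2| < r ->
    [/\ cone q (x, y), mm <= G1 (x, y) <= MM & mm <= G2 (x, y) <= MM].
Hypotheses (mm0 : 0 < mm) (mk : mm * k = MM + mm).

Let gain (s : R) : 0 < s -> MM * s < mm * (s * k).
Proof.
move=> s0; have -> : mm * (s * k) = s * (MM + mm) by rewrite -mk; ring.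
by rewrite mulrC ltr_pM2l // ltrDl.
Qed.

(** By monotonicity it suffices to bound [G] at the corner (l1 - s k, l2 + s). From there to (l1,
    l2), lowering the second coordinate costs at most MM s while raising the first gains at least mm
    s k = (MM + mm) s. Only this corner path has to lie in the box; (p1, p2) may be anywhere in the
    cone. *)
Lemma ell_tradeoff1 (l1 l2 s p1 p2 : R) : 0 < s -> 0 < s * k ->
  z1 - r < l1 - s * k -> l1 < z1 + r -> z2 - r < l2 -> l2 + s < z2 + r ->
  p1 <= l1 - s * k -> p2 <= l2 + s -> cone q (p1, p2) -> G (p1, p2) < G (l1, l2).
Proof.
move=> s0 sk0 a1 a2 a3 a4 hp1 hp2 cp.
have b1 (x : R) : l1 - s * k <= x <= l1 -> `|x - z1| < r.
  move=> /andP[h1 h2]; apply: dist_lt_of_bounds.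
    exact: lt_le_trans h1.
  exact: le_lt_trans h2 a2.
have b2 (y : R) : l2 <= y <= l2 + s -> `|y - z2| < r.
  move=> /andP[h1 h2]; apply: dist_lt_of_bounds.
    exact: lt_le_trans h1.
  exact: le_lt_trans h2 a4.
have i1 : l1 - s * k <= l1 by rewrite gerBl ltW.
have i2 : l2 <= l2 + s by rewrite lerDl ltW.
have j1 : l1 - s * k <= l1 - s * k <= l1 by rewrite lexx.
have j2 : l2 <= l2 <= l2 + s by rewrite lexx.
apply: le_lt_trans (ell_mono _ _ _ _ cp hp1 hp2) _.
have [t ht E1] := MVT_seg (fun t => G (l1 - s * k, t))
    (fun t => G2 (l1 - s * k, t)) l2 (l2 + s) i2 (fun t ht =>
     ell_d2 _ _ _ _ ell (l1 - s * k, t) (let: And3 h _ _ := box _ _ (b1 _ j1) (b2 _ ht) in h)).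
have [u hu E2] := MVT_seg (fun t => G (t, l2))
    (fun t => G1 (t, l2)) (l1 - s * k) l1 i1 (fun t ht =>
     ell_d1 _ _ _ _ ell (t, l2) (let: And3 h _ _ := box _ _ (b1 _ ht) (b2 _ j2) in h)).
have [_ _ /andP[_ B1]] := box _ _ (b1 _ j1) (b2 _ ht).
have [_ /andP[B2 _] _] := box _ _ (b1 _ hu) (b2 _ j2).
have F1 : G2 (l1 - s * k, t) * (l2 + s - l2) <= MM * s.
  by rewrite [l2 + s]addrC addrK ler_wpM2r // ltW.
have F2 : mm * (s * k) <= G1 (u, l2) * (l1 - (l1 - s * k)).
  by rewrite opprB addrC subrK ler_wpM2r // ltW.
have := gain s s0.
rewrite -E1 in F1; rewrite -E2 in F2.
by clear - ell box mm0 mk gain F1 F2; lra.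
Qed.

Lemma ell_tradeoff2 (l1 l2 s p1 p2 : R) : 0 < s -> 0 < s * k ->
  z2 - r < l2 - s * k -> l2 < z2 + r -> z1 - r < l1 -> l1 + s < z1 + r ->
  p1 <= l1 + s -> p2 <= l2 - s * k -> cone q (p1, p2) -> G (p1, p2) < G (l1, l2).
Proof.
move=> s0 sk0 a1 a2 a3 a4 hp1 hp2 cp.
have b2 (x : R) : l2 - s * k <= x <= l2 -> `|x - z2| < r.
  move=> /andP[h1 h2]; apply: dist_lt_of_bounds.
    exact: lt_le_trans h1.
  exact: le_lt_trans h2 a2.
have b1 (y : R) : l1 <= y <= l1 + s -> `|y - z1| < r.
  move=> /andP[h1 h2]; apply: dist_lt_of_bounds.
    exact: lt_le_trans h1.
  exact: le_lt_trans h2 a4.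
have i2 : l2 - s * k <= l2 by rewrite gerBl ltW.
have i1 : l1 <= l1 + s by rewrite lerDl ltW.
have j2 : l2 - s * k <= l2 - s * k <= l2 by rewrite lexx.
have j1 : l1 <= l1 <= l1 + s by rewrite lexx.
apply: le_lt_trans (ell_mono _ _ _ _ cp hp1 hp2) _.
have [t ht E1] := MVT_seg (fun t => G (t, l2 - s * k))
    (fun t => G1 (t, l2 - s * k)) l1 (l1 + s) i1 (fun t ht =>
     ell_d1 _ _ _ _ ell (t, l2 - s * k) (let: And3 h _ _ := box _ _ (b1 _ ht) (b2 _ j2) in h)).
have [u hu E2] := MVT_seg (fun t => G (l1, t))
    (fun t => G2 (l1, t)) (l2 - s * k) l2 i2 (fun t ht =>
     ell_d2 _ _ _ _ ell (l1, t) (let: And3 h _ _ := box _ _ (b1 _ j1) (b2 _ ht) in h)).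
have [_ /andP[_ B1] _] := box _ _ (b1 _ ht) (b2 _ j2).
have [_ _ /andP[B2 _]] := box _ _ (b1 _ j1) (b2 _ hu).
have F1 : G1 (t, l2 - s * k) * (l1 + s - l1) <= MM * s.
  by rewrite [l1 + s]addrC addrK ler_wpM2r // ltW.
have F2 : mm * (s * k) <= G2 (l1, u) * (l2 - (l2 - s * k)).
  by rewrite opprB addrC subrK ler_wpM2r // ltW.
have := gain s s0.
rewrite -E1 in F1; rewrite -E2 in F2.
by clear - ell box mm0 mk gain F1 F2; lra.
Qed.

End Tradeoff.

(* If [N <= M + s (I - K e (x) e)] then the eigenvalues of [N] are at most [s] above
   those of [M] while their sum is at least [(K - 2) s] below; for large [K] this
   forces [f] to decrease. *)
Lemma comparison_local (m011 m012 m022 : R) : good m011 m012 m022 ->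
  exists K eta : R, [/\ 0 < K, 0 < eta &
  forall m11 m12 m22 n11 n12 n22 s e1 e2 : R,
    `|m11 - m011| < eta -> `|m12 - m012| < eta -> `|m22 - m022| < eta ->
    good m11 m12 m22 -> good n11 n12 n22 -> 0 < s -> s < eta ->
    e1 ^+ 2 + e2 ^+ 2 = 1 ->
    (forall a b, qf n11 n12 n22 a b <= qf m11 m12 m22 a b +
       s * ((a ^+ 2 + b ^+ 2) - K * (e1 * a + e2 * b) ^+ 2)) -> False].
Proof.
move=> /good_ordered[z1 [z2 [eo z21 co Go]]].
have [r [mm [MM [r0 mm0 box]]]] := ell_box _ co.
have mM : mm <= MM.
  have zz (z : R) : `|z - z| < r by rewrite subrr normr0.
  have [_ /andP[h1 h2] _] := box z1 z2 (zz _) (zz _).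
  exact: le_trans h2.
pose k := MM / mm + 1.
have k1 : 1 <= k by rewrite /k lerDr divr_ge0 ?ltW // (lt_le_trans mm0 mM).
have mk : mm * k = MM + mm by rewrite /k; field; rewrite gt_eqF.
(* The eigenvalues of M are within 2 eta of (z1, z2), and the corner path of [ell_tradeoff1] adds at
   most s < eta upwards and s k < eta k downwards; these fit in the box since 3 eta + eta k = r. *)
pose eta := r / (k + 3).
have k30 : 0 < k + 3 by clear - ell k1; lra.
have eta0 : 0 < eta by rewrite divr_gt0.
have etak : eta * (k + 3) = r by rewrite /eta divfK // gt_eqF.
(* The trace of s (I - K e e^T) is (2 - K) s = - 2 s k, so at least one of the two eigenvalues drops
   by s k. *)
exists (2 + 2 * k), eta; split => //; first by clear - ell k1; lra.
move=> m11 m12 m22 n11 n12 n22 s e1 e2 h1 h2 h3 /good_ordered[l1 [l2 [el l21 cl Gl]]].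
move=> /good_ordered[p1 [p2 [ep p21 cp Gp]]] s0 se e12 H.
have hweyl a b : qf n11 n12 n22 a b <= qf m11 m12 m22 a b + s * (a ^+ 2 + b ^+ 2).
  apply: le_trans (H a b) _; rewrite lerD2l ler_wpM2l ?(ltW s0) // gerBl.
  by rewrite mulr_ge0 ?sqr_ge0 //; clear - ell k1; lra.
have [w1 w2] := weyl _ _ _ _ _ _ _ _ _ _ _ el l21 ep p21 hweyl.
have [c1 c2] := weyl _ _ _ _ _ _ _ _ _ _ _ eo z21 el l21
  (qf_close _ _ _ _ _ _ _ (ltW h1) (ltW h2) (ltW h3)).
have [d1 d2] : z1 <= l1 + 2 * eta /\ z2 <= l2 + 2 * eta.
  apply: (weyl _ _ _ _ _ _ _ _ _ _ _ el l21 eo z21).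
  by apply: qf_close; rewrite distrC ltW.
have tr : p1 + p2 <= l1 + l2 - 2 * (s * k).
  have [-> _] := ep; have [-> _] := el.
  have := lerD (H 1 0) (H 0 1); rewrite /qf.
  rewrite !(mulr0, mulr1, expr1n, expr0n, addr0, add0r) /= => hh.
  have : s * (1 - (2 + 2 * k) * e1 ^+ 2) + s * (1 - (2 + 2 * k) * e2 ^+ 2) = - 2 * (s * k).
    have -> : e2 ^+ 2 = 1 - e1 ^+ 2 by rewrite -e12; ring.
    ring.
  by clear - ell hh; lra.
have sk0 : 0 < s * k by rewrite mulr_gt0 // (lt_le_trans _ k1).
have sk : s * k < eta * k by rewrite ltr_pM2r // (lt_le_trans _ k1).
have etar : 3 * eta + eta * k = r by rewrite -etak; ring.
have d12 : p1 <= l1 - s * k \/ p2 <= l2 - s * k.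
  have [|h] := lerP p1 (l1 - s * k); first by left.
  by right; clear - ell h tr; lra.
have [i1 i2 i3 i4] : [/\ z1 - r < l1 - s * k, l1 < z1 + r, z2 - r < l2 & l2 + s < z2 + r].
  clear - ell c1 c2 d1 d2 sk se s0 sk0 eta0 etar; split; lra.
have [i5 i6 i7 i8] : [/\ z2 - r < l2 - s * k, l2 < z2 + r, z1 - r < l1 & l1 + s < z1 + r].
  clear - ell c1 c2 d1 d2 sk se s0 sk0 eta0 etar; split; lra.
have : G (p1, p2) < G (l1, l2).
  case: d12 => hp.
    exact: (ell_tradeoff1 z1 z2 r mm MM k box mm0 mk l1 l2 s).
  exact: (ell_tradeoff2 z1 z2 r mm MM k box mm0 mk l1 l2 s).
by rewrite Gp Gl ltxx.
Qed.

(** In an orthonormal frame the diagonal entries x, y satisfy x + y = l1 + l2 and x <= l1, so y + q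
    x = l1 + l2 - (1 - q) x is at least l2 + q l1, which is positive. The bound x <= l1 comes from
    (x - l1)(x - l2) being minus the square of the off-diagonal entry. *)
Lemma good_cone (m11 m12 m22 e1 e2 : R) : good m11 m12 m22 -> e1 ^+ 2 + e2 ^+ 2 = 1 ->
  0 < qf m11 m12 m22 (- e2) e1 + q * qf m11 m12 m22 e1 e2.
Proof.
move=> /good_ordered[l1 [l2 [[ht hd] l21 [/= c1 c2] _]]] e12.
have q0 := ell_q0 _ _ _ _ ell; have q1 := ell_q1 _ _ _ _ ell.
set x := qf _ _ _ e1 e2; set y := qf _ _ _ _ _.
have xy : x + y = l1 + l2.
  rewrite ht /x /y /qf.
  have -> : e2 ^+ 2 = 1 - e1 ^+ 2 by lra.
  have -> : (- e2) ^+ 2 = 1 - e1 ^+ 2 by rewrite sqrrN; lra.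
  ring.
have xy2 : x * y - (m12 * (e1 ^+ 2 - e2 ^+ 2) + (m22 - m11) * (e1 * e2)) ^+ 2 = l1 * l2.
  have -> : l1 * l2 = (m11 * m22 - m12 ^+ 2) * (e1 ^+ 2 + e2 ^+ 2) ^+ 2.
    by rewrite hd e12 expr1n mulr1.
  rewrite /x /y /qf; ring.
have prod : (x - l1) * (x - l2) <= 0.
  have -> : (x - l1) * (x - l2) = - (x * y - l1 * l2).
    have -> : y = l1 + l2 - x by lra.
    ring.
  by rewrite oppr_le0 -xy2 opprB addrC subrK sqr_ge0.
have xl1 : x <= l1 by rewrite leNgt; apply/negP => h; nra.
have -> : y = l1 + l2 - x by lra.
nra.
Qed.

Lemma good_trace (m11 m12 m22 : R) : good m11 m12 m22 -> 0 < m11 + m22.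
Proof. by move=> [[x y] /= [[<- _] /cone_trace]]. Qed.

End Elliptic.

(** * Compactness in the plane *)

Section Plane.
Context {R : realType}.
Implicit Types (F G : R * R -> R) (p q z : R * R).

Definition dsq z p : R := (p.1 - z.1) ^+ 2 + (p.2 - z.2) ^+ 2.
Definition nsq p : R := p.1 ^+ 2 + p.2 ^+ 2.

Lemma contD (T : topologicalType) (f g : T -> R) (x : T) : {for x, continuous f} ->
  {for x, continuous g} -> {for x, continuous (fun t => f t + g t)}.
Proof. by move=> hf hg; apply: cvgD. Qed.
Lemma contM (T : topologicalType) (f g : T -> R) (x : T) : {for x, continuous f} ->
  {for x, continuous g} -> {for x, continuous (fun t => f t * g t)}.
Proof. by move=> hf hg; apply: cvgM. Qed.
Lemma contB (T : topologicalType) (f g : T -> R) (x : T) : {for x, continuous f} ->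
  {for x, continuous g} -> {for x, continuous (fun t => f t - g t)}.
Proof. by move=> hf hg; apply: cvgB. Qed.
Lemma contV (T : topologicalType) (f : T -> R) (x : T) : f x != 0 ->
  {for x, continuous f} -> {for x, continuous (fun t => (f t)^-1)}.
Proof. by move=> h0 hf; apply: cvgV. Qed.
Lemma contX (T : topologicalType) (f : T -> R) (x : T) n : {for x, continuous f} ->
  {for x, continuous (fun t => f t ^+ n)}.
Proof. by move=> hf; apply: (@continuous_comp _ _ _ f (fun y => y ^+ n)) => //; exact: exprn_continuous. Qed.
Lemma cont_cst (T : topologicalType) (c : R) (x : T) : {for x, continuous (fun=> c)}.
Proof. exact: cst_continuous. Qed.
Lemma cont_fst p : {for p, continuous (@fst R R)}.
Proof. exact: cvg_fst. Qed.
Lemma cont_snd p : {for p, continuous (@snd R R)}.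
Proof. exact: cvg_snd. Qed.
Lemma cont_comp (T : topologicalType) (k : R -> R) (f : T -> R) (x : T) :
  {for x, continuous f} -> {for f x, continuous k} -> {for x, continuous (fun t => k (f t))}.
Proof. by move=> hf hk; apply: (@continuous_comp _ _ _ f k). Qed.

Lemma cont_nsq p : {for p, continuous nsq}.
Proof. by apply: contD; apply: contX; [exact: cont_fst | exact: cont_snd]. Qed.
Lemma cont_dsq z p : {for p, continuous (dsq z)}.
Proof.
by apply: contD; apply: contX; apply: contB; do ?[exact: cont_cst];
  [exact: cont_fst | exact: cont_snd].
Qed.

Lemma sqr_le_norm (x r : R) : 0 <= r -> x ^+ 2 <= r ^+ 2 -> `|x| <= r.
Proof. by move=> r0; rewrite -real_normK ?num_real // ler_pXn2r // nnegrE. Qed.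

Lemma closed_dsq_ge z (a : R) : closed [set p | a <= dsq z p].
Proof.
have := @preimage_closed _ _ (dsq z) [set x | a <= x]; apply; last exact: closed_ge.
by move=> p _; exact: cont_dsq.
Qed.

Lemma closed_dsq_le z (a : R) : closed [set p | dsq z p <= a].
Proof.
have := @preimage_closed _ _ (dsq z) [set x | x <= a]; apply; last exact: closed_le.
by move=> p _; exact: cont_dsq.
Qed.

Lemma compact_annulus z (a b : R) : compact [set p | a <= dsq z p <= b].
Proof.
have -> : [set p | a <= dsq z p <= b] = [set p | a <= dsq z p] `&` [set p | dsq z p <= b].
  by apply/seteqP; split => p /=; [move=> /andP[] | move=> [-> ->]].
pose r := `|b| + 1.
have br : b <= r ^+ 2.
  have h1 := ler_norm b; have h2 := normr_ge0 b.
  by rewrite /r; nra.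
have r0 : 0 <= r by rewrite addr_ge0.
apply: (@subclosed_compact _ _ (`[z.1 - r, z.1 + r] `*` `[z.2 - r, z.2 + r])).
- by apply: closedI; [exact: closed_dsq_ge | exact: closed_dsq_le].
- by apply: compact_setX; exact: segment_compact.
- move=> p /= [_ pb]; rewrite /= !in_itv /=.
  have h1 : `|p.1 - z.1| <= r.
    apply: sqr_le_norm => //; apply: le_trans br; apply: le_trans pb.
    by rewrite /dsq lerDl sqr_ge0.
  have h2 : `|p.2 - z.2| <= r.
    apply: sqr_le_norm => //; apply: le_trans br; apply: le_trans pb.
    by rewrite /dsq lerDr sqr_ge0.
  move: h1 h2; rewrite !ler_norml => /andP[? ?] /andP[? ?].
  by split; apply/andP; split; lra.
Qed.

Lemma within_for (K : set (R * R)) F : (forall q, K q -> {for q, continuous F}) ->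
  {within K, continuous F}.
Proof. by move=> h; apply: continuous_in_subspaceT => q; rewrite inE => /h. Qed.

Lemma min_on_compact (K : set (R * R)) F : K !=set0 -> compact K ->
  (forall q, K q -> {for q, continuous F}) ->
  exists2 c, K c & forall q, K q -> F c <= F q.
Proof.
move=> K0 cK /within_for cF; have [c] := compact_EVT_min K0 cK cF.
by rewrite inE => Kc h; exists c => // q Kq; apply: h; rewrite inE.
Qed.

Lemma max_on_compact (K : set (R * R)) F : K !=set0 -> compact K ->
  (forall q, K q -> {for q, continuous F}) ->
  exists2 c, K c & forall q, K q -> F q <= F c.
Proof.
move=> K0 cK /within_for cF; have [c] := compact_EVT_max K0 cK cF.
by rewrite inE => Kc h; exists c => // q Kq; apply: h; rewrite inE.
Qed.

(** A sequence of counterexamples, one for each n, would have a cluster point, and the local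
    property there contradicts monotonicity in n. *)
Lemma compact_uniform (K : set (R * R)) (P : nat -> R * R -> Prop) : compact K ->
  (forall n m q, (n <= m)%N -> P n q -> P m q) ->
  (forall y, K y -> exists n, \forall q \near y, P n q) ->
  exists n, forall q, K q -> P n q.
Proof.
move=> cK mono loc; apply: contrapT => /forallNP h.
have /choice[y hy] : forall n, exists q, K q /\ ~ P n q.
  move=> n; apply: contrapT => /forallNP h'; apply: (h n) => q Kq.
  by apply: contrapT => h''; apply: (h' q).
have [|y0 [Ky0 cl]] := cK (y @ \oo) _.
  by exists 0%N => // n _; case: (hy n).
have [n0 hn0] := loc y0 Ky0.
have tail : (y @ \oo) [set q | exists2 n, (n0 <= n)%N & q = y n].
  by exists n0 => // n /= n0n; exists n.
have [q [[n n0n ->] Pn]] := cl _ _ tail hn0.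
by case: (hy n) => _; apply; apply: mono Pn.
Qed.

Lemma inv_nat_lt (e : R) : 0 < e -> exists n : nat, n.+1%:R^-1 < e.
Proof.
move=> e0; exists (Num.truncn e^-1); rewrite invf_plt ?posrE //.
exact: truncnS_gt.
Qed.

(** [C1_on] records the continuity of the partials but not that of the function, which is recovered
    here from local boundedness of the gradient. *)
Lemma for_continuous_C1 F F1 F2 p : (forall q, grad_at F q (F1 q) (F2 q)) ->
  {for p, continuous F1} -> {for p, continuous F2} -> {for p, continuous F}.
Proof.
move=> hF c1 c2.
pose M := Num.max `|F1 p| `|F2 p| + 1.
have M0 : 0 < M by rewrite /M ltr_wpDl // le_max normr_ge0.
have hM : `|F1 p| < M /\ `|F2 p| < M.
  by split; rewrite /M ltr_pwDr // le_max lexx ?orbT.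
have [r /= r0 Hr] : exists2 r : R, 0 < r & forall q, ball p r q -> `|F1 q| < M /\ `|F2 q| < M.
  have n1 : \forall q \near p, `|F1 q| < M.
    by move/cvg_norm/cvgr_lt : c1; apply; exact: (proj1 hM).
  have n2 : \forall q \near p, `|F2 q| < M.
    by move/cvg_norm/cvgr_lt : c2; apply; exact: (proj2 hM).
  have nb : \forall q \near p, `|F1 q| < M /\ `|F2 q| < M.
    by near=> q; split; near: q; assumption.
  by have /nbhs_ballP[r /= r0 Hr] := nb; exists r.
apply/cvgrPdist_le => e e0.
have m0 : 0 < Num.min r (e / (2 * M)) by rewrite lt_min r0 divr_gt0 // mulr_gt0.
have := nbhsx_ballx p _ m0; apply: filterS => q [/=]; rewrite /ball /= !lt_min => /andP[a1 a2] /andP[b1 b2].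
have [x hx E1] := MVT_between (fun s => F (s, q.2)) (fun s => F1 (s, q.2)) p.1 q.1
  (fun s => grad_at_axis1 _ _ _ _ (hF (s, q.2))).
have [y hy E2] := MVT_between (fun s => F (p.1, s)) (fun s => F2 (p.1, s)) p.2 q.2
  (fun s => grad_at_axis2 _ _ _ _ (hF (p.1, s))).
have -> : F p - F q = - (F1 (x, q.2) * (q.1 - p.1) + F2 (p.1, y) * (q.2 - p.2)).
  by rewrite -E1 -E2 -!surjective_pairing; ring.
rewrite normrN (le_trans (ler_normD _ _)) // !normrM.
have [B1 _] : `|F1 (x, q.2)| < M /\ `|F2 (x, q.2)| < M.
  apply: Hr; split => //=; rewrite /ball /= distrC; apply: le_lt_trans hx _.
  by rewrite distrC.
have [_ B2] : `|F1 (p.1, y)| < M /\ `|F2 (p.1, y)| < M.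
  apply: Hr; split => /=; rewrite /ball /= ?subrr ?normr0 // distrC.
  by apply: le_lt_trans hy _; rewrite distrC.
have k (A d : R) : A < M -> 0 <= A -> 0 <= d -> d < e / (2 * M) -> A * d <= e / 2.
  move=> h1 h2 h3 h4; have -> : e / 2 = M * (e / (2 * M)) by field; rewrite gt_eqF.
  by apply: ler_pM => //; apply: ltW.
rewrite [leRHS]splitr lerD // k // ?normr_ge0 // distrC //.
Unshelve. all: by end_near. Qed.

End Plane.

(** * Solutions *)

Section Solutions.
Context {R : realType} {q : R} {G G1 G2 : R * R -> R} (ell : elliptic q G G1 G2).

Definition Adiag (v g1 g2 h : R) : R := 2 * v * h - (g1 ^+ 2 + g2 ^+ 2).
Definition Aoff (v h : R) : R := 2 * v * h.

(* With [w = exp (- u / 2)] the matrix [A^u] is [2 w D^2 w - |D w|^2 I]. *)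
Record solution := Solution {
  sw :> R * R -> R;
  sw1 : R * R -> R; sw2 : R * R -> R;
  sw11 : R * R -> R; sw12 : R * R -> R; sw22 : R * R -> R;
  sw_pos : forall p, 0 < sw p;
  sw_grad : forall p, grad_at sw p (sw1 p) (sw2 p);
  sw1_grad : forall p, grad_at sw1 p (sw11 p) (sw12 p);
  sw2_grad : forall p, grad_at sw2 p (sw12 p) (sw22 p);
  sw_cont : forall p, {for p, continuous sw};
  sw1_cont : forall p, {for p, continuous sw1};
  sw2_cont : forall p, {for p, continuous sw2};
  sw11_cont : forall p, {for p, continuous sw11};
  sw12_cont : forall p, {for p, continuous sw12};
  sw22_cont : forall p, {for p, continuous sw22};
  sw_good : forall p, @good R q G (Adiag (sw p) (sw1 p) (sw2 p) (sw11 p))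
     (Aoff (sw p) (sw12 p)) (Adiag (sw p) (sw1 p) (sw2 p) (sw22 p))
}.

Implicit Types (w : solution).

Lemma cont_A w p :
  [/\ {for p, continuous (fun t => Adiag (w t) (sw1 w t) (sw2 w t) (sw11 w t))},
      {for p, continuous (fun t => Aoff (w t) (sw12 w t))} &
      {for p, continuous (fun t => Adiag (w t) (sw1 w t) (sw2 w t) (sw22 w t))}].
Proof.
have c2M (f g : R * R -> R) : {for p, continuous f} -> {for p, continuous g} ->
    {for p, continuous (fun t => 2 * f t * g t)}.
  move=> hf hg; apply: (contM _ (fun t => 2 * f t)) => //.
  by apply: contM => //; exact: cont_cst.
have cg : {for p, continuous (fun t => sw1 w t ^+ 2 + sw2 w t ^+ 2)}.
  by apply: contD; apply: contX; [exact: sw1_cont | exact: sw2_cont].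
split.
- by apply: contB cg; apply: c2M; [exact: sw_cont | exact: sw11_cont].
- by apply: c2M; [exact: sw_cont | exact: sw12_cont].
- by apply: contB cg; apply: c2M; [exact: sw_cont | exact: sw22_cont].
Qed.

(** The local constants become uniform by compactness. A single integer n stands for both, as K = n
    + 1 and eta = 1 / (n + 1), which makes the property monotone in n as [compact_uniform]
    requires. *)
Lemma comparison_on_compact w (S : set (R * R)) : compact S ->
  exists K eta : R, [/\ 0 < K, 0 < eta &
  forall (p : R * R) (n11 n12 n22 s e1 e2 : R), S p ->
    @good R q G n11 n12 n22 -> 0 < s -> s < eta -> e1 ^+ 2 + e2 ^+ 2 = 1 ->
    (forall a b, qf n11 n12 n22 a b <=
       qf (Adiag (w p) (sw1 w p) (sw2 w p) (sw11 w p))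
          (Aoff (w p) (sw12 w p)) (Adiag (w p) (sw1 w p) (sw2 w p) (sw22 w p)) a b +
       s * ((a ^+ 2 + b ^+ 2) - K * (e1 * a + e2 * b) ^+ 2)) -> False].
Proof.
move=> cS.
pose P (n : nat) (p : R * R) := forall (n11 n12 n22 s e1 e2 : R),
    @good R q G n11 n12 n22 -> 0 < s -> s < n.+1%:R^-1 -> e1 ^+ 2 + e2 ^+ 2 = 1 ->
    (forall a b, qf n11 n12 n22 a b <=
       qf (Adiag (w p) (sw1 w p) (sw2 w p) (sw11 w p))
          (Aoff (w p) (sw12 w p)) (Adiag (w p) (sw1 w p) (sw2 w p) (sw22 w p)) a b +
       s * ((a ^+ 2 + b ^+ 2) - n.+1%:R * (e1 * a + e2 * b) ^+ 2)) -> False.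
have [n hn] : exists n, forall p, S p -> P n p.
  apply: (compact_uniform S P cS).
  - move=> n m p nm Pn n11 n12 n22 s e1 e2 gn s0 sm e12 H.
    have nm' : n.+1%:R <= m.+1%:R :> R by rewrite ler_nat.
    apply: (Pn n11 n12 n22 s e1 e2 gn s0 _ e12) => [|a b].
      by apply: lt_le_trans sm _; rewrite lef_pV2 ?posrE ?ltr0n.
    apply: le_trans (H a b) _; rewrite lerD2l ler_wpM2l ?(ltW s0) // lerD2l lerN2.
    by rewrite ler_wpM2r ?sqr_ge0.
  - move=> y Sy; have [K [eta [K0 eta0 H]]] := comparison_local ell _ _ _ (sw_good w y).
    have [n1 hn1] := inv_nat_lt eta eta0.
    have Ki : 0 < K^-1 by rewrite invr_gt0.
    have [n2 hn2] := inv_nat_lt K^-1 Ki.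
    exists (maxn n1 n2).
    have [c1 c2 c3] := cont_A w y.
    move/cvgrPdist_lt : c1 => /(_ _ eta0) c1; move/cvgrPdist_lt : c2 => /(_ _ eta0) c2.
    move/cvgrPdist_lt : c3 => /(_ _ eta0) c3.
    near=> p => n11 n12 n22 s e1 e2 gn s0 sm e12 HH.
    apply: (H _ _ _ n11 n12 n22 s e1 e2 _ _ _ (sw_good w p) gn s0 _ e12).
    + by rewrite distrC; near: p.
    + by rewrite distrC; near: p.
    + by rewrite distrC; near: p.
    + apply: lt_trans sm _; apply: le_lt_trans hn1.
      by rewrite lef_pV2 ?posrE ?ltr0n // ler_nat ltnS leq_maxl.
    + move=> a b; apply: le_trans (HH a b) _.
      rewrite lerD2l ler_wpM2l ?(ltW s0) // lerD2l lerN2 ler_wpM2r ?sqr_ge0 //.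
      apply: ltW; apply: (@lt_le_trans _ _ n2.+1%:R); last by rewrite ler_nat ltnS leq_maxr.
      by rewrite -ltf_pV2 ?posrE.
exists n.+1%:R, n.+1%:R^-1; split; rewrite ?invr_gt0 ?ltr0n //.
by move=> p n11 n12 n22 s e1 e2 /hn; apply.
Unshelve. all: by end_near. Qed.

Lemma grad_at_affine (F : R * R -> R) (x p : R * R) (l a b : R) :
  grad_at F (x.1 + l * p.1, x.2 + l * p.2) a b ->
  grad_at (fun t => F (x.1 + l * t.1, x.2 + l * t.2)) p (l * a) (l * b).
Proof.
move=> hF.
have h1 := grad_atD _ _ _ _ _ _ _ (grad_at_cst x.1 p)
  (grad_atM _ _ _ _ _ _ _ (grad_at_cst l p) (grad_at_fst p)).
have h2 := grad_atD _ _ _ _ _ _ _ (grad_at_cst x.2 p)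
  (grad_atM _ _ _ _ _ _ _ (grad_at_cst l p) (grad_at_snd p)).
by apply: (grad_at_eq _ _ _ _ _ _ (grad_at_comp2 _ _ _ _ _ _ _ _ _ _ hF h1 h2)); ring.
Qed.

Lemma cont_affine (F : R * R -> R) (x p : R * R) (l : R) :
  {for (x.1 + l * p.1, x.2 + l * p.2), continuous F} ->
  {for p, continuous (fun t => F (x.1 + l * t.1, x.2 + l * t.2))}.
Proof.
move=> cF; apply: (for_continuous_comp2 _ F (fun t => x.1 + l * t.1)
  (fun t : R * R => x.2 + l * t.2)) => //.
- by apply: contD; [exact: cont_cst | apply: contM; [exact: cont_cst | exact: cont_fst]].
- by apply: contD; [exact: cont_cst | apply: contM; [exact: cont_cst | exact: cont_snd]].
Qed.

Lemma grad_atZ (F : R * R -> R) p (c a b : R) : grad_at F p a b ->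
  grad_at (fun t => c * F t) p (c * a) (c * b).
Proof.
move=> hF; apply: (grad_at_eq _ _ _ _ _ _ (grad_atM _ _ _ _ _ _ _ (grad_at_cst c p) hF)); ring.
Qed.

Lemma contZ (F : R * R -> R) p (c : R) : {for p, continuous F} ->
  {for p, continuous (fun t => c * F t)}.
Proof. by move=> hF; apply: contM => //; exact: cont_cst. Qed.

(** The factor l^-1 leaves the gradient unchanged and cancels against the l of the second
    derivatives in the product w D^2 w, so the matrix is the one of [w] at the image point. *)
Definition rescale w (x : R * R) (l : R) (l0 : 0 < l) : solution.
Proof.
refine (@Solution
  (fun p => l^-1 * w (x.1 + l * p.1, x.2 + l * p.2))
  (fun p => sw1 w (x.1 + l * p.1, x.2 + l * p.2))
  (fun p => sw2 w (x.1 + l * p.1, x.2 + l * p.2))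
  (fun p => l * sw11 w (x.1 + l * p.1, x.2 + l * p.2))
  (fun p => l * sw12 w (x.1 + l * p.1, x.2 + l * p.2))
  (fun p => l * sw22 w (x.1 + l * p.1, x.2 + l * p.2)) _ _ _ _ _ _ _ _ _ _ _).
- by move=> p; rewrite mulr_gt0 ?invr_gt0 ?sw_pos.
- move=> p; apply: (grad_at_eq _ _ _ _ _ _ (grad_atZ _ _ l^-1 _ _ (grad_at_affine _ _ _ _ _ _ (sw_grad w _))));
  by rewrite mulrA mulVf ?mul1r ?gt_eqF.
- by move=> p; apply: grad_at_affine; exact: sw1_grad.
- by move=> p; apply: grad_at_affine; exact: sw2_grad.
- by move=> p; apply: contZ; apply: cont_affine; exact: sw_cont.
- by move=> p; apply: cont_affine; exact: sw1_cont.
- by move=> p; apply: cont_affine; exact: sw2_cont.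
- by move=> p; apply: contZ; apply: cont_affine; exact: sw11_cont.
- by move=> p; apply: contZ; apply: cont_affine; exact: sw12_cont.
- by move=> p; apply: contZ; apply: cont_affine; exact: sw22_cont.
- move=> p; have := sw_good w (x.1 + l * p.1, x.2 + l * p.2).
  have E a b : 2 * (l^-1 * a) * (l * b) = 2 * a * b by field; rewrite gt_eqF.
  by rewrite /Adiag /Aoff !E.
Defined.

End Solutions.

(** * The Kelvin transform *)

Section Kelvin.
Context {R : realType} {q : R} {G G1 G2 : R * R -> R} (ell : elliptic q G G1 G2).
Notation sol := (@solution R q G).
Implicit Types (w : sol) (p : R * R).

(** Conjugation by the reflection with rows (o1, o2) and (o2, - o1); trace and determinant are
    unchanged. *)
Lemma good_conj (m11 m12 m22 o1 o2 : R) : o1 ^+ 2 + o2 ^+ 2 = 1 ->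
  @good R q G m11 m12 m22 ->
  @good R q G (o1 ^+ 2 * m11 + 2 * (o1 * o2) * m12 + o2 ^+ 2 * m22)
    (o1 * o2 * (m11 - m22) + (o2 ^+ 2 - o1 ^+ 2) * m12)
    (o2 ^+ 2 * m11 - 2 * (o1 * o2) * m12 + o1 ^+ 2 * m22).
Proof.
move=> o12 [l [[h1 h2] hc hG]]; exists l; split => //; split.
- rewrite h1; have -> : m11 + m22 = (o1 ^+ 2 + o2 ^+ 2) * (m11 + m22) by rewrite o12 mul1r.
  ring.
- rewrite h2; have -> : m11 * m22 - m12 ^+ 2 = (o1 ^+ 2 + o2 ^+ 2) ^+ 2 * (m11 * m22 - m12 ^+ 2).
    by rewrite o12 expr1n mul1r.
  ring.
Qed.

Definition inv1 p : R := p.1 / nsq p.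
Definition inv2 p : R := p.2 / nsq p.
Definition inversion p : R * R := (inv1 p, inv2 p).

Lemma nsq_neq0 p : p != (0, 0) -> nsq p != 0.
Proof.
apply: contra; rewrite /nsq paddr_eq0 ?sqr_ge0 // !sqrf_eq0 => /andP[/eqP h1 /eqP h2].
by rewrite [p]surjective_pairing h1 h2.
Qed.

Lemma nsq_inversion p : nsq p != 0 -> nsq (inversion p) = (nsq p)^-1.
Proof. by rewrite /nsq /= /inv1 /inv2 /nsq => h; field. Qed.

Lemma inversionK p : nsq p != 0 -> inversion (inversion p) = p.
Proof.
move=> h; rewrite {1}/inversion /inv1 /inv2 (nsq_inversion _ h) /= /inv1 /inv2.
by rewrite [RHS]surjective_pairing; congr pair; field.
Qed.

(** Entries of the Jacobian of the inversion, |p|^-2 (I - 2 p p^T / |p|^2). *)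
Definition dinv11 p : R := (nsq p)^-1 - 2 * inv1 p ^+ 2.
Definition dinv12 p : R := - 2 * (inv1 p * inv2 p).
Definition dinv22 p : R := (nsq p)^-1 - 2 * inv2 p ^+ 2.

Lemma grad_nsqV p : nsq p != 0 -> grad_at (fun t => (nsq t)^-1) p
  (- 2 * p.1 / nsq p ^+ 2) (- 2 * p.2 / nsq p ^+ 2).
Proof.
move=> h.
have hN : grad_at nsq p (2 * p.1) (2 * p.2).
  have h1 := grad_atM _ _ _ _ _ _ _ (grad_at_fst p) (grad_at_fst p).
  have h2 := grad_atM _ _ _ _ _ _ _ (grad_at_snd p) (grad_at_snd p).
  by apply: (grad_at_eq _ _ _ _ _ _ (grad_atD _ _ _ _ _ _ _ h1 h2)); ring.
have hV : is_derive (nsq p) (1 : R) (fun x : R => x^-1) (- (nsq p) ^- 2).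
  have := @is_deriveV R id (nsq p) 1 1 h (is_derive_id _ _).
  by move=> /is_derive_eq; apply; rewrite /GRing.scale /= mulr1.
by apply: (grad_at_eq _ _ _ _ _ _ (grad_at_comp1 _ _ _ _ _ _ hV hN)); field.
Qed.

Lemma grad_inv1 p : nsq p != 0 -> grad_at inv1 p (dinv11 p) (dinv12 p).
Proof.
move=> h; have := grad_atM _ _ _ _ _ _ _ (grad_at_fst p) (grad_nsqV p h).
by move=> /grad_at_eq; apply; rewrite /dinv11 /dinv12 /inv1 /inv2; field.
Qed.

Lemma grad_inv2 p : nsq p != 0 -> grad_at inv2 p (dinv12 p) (dinv22 p).
Proof.
move=> h; have := grad_atM _ _ _ _ _ _ _ (grad_at_snd p) (grad_nsqV p h).
by move=> /grad_at_eq; apply; rewrite /dinv22 /dinv12 /inv1 /inv2; field.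
Qed.

Lemma grad_inversion (F : R * R -> R) p a b : nsq p != 0 ->
  grad_at F (inversion p) a b ->
  grad_at (fun t => F (inversion t)) p (a * dinv11 p + b * dinv12 p)
     (a * dinv12 p + b * dinv22 p).
Proof. by move=> h hF; apply: grad_at_comp2 hF (grad_inv1 p h) (grad_inv2 p h). Qed.

Definition kelvin w p : R := nsq p * w (inversion p).
(** The gradient of the Kelvin transform is 2 p [kS] + Dw(z) at z = [inversion p]. The pair ([kT1],
    [kT2]) is the gradient in z of w - z.Dw, namely - D^2 w z, since the first-order terms
    cancel. *)
Definition kS w p : R := let z := inversion p in w z - (z.1 * sw1 w z + z.2 * sw2 w z).
Definition kelvin1 w p : R := 2 * p.1 * kS w p + sw1 w (inversion p).
Definition kelvin2 w p : R := 2 * p.2 * kS w p + sw2 w (inversion p).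
Definition kT1 w p : R :=
  let z := inversion p in - (z.1 * sw11 w z + z.2 * sw12 w z).
Definition kT2 w p : R :=
  let z := inversion p in - (z.1 * sw12 w z + z.2 * sw22 w z).
Definition kelvin11 w p : R := let z := inversion p in
  2 * kS w p + 2 * p.1 * (kT1 w p * dinv11 p + kT2 w p * dinv12 p) +
  (sw11 w z * dinv11 p + sw12 w z * dinv12 p).
Definition kelvin12 w p : R := let z := inversion p in
  2 * p.1 * (kT1 w p * dinv12 p + kT2 w p * dinv22 p) +
  (sw11 w z * dinv12 p + sw12 w z * dinv22 p).
Definition kelvin22 w p : R := let z := inversion p in
  2 * kS w p + 2 * p.2 * (kT1 w p * dinv12 p + kT2 w p * dinv22 p) +
  (sw12 w z * dinv12 p + sw22 w z * dinv22 p).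

Lemma grad_kS w p : nsq p != 0 ->
  grad_at (kS w) p (kT1 w p * dinv11 p + kT2 w p * dinv12 p)
    (kT1 w p * dinv12 p + kT2 w p * dinv22 p).
Proof.
move=> h.
have hS : grad_at (fun z => w z - (z.1 * sw1 w z + z.2 * sw2 w z)) (inversion p)
    (kT1 w p) (kT2 w p).
  have h1 := grad_atM _ _ _ _ _ _ _ (grad_at_fst (inversion p)) (sw1_grad w (inversion p)).
  have h2 := grad_atM _ _ _ _ _ _ _ (grad_at_snd (inversion p)) (sw2_grad w (inversion p)).
  have h3 := grad_atZ _ _ (-1) _ _ (grad_atD _ _ _ _ _ _ _ h1 h2).
  have h4 := grad_atD _ _ _ _ _ _ _ (sw_grad w (inversion p)) h3.
  have -> : (fun z => w z - (z.1 * sw1 w z + z.2 * sw2 w z)) =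
      (fun z => w z + -1 * (z.1 * sw1 w z + z.2 * sw2 w z)).
    by apply/funext => z; rewrite mulN1r.
  by apply: (grad_at_eq _ _ _ _ _ _ h4); rewrite /kT1 /kT2; ring.
exact: grad_inversion hS.
Qed.

Lemma near_nsq_neq0 p : nsq p != 0 -> \forall z \near p, nsq z != 0.
Proof.
move=> h; have h0 : 0 < nsq p by rewrite lt_neqAle eq_sym h /nsq addr_ge0 ?sqr_ge0.
have := cont_nsq p; move=> /cvgr_gt /(_ _ h0); apply: filterS => z hz.
by rewrite gt_eqF.
Qed.

Lemma kelvin_grad w p : nsq p != 0 -> grad_at (kelvin w) p (kelvin1 w p) (kelvin2 w p).
Proof.
move=> h.
have h1 := grad_atM _ _ _ _ _ _ _ (grad_at_fst p) (grad_at_fst p).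
have h2 := grad_atM _ _ _ _ _ _ _ (grad_at_snd p) (grad_at_snd p).
have h3 := grad_atD _ _ _ _ _ _ _ h1 h2.
have h4 := grad_atM _ _ _ _ _ _ _ h3 (grad_inversion w _ _ _ h (sw_grad w (inversion p))).
apply: (grad_at_eq _ _ _ _ _ _ h4); rewrite /kelvin1 /kelvin2 /kS /= /dinv11 /dinv12 /dinv22 /inv1 /inv2;
  rewrite /nsq in h *; field; exact: h.
Qed.

Lemma kelvin_jet w p : nsq p != 0 ->
  jet2 (kelvin w) (kelvin1 w) (kelvin2 w) p (kelvin11 w p) (kelvin12 w p) (kelvin22 w p).
Proof.
move=> h; split.
- by have := near_nsq_neq0 p h; apply: filterS => z; exact: kelvin_grad.
- have h1 := grad_atM _ _ _ _ _ _ _ (grad_atZ _ _ 2 _ _ (grad_at_fst p)) (grad_kS w p h).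
  have h2 := grad_inversion (sw1 w) _ _ _ h (sw1_grad w (inversion p)).
  apply: (grad_at_eq _ _ _ _ _ _ (grad_atD _ _ _ _ _ _ _ h1 h2));
    rewrite /kelvin11 /kelvin12 /=; ring.
- have h1 := grad_atM _ _ _ _ _ _ _ (grad_atZ _ _ 2 _ _ (grad_at_snd p)) (grad_kS w p h).
  have h2 := grad_inversion (sw2 w) _ _ _ h (sw2_grad w (inversion p)).
  apply: (grad_at_eq _ _ _ _ _ _ (grad_atD _ _ _ _ _ _ _ h1 h2));
    rewrite /kelvin22 /kelvin12 /kT1 /kT2 /= /dinv11 /dinv12 /dinv22 /inv1 /inv2;
    rewrite /nsq in h *; field; exact: h.
Qed.

(** The matrix of the transform at [p] is the conjugate of that of [w] at [inversion p] by the
    reflection I - 2 p p^T / |p|^2, whose first row is (o1, o2). The conformal factors cancel,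
    leaving a rational identity. *)
Lemma kelvin_good w p : nsq p != 0 -> @good R q G
  (Adiag (kelvin w p) (kelvin1 w p) (kelvin2 w p) (kelvin11 w p))
  (Aoff (kelvin w p) (kelvin12 w p))
  (Adiag (kelvin w p) (kelvin1 w p) (kelvin2 w p) (kelvin22 w p)).
Proof.
move=> h; pose o1 := (p.2 ^+ 2 - p.1 ^+ 2) / nsq p; pose o2 := - 2 * (p.1 * p.2) / nsq p.
have o12 : o1 ^+ 2 + o2 ^+ 2 = 1.
  by rewrite /o1 /o2; rewrite /nsq in h *; field.
have := good_conj _ _ _ _ _ o12 (sw_good w (inversion p)).
set z := inversion p.
rewrite /Adiag /Aoff /kelvin /kelvin1 /kelvin2 /kelvin11 /kelvin12 /kelvin22.
rewrite /kT1 /kT2 /kS /= -/z /dinv11 /dinv12 /dinv22 /inv1 /inv2 /o1 /o2.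
move: (w z) (sw1 w z) (sw2 w z) (sw11 w z) (sw12 w z) (sw22 w z) => W W1 W2 W11 W12 W22.
move: h; rewrite /nsq; move: (p.1) (p.2) => a b h.
by congr (good _ _ _); field.
Qed.

End Kelvin.

(** * Interior maxima on annuli and radial functions *)

Section Radial.
Context {R : realType}.
Implicit Types (F : R * R -> R) (p c z : R * R).

Lemma dsq0 : dsq (0, 0) = @nsq R.
Proof. by apply/funext => p; rewrite /dsq /nsq /= !subr0. Qed.

Lemma dsq_ge0 c z : 0 <= dsq c z.
Proof. by rewrite addr_ge0 ?sqr_ge0. Qed.

Lemma nsq_ge0 z : 0 <= nsq z.
Proof. by rewrite addr_ge0 ?sqr_ge0. Qed.

(** The source of all touching points on annuli: if a comparison fails at [p] while both boundary
    circles lie strictly below F p, the maximum over the annulus is a local maximum in the plane. *)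
Lemma annulus_interior_max c (a b : R) F p : a <= dsq c p <= b ->
  (forall z, a <= dsq c z <= b -> {for z, continuous F}) ->
  (forall z, dsq c z = a -> F z < F p) -> (forall z, dsq c z = b -> F z < F p) ->
  exists z, [/\ a < dsq c z < b, F p <= F z & \forall t \near z, F t <= F z].
Proof.
move=> pab cF Fa Fb.
have [z + zmax] := max_on_compact [set z | a <= dsq c z <= b] F
  (ex_intro _ p pab) (compact_annulus c a b) cF.
move=> /= /andP[za zb].
have pz := zmax p pab.
have za' : a < dsq c z.
  rewrite lt_neqAle za andbT; apply/eqP => e.
  by have := lt_le_trans (Fa z (esym e)) pz; rewrite ltxx.
have zb' : dsq c z < b.
  rewrite lt_neqAle zb andbT; apply/eqP => e.
  by have := lt_le_trans (Fb z e) pz; rewrite ltxx.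
exists z; split => //; first by rewrite za' zb'.
have n1 := cont_dsq c z; move/cvgr_gt : (n1) => /(_ _ za') n2.
move/cvgr_lt : n1 => /(_ _ zb') n1.
near=> t; apply: zmax; apply/andP; split; apply: ltW; near: t; assumption.
Unshelve. all: by end_near. Qed.

Lemma grad_dsq c p : grad_at (dsq c) p (2 * (p.1 - c.1)) (2 * (p.2 - c.2)).
Proof.
have h1 := grad_atD _ _ _ _ _ _ _ (grad_at_fst p) (grad_at_cst (- c.1) p).
have h2 := grad_atD _ _ _ _ _ _ _ (grad_at_snd p) (grad_at_cst (- c.2) p).
have h := grad_atD _ _ _ _ _ _ _ (grad_atM _ _ _ _ _ _ _ h1 h1) (grad_atM _ _ _ _ _ _ _ h2 h2).
by apply: (grad_at_eq _ _ _ _ _ _ h); ring.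
Qed.

(** In terms of the squared distance the Hessian is 2 k' I + 4 k'' (z - c)(z - c)^T, with no square
    roots. *)
Lemma radial_jet c (k dk : R -> R) (d2k : R) p :
  (\forall t \near dsq c p, is_derive t (1 : R) k (dk t)) ->
  is_derive (dsq c p) (1 : R) dk d2k ->
  jet2 (fun z => k (dsq c z)) (fun z => 2 * (z.1 - c.1) * dk (dsq c z))
    (fun z => 2 * (z.2 - c.2) * dk (dsq c z)) p
    (2 * dk (dsq c p) + 4 * (p.1 - c.1) ^+ 2 * d2k)
    (4 * ((p.1 - c.1) * (p.2 - c.2)) * d2k)
    (2 * dk (dsq c p) + 4 * (p.2 - c.2) ^+ 2 * d2k).
Proof.
move=> hk hdk; split.
- have hk' : \forall z \near p, is_derive (dsq c z) (1 : R) k (dk (dsq c z)).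
    exact: (cont_dsq c p _ hk).
  near=> z; have hz : is_derive (dsq c z) (1 : R) k (dk (dsq c z)) by near: z.
  apply: (grad_at_eq _ _ _ _ _ _ (grad_at_comp1 k _ (dsq c) z _ _ hz (grad_dsq c z))); ring.
- have h1 := grad_atZ _ _ 2 _ _ (grad_atD _ _ _ _ _ _ _ (grad_at_fst p) (grad_at_cst (- c.1) p)).
  have h := grad_atM _ _ _ _ _ _ _ h1 (grad_at_comp1 _ _ _ _ _ _ hdk (grad_dsq c p)).
  by apply: (grad_at_eq _ _ _ _ _ _ h); ring.
- have h1 := grad_atZ _ _ 2 _ _ (grad_atD _ _ _ _ _ _ _ (grad_at_snd p) (grad_at_cst (- c.2) p)).
  have h := grad_atM _ _ _ _ _ _ _ h1 (grad_at_comp1 _ _ _ _ _ _ hdk (grad_dsq c p)).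
  by apply: (grad_at_eq _ _ _ _ _ _ h); ring.
Unshelve. all: by end_near. Qed.

End Radial.

(** * Behaviour at the puncture *)

Section RealDerivatives.
Context {R : realType}.
Implicit Types (f g : R -> R) (x a b : R).

Lemma derD f g x a b : is_derive x (1 : R) f a -> is_derive x (1 : R) g b ->
  is_derive x (1 : R) (fun t => f t + g t) (a + b).
Proof. by move=> hf hg; exact: is_deriveD. Qed.

Lemma derM f g x a b : is_derive x (1 : R) f a -> is_derive x (1 : R) g b ->
  is_derive x (1 : R) (fun t => f t * g t) (f x * b + g x * a).
Proof. by move=> hf hg; exact: is_deriveM. Qed.

Lemma derZ (c : R) f x a : is_derive x (1 : R) f a ->
  is_derive x (1 : R) (fun t => c * f t) (c * a).
Proof.
by move=> hf; have := derM _ _ _ _ _ (is_derive_cst c x (1 : R)) hf;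
  move=> /is_derive_eq; apply; rewrite mulr0 addr0.
Qed.

Lemma derV f x a : f x != 0 -> is_derive x (1 : R) f a ->
  is_derive x (1 : R) (fun t => (f t)^-1) (- a / f x ^+ 2).
Proof.
move=> h hf; apply: (is_derive_eq (is_deriveV h hf)).
by rewrite /GRing.scale /= mulNr mulrC mulNr.
Qed.

Lemma derX f x a n : is_derive x (1 : R) f a ->
  is_derive x (1 : R) (fun t => f t ^+ n) (n%:R * f x ^+ n.-1 * a).
Proof. by move=> hf; have := @is_deriveX R R f n x 1 a hf; rewrite exprfctE. Qed.

End RealDerivatives.

Section Puncture.
Context {R : realType} {q : R} {G G1 G2 : R * R -> R} (ell : elliptic q G G1 G2).
Notation sol := (@solution R q G).
Implicit Types (w : sol) (p z : R * R).

Lemma good_cone_dir (m11 m12 m22 e1 e2 : R) : @good R q G m11 m12 m22 ->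
  0 < e1 ^+ 2 + e2 ^+ 2 ->
  0 < qf m11 m12 m22 (- e2) e1 + q * qf m11 m12 m22 e1 e2.
Proof.
move=> hg e0; pose s := Num.sqrt (e1 ^+ 2 + e2 ^+ 2).
have s2 : s ^+ 2 = e1 ^+ 2 + e2 ^+ 2 by rewrite sqr_sqrtr // ltW.
have s0 : 0 < s by rewrite sqrtr_gt0.
have := good_cone ell _ _ _ (e1 / s) (e2 / s) hg.
rewrite !expr_div_n s2 -mulrDl divff ?gt_eqF // => /(_ erefl).
have -> : qf m11 m12 m22 (- (e2 / s)) (e1 / s) + q * qf m11 m12 m22 (e1 / s) (e2 / s) =
  (qf m11 m12 m22 (- e2) e1 + q * qf m11 m12 m22 e1 e2) / s ^+ 2.
  by rewrite /qf; field; rewrite gt_eqF.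
by rewrite pmulr_lgt0 // invr_gt0 exprn_gt0.
Qed.

Lemma cont_kelvin w p : nsq p != 0 -> {for p, continuous (kelvin w)}.
Proof.
move=> h; apply: contM; first exact: cont_nsq.
apply: (for_continuous_comp2 _ w inv1 inv2); last exact: sw_cont.
- by apply: contM; [exact: cont_fst | apply: contV => //; exact: cont_nsq].
- by apply: contM; [exact: cont_snd | apply: contV => //; exact: cont_nsq].
Qed.

Lemma kelvin_gt0 w p : nsq p != 0 -> 0 < kelvin w p.
Proof.
by move=> h; rewrite mulr_gt0 ?sw_pos // lt_neqAle eq_sym h nsq_ge0.
Qed.

(** Bernoulli's inequality. *)
Lemma one_sub_pow_ge (x : R) n : 0 <= x <= 1 -> 1 - n%:R * x <= (1 - x) ^+ n.
Proof.
move=> /andP[x0 x1]; elim: n => [|n ih]; first by rewrite mul0r subr0 expr0.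
rewrite exprS.
have h : (1 - x) * (1 - n%:R * x) <= (1 - x) * (1 - x) ^+ n by rewrite ler_wpM2l // subr_ge0.
apply: le_trans h; rewrite -natr1.
have : 0 <= n%:R * x ^+ 2 by rewrite mulr_ge0 ?sqr_ge0.
lra.
Qed.

(** For m = m' + 1 this reads q (m + 2) - m <= 0, the sign that disposes of the 1 / g term in the
    barrier computation; such an m exists as q < 1. *)
Lemma exists_exponent : exists m : nat, 2 * q <= m.+1%:R * (1 - q).
Proof.
have q1 := ell_q1 _ _ _ _ ell; have q0 := ell_q0 _ _ _ _ ell.
have q1' : 0 < 1 - q by rewrite subr_gt0.
exists (Num.truncn (2 * q / (1 - q))).
have := truncnS_gt (2 * q / (1 - q)).
by rewrite ltr_pdivrMr // => /ltW.
Qed.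

(* [F g^-m] with [g = ln (|z|^2 / rho)] lies outside the cone: the condition on the
   eigenvalues amounts to [-1 + q + (q (m + 2) - m) / g > 0]. *)
Lemma kelvin_barrier w p (F rho : R) (m : nat) : nsq p != 0 -> 0 < rho ->
  rho < nsq p -> 2 * q <= m%:R * (1 - q) -> (0 < m)%N -> 0 < F ->
  kelvin w p = F * (ln (nsq p) - ln rho) ^- m ->
  (\forall z \near p, kelvin w z <= F * (ln (nsq z) - ln rho) ^- m) -> False.
Proof.
move=> h rho0 rhop hm m0 F0 vp near_v.
have q1 := ell_q1 _ _ _ _ ell; have q0 := ell_q0 _ _ _ _ ell.
pose y (t : R) := (ln t - ln rho)^-1.
have N0 : 0 < nsq p by rewrite lt_neqAle eq_sym h nsq_ge0.
have dy (t : R) : rho < t -> is_derive t (1 : R) y (- y t ^+ 2 / t).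
  move=> rt; have t0 : 0 < t := lt_trans rho0 rt.
  have l0 : ln t - ln rho != 0 by rewrite gt_eqF // subr_gt0 ltr_ln ?posrE.
  have h1 := derD _ _ _ _ _ (is_derive1_ln t0) (is_derive_cst (- ln rho) t (1 : R)).
  apply: (is_derive_eq (derV (fun t => ln t - ln rho) t _ l0 h1)).
  by rewrite addr0 /y exprVn mulNr mulrC mulNr.
pose k (t : R) := F * y t ^+ m.
pose dk (t : R) := - (m%:R * F) * (y t ^+ m.+1 / t).
have dyn n (t : R) : rho < t -> is_derive t (1 : R) (fun t => y t ^+ n) (- (n%:R * y t ^+ n.+1 / t)).
  move=> rt; apply: (is_derive_eq (derX _ _ _ n (dy t rt))).
  case: n => [|n] /=; first by rewrite !mul0r oppr0.
  by rewrite !exprS; ring.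
have dkP (t : R) : rho < t -> is_derive t (1 : R) k (dk t).
  move=> rt; apply: (is_derive_eq (derZ F _ _ _ (dyn m t rt))); rewrite /dk; ring.
pose N := nsq p.
pose d2k := m%:R * F * ((m.+1%:R * y N ^+ m.+2 + y N ^+ m.+1) / N ^+ 2).
have d2kP : is_derive (nsq p) (1 : R) dk d2k.
  have h2 := derM _ _ _ _ _ (dyn m.+1 N rhop) (derV id N _ (lt0r_neq0 N0) (is_derive_id N (1 : R))).
  apply: (is_derive_eq (derZ (- (m%:R * F)) _ _ _ h2)).
  by rewrite /d2k; field; rewrite gt_eqF.
have kE t : k t = F * (ln t - ln rho) ^- m by rewrite /k /y exprVn.
have near_k : \forall t \near dsq (0, 0) p, is_derive t (1 : R) k (dk t).
  rewrite dsq0; have := lt_nbhsr rhop; apply: filterS => t; exact: dkP.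
have jk := radial_jet (0, 0) k dk d2k p near_k.
rewrite dsq0 in jk; move: jk => /(_ d2kP) jk.
have touch : \forall z \near p, k (nsq p) - kelvin w p <= k (nsq z) - kelvin w z.
  by apply: filterS near_v => z; rewrite vp -!kE subrr subr_ge0.
have [e1 e2 e3] := jet2_touch _ _ _ _ _ _ _ _ _ _ _ _ _ jk (kelvin_jet w p h) touch.
(* The cone inequality is tested in the polar frame, with weight 1 on the tangential entry and q on
   the radial one: the convexity of the barrier in the radial direction is discounted by q. *)
have := good_cone_dir _ _ _ p.1 p.2 (kelvin_good w p h).
move=> /(_ N0); apply/negP; rewrite -leNgt.
rewrite /qf /Adiag /Aoff -e1 -e2.
have vk : kelvin w p = k N by rewrite kE.
have v0 := kelvin_gt0 w p h.
have i1 := e3 p.1 p.2; have i2 := e3 (- p.2) p.1.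
rewrite /= !subr0 -/N in i1 i2 *.
set v := kelvin w p in v0 vk *.
have j1 := ler_wpM2l (ltW v0) i1; have j2 := ler_wpM2l (ltW v0) i2.
have j1' := ler_wpM2l q0 j1.
pose Y := y N ^+ m.
have Ey1 : y N ^+ m.+1 = Y * y N by rewrite exprSr.
have Ey2 : y N ^+ m.+2 = Y * y N ^+ 2 by rewrite -addn2 exprD.
have y0 : 0 < y N by rewrite invr_gt0 subr_gt0 ltr_ln ?posrE.
have Y0 : 0 < Y by rewrite exprn_gt0.
have final : F ^+ 2 * m%:R * Y ^+ 2 * y N * (- 1 + q + y N * (q * (m%:R + 2) - m%:R)) <= 0.
  rewrite mulr_ge0_le0 //.
    by do ![apply: mulr_ge0]; rewrite ?sqr_ge0 ?ler0n ?(ltW y0) ?(ltW F0) ?(ltW Y0).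
  have : y N * (q * (m%:R + 2) - m%:R) <= 0 by rewrite mulr_ge0_le0 ?(ltW y0) //; lra.
  lra.
have NE : p.1 ^+ 2 = N - p.2 ^+ 2 by rewrite /N /nsq; ring.
have key : v * (2 * dk N * N) * 2 - (2 * dk N) ^+ 2 * N ^+ 2 +
   q * (v * (2 * dk N * N + 4 * d2k * N ^+ 2) * 2 - (2 * dk N) ^+ 2 * N ^+ 2) <= 0.
  rewrite vk /k /dk /d2k -/N Ey1 Ey2 -/Y.
  suff -> : F * Y * (2 * (- (m%:R * F) * (Y * y N / N)) * N) * 2 -
    (2 * (- (m%:R * F) * (Y * y N / N))) ^+ 2 * N ^+ 2 +
    q * (F * Y * (2 * (- (m%:R * F) * (Y * y N / N)) * N +
     4 * (m%:R * F * ((m.+1%:R * (Y * y N ^+ 2) + Y * y N) / N ^+ 2)) * N ^+ 2) * 2 -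
      (2 * (- (m%:R * F) * (Y * y N / N))) ^+ 2 * N ^+ 2) =
   4 * (F ^+ 2 * m%:R * Y ^+ 2 * y N * (- 1 + q + y N * (q * (m%:R + 2) - m%:R))).
    by rewrite pmulr_rle0.
  by rewrite -natr1; field; rewrite gt_eqF.
apply: le_trans key.
rewrite /N /nsq in j1' j2 *.
lra.
Qed.

End Puncture.

(** * Boundedness and log-subharmonicity of the Kelvin transform *)

Section PunctureBounds.
Context {R : realType} {q : R} {G G1 G2 : R * R -> R} (ell : elliptic q G G1 G2).
Notation sol := (@solution R q G).
Implicit Types (w : sol) (p z : R * R).

Lemma cont_ln_nsq p : 0 < nsq p -> {for p, continuous (fun z => ln (nsq z) : R)}.
Proof. by move=> h; apply: cont_comp; [exact: cont_nsq | exact: continuous_ln]. Qed.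

(** C is the maximum on the unit circle. The product [F] of [kelvin w] with (ln nsq - ln rho)^m
    vanishes on the circle nsq = rho and is at most C L^m on the unit circle. If [kelvin w p]
    exceeded C, a small enough rho would make F p larger than both, and an interior maximum of [F]
    is exactly a touching by the barrier. *)
Lemma kelvin_bounded w : exists2 C : R, 0 < C &
  forall p, 0 < nsq p <= 1 -> kelvin w p <= C.
Proof.
have n10 : nsq ((1, 0) : R * R) = 1 by rewrite /nsq /= expr1n expr0n addr0.
have [c /= c1 cmax] : exists2 c : R * R, 1 <= nsq c <= 1 &
    forall z, 1 <= nsq z <= 1 -> kelvin w z <= kelvin w c.
  have := max_on_compact [set p | 1 <= dsq (0, 0) p <= 1] (kelvin w)
    (ex_intro _ (1, 0) _) (compact_annulus (0, 0) 1 1) _.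
  rewrite dsq0 /= n10 lexx; apply => // z /andP[z1 _]; apply: cont_kelvin.
  by rewrite gt_eqF // (lt_le_trans ltr01).
have c0 : nsq c != 0 by move/andP: c1 => [c1 _]; rewrite gt_eqF // (lt_le_trans ltr01).
set C := kelvin w c in cmax; have C0 : 0 < C by exact: kelvin_gt0.
exists C => // p /andP[p0 p1]; rewrite leNgt; apply/negP => vC.
have [m0 hm] := exists_exponent ell; set m := m0.+1 in hm.
set v := kelvin w p in vC; have v0 : 0 < v := lt_trans C0 vC.
pose a := - ln (nsq p).
have a0 : 0 <= a by rewrite oppr_ge0 ln_le0.
(* L is - ln rho. By Bernoulli F p > C L^m follows from C < v (1 - m a / L), that is from L > m a v
   / (v - C); the summand a + 1 keeps rho below [nsq p]. *)
pose L := m%:R * a * v / (v - C) + a + 1.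
have k0 : 0 <= m%:R * a * v / (v - C).
  apply: divr_ge0; last by rewrite subr_ge0 ltW.
  by apply: mulr_ge0; [apply: mulr_ge0 | exact: ltW].
have aL : a < L by rewrite /L; clear - ell k0; lra.
have L0 : 0 < L := le_lt_trans a0 aL.
have hL : C < v * (1 - m%:R * (a / L)).
  have e1 : m%:R * a * v < (v - C) * L.
    have -> : (v - C) * L = m%:R * a * v + (v - C) * (a + 1).
      by rewrite /L; field; rewrite gt_eqF // subr_gt0.
    by rewrite ltrDl mulr_gt0 ?subr_gt0 // ltr_wpDl.
  have -> : v * (1 - m%:R * (a / L)) = v - m%:R * a * v / L by field; rewrite gt_eqF.
  by rewrite ltrBrDl -ltrBrDr ltr_pdivrMr.
pose rho := expR (- L).
have rho0 : 0 < rho := expR_gt0 _.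
have lrho : ln rho = - L by rewrite expRK.
have rp : rho < nsq p by rewrite -[ltRHS]lnK ?posrE // ltr_expR; rewrite /a in aL; clear - ell aL; lra.
pose F z := kelvin w z * (ln (nsq z) - ln rho) ^+ m.
have Fp : C * L ^+ m < F p.
  rewrite /F lrho opprK -/v.
  have -> : ln (nsq p) + L = L * (1 - a / L) by rewrite /a; field; rewrite gt_eqF.
  rewrite exprMn mulrCA mulrC ltr_pM2l ?exprn_gt0 //.
  apply: lt_le_trans hL _; rewrite ler_pM2l //; apply: one_sub_pow_ge.
  by rewrite divr_ge0 ?(ltW L0) //= ler_pdivrMr // mul1r ltW.
have Fp0 : 0 < F p by apply: lt_trans Fp; rewrite mulr_gt0 // exprn_gt0.
have [||||z [zr Fz near_z]] := @annulus_interior_max R (0, 0) rho 1 F p.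
- by rewrite dsq0 (ltW rp) p1.
- rewrite dsq0 => z /andP[z1 _]; have z0 : 0 < nsq z := lt_le_trans rho0 z1.
  apply: contM; first by apply: cont_kelvin; rewrite gt_eqF.
  by apply: contX; apply: contB; [exact: cont_ln_nsq | exact: cont_cst].
- by rewrite dsq0 => z e; rewrite /F e subrr expr0n /= mulr0.
- rewrite dsq0 => z e; apply: le_lt_trans Fp; rewrite /F e ln1 sub0r lrho opprK.
  by rewrite ler_wpM2r ?exprn_ge0 ?(ltW L0) // cmax // e lexx.
rewrite dsq0 in zr; move/andP: zr => [zr z1].
have z0 : 0 < nsq z := lt_trans rho0 zr.
have lpos t : rho < nsq t -> 0 < ln (nsq t) - ln rho.
  by move=> h; rewrite subr_gt0 ltr_ln ?posrE // (lt_trans rho0).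
have Fz0 : 0 < F z := lt_le_trans Fp0 Fz.
apply: (kelvin_barrier ell w z (F z) rho m _ rho0 zr hm _ Fz0) => //.
- by rewrite gt_eqF.
- by rewrite /F mulfK // gt_eqF // exprn_gt0 // lpos.
- have n1 : \forall t \near z, rho < nsq t.
    by have := cont_nsq z; move/cvgr_gt => /(_ _ zr).
  near=> t; rewrite ler_pdivlMr; first by near: t.
  by apply: exprn_gt0; apply: lpos; near: t.
Unshelve. all: by end_near. Qed.

(* The trace of [A] being positive, [ln (kelvin w)] is subharmonic; a multiple of
   [ln |z|] takes care of the puncture. *)
Lemma kelvin_log_subharmonic w (rho a0 a1 a2 : R) : 0 < rho <= 1 ->
  (forall z, nsq z = rho -> ln (kelvin w z) <= a0 + a1 * z.1 + a2 * z.2) ->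
  forall z, 0 < nsq z <= rho -> ln (kelvin w z) <= a0 + a1 * z.1 + a2 * z.2.
Proof.
move=> /andP[rho0 rho1] hb p /andP[p0 pr]; rewrite leNgt; apply/negP => hp.
pose aff z : R := a0 + a1 * z.1 + a2 * z.2.
have [C C0 hC] := kelvin_bounded w.
set gap := ln (kelvin w p) - aff p.
have gap0 : 0 < gap by rewrite subr_gt0.
pose L := ln rho - ln (nsq p).
have L0 : 0 <= L by rewrite subr_ge0 ler_ln ?posrE.
(* Small enough for the logarithmic correction d L at [p] not to use up the gap. *)
pose d := gap / (L + 1) / 2.
have d0 : 0 < d by rewrite !divr_gt0 // ltr_wpDl.
have dL : d * L < gap.
  have -> : d * L = gap * (L / (L + 1) / 2) by rewrite /d; field; rewrite gt_eqF // ltr_wpDl.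
  rewrite gtr_pMr // ltr_pdivrMr // mul1r ltr_pdivrMr ?ltr_wpDl //.
  by clear - ell L0; lra.
pose H z : R := ln (kelvin w z) - aff z + d * (ln (nsq z) - ln rho).
have Hp : 0 < H p.
  have -> : H p = gap - d * L by rewrite /H /gap /L; ring.
  by rewrite subr_gt0.
pose B := `|a0| + `|a1| + `|a2|.
have affB z : nsq z <= 1 -> - B <= aff z.
  move=> z1.
  have [h1 h2] : `|z.1| <= 1 /\ `|z.2| <= 1.
    split; apply: sqr_le_norm => //; rewrite expr1n; apply: le_trans z1; rewrite /nsq.
      by rewrite lerDl sqr_ge0.
    by rewrite lerDr sqr_ge0.
  have k1 : `|a1 * z.1| <= `|a1| by rewrite normrM ler_piMr.
  have k2 : `|a2 * z.2| <= `|a2| by rewrite normrM ler_piMr.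
  have k0 : `|a0| <= `|a0| by [].
  rewrite /aff /B; move: k0 k1 k2; rewrite !ler_norml.
  by move=> /andP[? _] /andP[? _] /andP[? _]; rewrite !opprD !lerD.
(* On the inner circle the correction d (ln rho' - ln rho) must beat the a priori bounds ln (kelvin
   w) <= ln C and aff >= - B; this fixes how small rho' is. *)
pose E := (ln C + B) / d.
pose rho' := Num.min (nsq p / 2) (rho * expR (- `|E|)).
have rho'0 : 0 < rho' by rewrite lt_min divr_gt0 //= mulr_gt0 // expR_gt0.
have rho'p : rho' < nsq p.
  apply: (@le_lt_trans _ _ (nsq p / 2)); first by rewrite ge_min lexx.
  by rewrite ltr_pdivrMr // ltr_pMr // ltr1n.
have lrho' : d * (ln rho' - ln rho) <= - (ln C + B).
  have h : ln rho' <= ln rho - `|E|.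
    rewrite -[X in _ <= X + _]expRK -[- `|E|]expRK -lnM ?posrE ?expR_gt0 //.
    rewrite lnK ?posrE // ler_ln ?posrE // ?mulr_gt0 ?expR_gt0 //.
    by rewrite ge_min lexx orbT.
  have -> : ln C + B = d * E by rewrite /E mulrC divfK // gt_eqF.
  rewrite -mulrN ler_pM2l //; have := ler_norm E; clear - ell h; lra.
have [||||z [zr Hz near_z]] := @annulus_interior_max R (0, 0) rho' rho H p.
- by rewrite dsq0 (ltW rho'p) pr.
- rewrite dsq0 => z /andP[z1 _]; have z0 : 0 < nsq z := lt_le_trans rho'0 z1.
  have zn : nsq z != 0 by rewrite gt_eqF.
  apply: contD.
    apply: contB.
      by apply: cont_comp; [exact: cont_kelvin | apply: continuous_ln; exact: kelvin_gt0].
    apply: contD; last by apply: contM; [exact: cont_cst | exact: cont_snd].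
    by apply: contD; [exact: cont_cst | apply: contM; [exact: cont_cst | exact: cont_fst]].
  apply: contM; first exact: cont_cst.
  by apply: contB; [exact: cont_ln_nsq | exact: cont_cst].
- rewrite dsq0 => z e; apply: le_lt_trans Hp; rewrite /H e.
  have z01 : 0 < nsq z <= 1 by rewrite e rho'0 /= (le_trans (ltW rho'p)) // (le_trans pr).
  have h1 : ln (kelvin w z) <= ln C.
    rewrite ler_ln ?posrE //; first exact: hC.
    by apply: kelvin_gt0; move/andP: z01 => [z0 _]; rewrite gt_eqF.
  have h2 := affB z (proj2 (andP z01)).
  by clear - ell h1 h2 lrho'; lra.
- rewrite dsq0 => z e; apply: le_lt_trans Hp; rewrite /H e subrr mulr0 addr0 subr_le0.
  exact: hb.
rewrite dsq0 in zr; move/andP: zr => [zr z1].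
have z0 : 0 < nsq z := lt_trans rho'0 zr.
have zn : nsq z != 0 by rewrite gt_eqF.
have v0 := kelvin_gt0 w z zn.
have [near_g g1 g2] := kelvin_jet w z zn.
have near_v : \forall t \near z, nsq t != 0 := near_nsq_neq0 z zn.
have jU : jet2 (fun t => ln (kelvin w t)) (fun t => kelvin1 w t / kelvin w t)
   (fun t => kelvin2 w t / kelvin w t) z
   ((kelvin11 w z - kelvin1 w z ^+ 2 / kelvin w z) / kelvin w z)
   ((kelvin12 w z - kelvin1 w z * kelvin2 w z / kelvin w z) / kelvin w z)
   ((kelvin22 w z - kelvin2 w z ^+ 2 / kelvin w z) / kelvin w z).
  have dV : is_derive (kelvin w z) (1 : R) (fun x : R => x^-1) (- (kelvin w z) ^- 2).
    have := derV id (kelvin w z) 1 (lt0r_neq0 v0) (is_derive_id _ _).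
    by move=> /is_derive_eq; apply; rewrite mulN1r.
  have gV := grad_at_comp1 _ _ _ _ _ _ dV (kelvin_grad w z zn).
  split.
  - near=> t; have tn : nsq t != 0 by near: t.
    have := grad_at_comp1 _ _ _ _ _ _ (is_derive1_ln (kelvin_gt0 w t tn)) (kelvin_grad w t tn).
    by move=> /grad_at_eq; apply; rewrite mulrC.
  - apply: (grad_at_eq _ _ _ _ _ _ (grad_atM _ _ _ _ _ _ _ g1 gV)); field; exact: lt0r_neq0.
  - apply: (grad_at_eq _ _ _ _ _ _ (grad_atM _ _ _ _ _ _ _ g2 gV)); field; exact: lt0r_neq0.
have near_ln : \forall t \near dsq (0, 0) z, is_derive t (1 : R) (@ln R) t^-1.
  by rewrite dsq0; have := lt_nbhsr z0; apply: filterS => t t0; exact: is_derive1_ln.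
have dV : is_derive (dsq (0, 0) z) (1 : R) (fun x : R => x^-1) (- (nsq z) ^- 2).
  rewrite dsq0; have := derV id (nsq z) 1 zn (is_derive_id _ _).
  by move=> /is_derive_eq; apply; rewrite mulN1r.
have jL := radial_jet (0, 0) (@ln R) (fun t => t^-1) _ z near_ln dV.
have jaff : jet2 aff (fun=> a1) (fun=> a2) z 0 0 0.
  split; try exact: grad_at_cst.
  near=> t.
  have h1 := grad_atZ _ _ a1 _ _ (grad_at_fst t).
  have h2 := grad_atZ _ _ a2 _ _ (grad_at_snd t).
  have := grad_atD _ _ _ _ _ _ _ (grad_atD _ _ _ _ _ _ _ (grad_at_cst a0 t) h1) h2.
  by move=> /grad_at_eq; apply; ring.
have jLd : jet2 (fun t => - d * ln (dsq (0, 0) t))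
   (fun t => - d * (2 * (t.1 - 0) * (dsq (0, 0) t)^-1))
   (fun t => - d * (2 * (t.2 - 0) * (dsq (0, 0) t)^-1)) z
   (- d * (2 * (nsq z)^-1 + 4 * (z.1 - 0) ^+ 2 * (- (nsq z) ^- 2)))
   (- d * (4 * ((z.1 - 0) * (z.2 - 0)) * (- (nsq z) ^- 2)))
   (- d * (2 * (nsq z)^-1 + 4 * (z.2 - 0) ^+ 2 * (- (nsq z) ^- 2))).
  move: jL => [n1 k1 k2]; rewrite dsq0 in k1 k2 *; split; try exact: grad_atZ.
  by apply: filterS n1 => t; rewrite dsq0; exact: grad_atZ.
have touch : \forall t \near z, (fun t => (- d * ln (dsq (0, 0) t)) - (ln (kelvin w t) - aff t)) z
  <= (- d * ln (dsq (0, 0) t)) - (ln (kelvin w t) - aff t).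
  by apply: filterS near_z => t; rewrite /H dsq0; clear; lra.
have [_ _ e3] := jet2_touch _ _ _ _ _ _ _ _ _ _ _ _ _ jLd (jet2B _ _ _ _ _ _ _ _ _ _ _ _ _ jU jaff) touch.
have i1 := e3 1 0; have i2 := e3 0 1.
have := good_trace ell _ _ _ (kelvin_good w z zn); apply/negP; rewrite -leNgt.
rewrite /Adiag.
have {}i1 : (kelvin11 w z - kelvin1 w z ^+ 2 / kelvin w z) / kelvin w z <=
  - d * (2 * (nsq z)^-1 + 4 * z.1 ^+ 2 * (- (nsq z) ^- 2)).
  move: i1; rewrite !subr0 !(expr1n, expr0n, mulr0, mulr1, addr0) //.
have {}i2 : (kelvin22 w z - kelvin2 w z ^+ 2 / kelvin w z) / kelvin w z <=
  - d * (2 * (nsq z)^-1 + 4 * z.2 ^+ 2 * (- (nsq z) ^- 2)).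
  move: i2; rewrite !subr0 !(expr1n, expr0n, mulr0, mulr1, addr0, add0r) //.
(* ln |z| is harmonic in the plane, so the correction does not affect the Laplacian at the touching
   point. *)
have lap0 : - d * (2 * (nsq z)^-1 + 4 * z.1 ^+ 2 * (- (nsq z) ^- 2)) +
   - d * (2 * (nsq z)^-1 + 4 * z.2 ^+ 2 * (- (nsq z) ^- 2)) = 0.
  by rewrite /nsq in zn *; field.
have := lerD i1 i2; rewrite lap0.
set v := kelvin w z in v0 *.
(* The trace of the matrix is 2 v^2 times the Laplacian of ln v; the former is positive, the latter
   has just been bounded by 0. *)
have -> : (kelvin11 w z - kelvin1 w z ^+ 2 / v) / v +
   (kelvin22 w z - kelvin2 w z ^+ 2 / v) / v =
   (2 * v * kelvin11 w z - (kelvin1 w z ^+ 2 + kelvin2 w z ^+ 2) +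
    (2 * v * kelvin22 w z - (kelvin1 w z ^+ 2 + kelvin2 w z ^+ 2))) / (2 * v ^+ 2).
  by field; exact: lt0r_neq0.
by rewrite pmulr_lle0 // invr_gt0 mulr_gt0 // exprn_gt0.
Unshelve. all: by end_near. Qed.

End PunctureBounds.

(** * Hopf barrier and removal of the puncture *)

Section Perturbation.
Context {R : realType} {q : R} {G G1 G2 : R * R -> R} (ell : elliptic q G G1 G2).
Notation sol := (@solution R q G).
Implicit Types (w : sol) (p z c : R * R).

Lemma disc_norm_bound (F : R * R -> R) : (forall p, {for p, continuous F}) ->
  exists2 C : R, 0 < C & forall p, nsq p <= 1 -> `|F p| <= C.
Proof.
move=> cF.
have cn p : {for p, continuous (fun p => `|F p|)} by apply: cvg_norm; exact: cF.
have ne : [set p : R * R | 0 <= dsq (0, 0) p <= 1] !=set0.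
  by exists (0, 0); rewrite /= dsq0 /nsq /= expr0n addr0 lexx ler01.
have [c _ hc] := max_on_compact _ _ ne (compact_annulus (0, 0) 0 1) (fun p _ => cn p).
exists (`|F c| + 1); first by rewrite ltr_wpDl.
move=> p p1; apply: le_trans (hc p _) _; last by rewrite lerDl.
by rewrite /= dsq0 nsq_ge0 p1.
Qed.

Lemma disc_bounds w : exists C w0 : R, [/\ 0 < C, 0 < w0 &
  forall p, nsq p <= 1 -> [/\ w0 <= w p <= C, `|sw1 w p| <= C, `|sw2 w p| <= C &
    [/\ `|sw11 w p| <= C, `|sw12 w p| <= C & `|sw22 w p| <= C]]].
Proof.
have [C0 p0 h0] := disc_norm_bound w (sw_cont w).
have [C1 p1 h1] := disc_norm_bound _ (sw1_cont w).
have [C2 p2 h2] := disc_norm_bound _ (sw2_cont w).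
have [C3 p3 h3] := disc_norm_bound _ (sw11_cont w).
have [C4 p4 h4] := disc_norm_bound _ (sw12_cont w).
have [C5 p5 h5] := disc_norm_bound _ (sw22_cont w).
have [C6 p6 h6] := disc_norm_bound (fun p => (w p)^-1)
  (fun p => contV _ _ _ (lt0r_neq0 (sw_pos w p)) (sw_cont w p)).
exists (C0 + C1 + C2 + C3 + C4 + C5), C6^-1; split; rewrite ?invr_gt0 //.
  by rewrite !addr_gt0.
move=> p hp.
have wn : 0 <= w p := ltW (sw_pos w p).
have := h6 p hp; rewrite ger0_norm ?invr_ge0 // => h6p.
have := h0 p hp; rewrite ger0_norm // => h0p.
have k1 := h1 p hp; have k2 := h2 p hp; have k3 := h3 p hp.
have k4 := h4 p hp; have k5 := h5 p hp.
have -> : C6^-1 <= w p by rewrite invf_ple ?posrE ?sw_pos.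
by split; [| | |split]; rewrite /=; clear -ell p0 p1 p2 p3 p4 p5 h0p k1 k2 k3 k4 k5; lra.
Qed.

Lemma qf_bound (C h11 h12 h22 a b : R) : `|h11| <= C -> `|h12| <= C -> `|h22| <= C ->
  `|qf h11 h12 h22 a b| <= 2 * C * (a ^+ 2 + b ^+ 2).
Proof.
move=> h1 h2 h3.
have := qf_close h11 h12 h22 0 0 0 C; rewrite !subr0 => /(_ h1 h2 h3 a b) u1.
have := qf_close 0 0 0 h11 h12 h22 C; rewrite !sub0r !normrN => /(_ h1 h2 h3 a b) u2.
rewrite ler_norml; move: u1 u2.
have -> : qf 0 0 0 a b = 0 by rewrite /qf; ring.
by move=> u1 u2; apply/andP; split; clear -ell u1 u2; lra.
Qed.

(** First-order touching of V by W minus a barrier with gradient g and Hessian k. The second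
    derivatives of V enter only through a one-sided bound, and h = V - W measures the remaining gap.
    The bracket is the error to be compared with s (I - K e e^T). *)
Lemma perturb_form (W W1 W2 W11 W12 W22 h g1 g2 k11 k12 k22 V V1 V2 V11 V12 V22 a b : R) :
  0 < V -> V = W + h -> V1 = W1 - g1 -> V2 = W2 - g2 ->
  qf V11 V12 V22 a b <= qf (W11 - k11) (W12 - k12) (W22 - k22) a b ->
  qf (Adiag V V1 V2 V11) (Aoff V V12) (Adiag V V1 V2 V22) a b <=
  qf (Adiag W W1 W2 W11) (Aoff W W12) (Adiag W W1 W2 W22) a b +
   (2 * h * qf W11 W12 W22 a b - 2 * V * qf k11 k12 k22 a b +
    (2 * (W1 * g1 + W2 * g2) - (g1 ^+ 2 + g2 ^+ 2)) * (a ^+ 2 + b ^+ 2)).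
Proof.
move=> V0 e0 e1 e2 H.
have -> : qf (Adiag V V1 V2 V11) (Aoff V V12) (Adiag V V1 V2 V22) a b =
  2 * V * qf V11 V12 V22 a b - (V1 ^+ 2 + V2 ^+ 2) * (a ^+ 2 + b ^+ 2).
  by rewrite /qf /Adiag /Aoff; ring.
have H2 : 2 * V * qf V11 V12 V22 a b <=
   2 * V * qf (W11 - k11) (W12 - k12) (W22 - k22) a b.
  by rewrite ler_wpM2l // mulr_ge0 // ltW.
apply: le_trans (lerB H2 (lexx _)) _.
rewrite e1 e2 e0 le_eqVlt; apply/orP; left; apply/eqP.
rewrite /qf /Adiag /Aoff; ring.
Qed.

Lemma exp_barrier_jet (al t0 : R) c p :
  let E := expR (- al * dsq c p) in
  jet2 (fun z => expR (- al * dsq c z) - t0)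
    (fun z => 2 * (z.1 - c.1) * (- al * expR (- al * dsq c z)))
    (fun z => 2 * (z.2 - c.2) * (- al * expR (- al * dsq c z))) p
    (2 * (- al * E) + 4 * (p.1 - c.1) ^+ 2 * (al ^+ 2 * E))
    (4 * ((p.1 - c.1) * (p.2 - c.2)) * (al ^+ 2 * E))
    (2 * (- al * E) + 4 * (p.2 - c.2) ^+ 2 * (al ^+ 2 * E)).
Proof.
move=> E.
have d1 (t : R) : is_derive t (1 : R) (fun t => expR (- al * t)) (- al * expR (- al * t)).
  have h := derZ (- al) id t 1 (is_derive_id _ _).
  have := @is_derive1_comp R expR (fun t => - al * t) t _ _ (is_derive_expR _) h.
  by move=> /is_derive_eq; apply; ring.
apply: (radial_jet c (fun t => expR (- al * t) - t0) (fun t => - al * expR (- al * t))).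
  near=> t; have := derD _ _ _ _ _ (d1 t) (is_derive_cst (- t0) t (1 : R)).
  by move=> /is_derive_eq; apply; rewrite addr0.
have := derZ (- al) _ _ _ (d1 (dsq c p)).
by move=> /is_derive_eq; apply; rewrite /E; ring.
Unshelve. all: by end_near. Qed.

Definition dominates w := forall z, 0 < nsq z <= 1 -> kelvin w z <= w z.

(** If eps times the barrier exceeded w - kelvin w inside the annulus, w minus the barrier would
    touch [kelvin w] at an interior point. There the radial second derivative of the barrier, of
    order al^2, beats all other terms, of order al, and [comparison_on_compact] applies with e
    radial. *)
Lemma hopf_barrier w c (R1 R2 : R) : dominates w -> 0 < R1 -> R1 < R2 -> R2 <= 1 ->
  (forall z, dsq c z <= R2 -> 0 < nsq z <= 1) ->
  (forall z, dsq c z = R1 -> kelvin w z < w z) ->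
  exists eps al : R, [/\ 0 < eps, 0 < al & forall z, R1 <= dsq c z <= R2 ->
    eps * (expR (- al * dsq c z) - expR (- al * R2)) <= w z - kelvin w z].
Proof.
move=> dom R10 R12 R21 ball_in strict.
have [C [w0 [C0 w00 bd]]] := disc_bounds w.
have cpt := compact_annulus (0, 0) 0 (1 : R).
have [K [eta [K0 eta0 cmp]]] := comparison_on_compact ell w _ cpt.
(* The radial term - 4 w0 al^2 sg |z - c|^2 has to absorb - K s with s = 20 C al sg, where |z - c|^2
   > R1: this is 5 C K <= al w0 R1. *)
pose al := 1 + 5 * C * K / (w0 * R1).
have al0' : 0 < 5 * C * K / (w0 * R1) by rewrite divr_gt0 ?mulr_gt0.
have al1 : 1 <= al by rewrite /al lerDl ltW.
have al0 : 0 < al := lt_le_trans ltr01 al1.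
have alK : 5 * C * K <= al * w0 * R1.
  have -> : al * w0 * R1 = w0 * R1 + 5 * C * K.
    by rewrite /al; field; rewrite !gt_eqF.
  by rewrite lerDr mulr_ge0 // ltW.
have contD_ z : dsq c z <= R2 -> {for z, continuous (fun z => w z - kelvin w z)}.
  move=> /ball_in /andP[z0 _]; apply: contB; first exact: sw_cont.
  by apply: cont_kelvin; rewrite gt_eqF.
have [m m0 hm] : exists2 m : R, 0 < m & forall z, dsq c z = R1 -> m <= w z - kelvin w z.
  have ne : [set p | R1 <= dsq c p <= R1] !=set0.
    exists (c.1 + Num.sqrt R1, c.2); rewrite /= /dsq /= subrr expr0n addr0.
    by rewrite addrAC subrr add0r sqr_sqrtr ?(ltW R10) // lexx.
  have [d /= d1 hd] := min_on_compact _ (fun z => w z - kelvin w z) ne (compact_annulus c R1 R1)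
    (fun z hz => contD_ z (le_trans (proj2 (andP hz)) (ltW R12))).
  exists (w d - kelvin w d); first by rewrite subr_gt0 strict //; apply/eqP; rewrite eq_le andbC.
  by move=> z e; apply: hd; rewrite e lexx.
(* The three bounds serve the inner circle (eps < m), the lower bound w0 / 2 for [kelvin w] at the
   touching point, and s < eta. *)
pose eps := Num.min (m / 2) (Num.min (w0 / 2) (eta / (40 * C * al))).
have e40 : 0 < 40 * C * al by rewrite !mulr_gt0.
have eps0 : 0 < eps by rewrite !lt_min !divr_gt0.
have epsm : eps < m.
  apply: (@le_lt_trans _ _ (m / 2)); first by rewrite ge_min lexx.
  by rewrite ltr_pdivrMr // ltr_pMr // ltr1n.
have epsw : eps <= w0 / 2 by rewrite !ge_min lexx orbT.
have epseta : 20 * C * al * eps < eta.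
  have : eps <= eta / (40 * C * al) by rewrite !ge_min lexx !orbT.
  rewrite ler_pdivlMr // => h; have : 0 < C * al * eps by rewrite !mulr_gt0.
  by clear -ell h; lra.
exists eps, al; split => // p pR; rewrite leNgt; apply/negP => hp.
pose b z := expR (- al * dsq c z) - expR (- al * R2).
pose F z := eps * b z - (w z - kelvin w z).
have Fp : 0 < F p by rewrite subr_gt0.
have b1 z : b z <= expR (- al * dsq c z) by rewrite gerBl expR_ge0.
have E1 z : expR (- al * dsq c z) <= 1.
  by rewrite -expR0 ler_expR mulNr oppr_le0 mulr_ge0 ?dsq_ge0 // ltW.
have [||||z [zr Fz near_z]] := @annulus_interior_max R c R1 R2 F p.
- by [].
- move=> z /andP[_ zR2]; apply: contB; last exact: contD_.
  apply: contM; first exact: cont_cst.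
  apply: contB; last exact: cont_cst.
  apply: cont_comp; last exact: continuous_expR.
  by apply: contM; [exact: cont_cst | exact: cont_dsq].
- move=> z e; apply: lt_trans Fp; rewrite subr_lt0.
  apply: lt_le_trans (hm z e); apply: le_lt_trans epsm.
  by rewrite ler_piMr ?(ltW eps0) // (le_trans (b1 z)).
- move=> z e; apply: le_lt_trans Fp; rewrite /F /b e subrr mulr0 sub0r oppr_le0 subr_ge0.
  by apply: dom; apply: ball_in; rewrite e.
move/andP: zr => [zR1 zR2].
have [z0 z1] := andP (ball_in z (ltW zR2)).
have zn : nsq z != 0 by rewrite gt_eqF.
have v0 := kelvin_gt0 w z zn.
have [/andP[bw bC] bw1 bw2 [bw11 bw12 bw22]] := bd z z1.
have hv := dom z (ball_in z (ltW zR2)).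
set E := expR (- al * dsq c z).
have E0 : 0 < E := expR_gt0 _.
pose sg := eps * E.
have sg0 : 0 < sg by rewrite mulr_gt0.
have sge : sg <= eps by rewrite ler_piMr ?E1 // ltW.
have hlow : - sg <= kelvin w z - w z.
  have := lt_le_trans Fp Fz; rewrite subr_gt0 => h1.
  have h2 : eps * b z <= sg by rewrite ler_wpM2l ?b1 // ltW.
  by clear -ell h1 h2; lra.
have jb := exp_barrier_jet al (expR (- al * R2)) c z.
have jw : jet2 w (sw1 w) (sw2 w) z (sw11 w z) (sw12 w z) (sw22 w z).
  by split; [near=> t; exact: sw_grad | exact: sw1_grad | exact: sw2_grad].
have jbe : jet2 (fun t => eps * b t) (fun t => eps * (2 * (t.1 - c.1) * (- al * expR (- al * dsq c t))))
   (fun t => eps * (2 * (t.2 - c.2) * (- al * expR (- al * dsq c t)))) z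
    (eps * (2 * (- al * E) + 4 * (z.1 - c.1) ^+ 2 * (al ^+ 2 * E)))
    (eps * (4 * ((z.1 - c.1) * (z.2 - c.2)) * (al ^+ 2 * E)))
    (eps * (2 * (- al * E) + 4 * (z.2 - c.2) ^+ 2 * (al ^+ 2 * E))).
  move: jb => [n1 k1 k2]; split; try exact: grad_atZ.
  by apply: filterS n1 => t; exact: grad_atZ.
have touch : \forall t \near z, (w z - eps * b z) - kelvin w z <= (w t - eps * b t) - kelvin w t.
  by apply: filterS near_z => t; rewrite /F; clear; lra.
have [g1 g2 g3] := jet2_touch _ _ _ _ _ _ _ _ _ _ _ _ _
  (jet2B _ _ _ _ _ _ _ _ _ _ _ _ _ jw jbe) (kelvin_jet w z zn) touch.
pose r := Num.sqrt (dsq c z).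
have r2 : r ^+ 2 = dsq c z by rewrite sqr_sqrtr ?dsq_ge0.
have d0 : 0 < dsq c z := lt_trans R10 zR1.
have r0 : 0 < r by rewrite sqrtr_gt0.
(* [sg] is the size eps E of the barrier at z. The isotropic errors are 4 C sg from the gap times
   D^2 w, 4 C al sg from the barrier Hessian and 8 C al sg from the gradients; as al >= 1, the value
   20 C al sg covers them. *)
apply: (cmp z _ _ _ (20 * C * al * sg) ((z.1 - c.1) / r) ((z.2 - c.2) / r) _ (kelvin_good w z zn)).
- by rewrite /= dsq0 nsq_ge0.
- by rewrite !mulr_gt0.
- by apply: le_lt_trans epseta; rewrite ler_wpM2l // !mulr_ge0 // ltW.
- by rewrite !expr_div_n -mulrDl r2 divff // gt_eqF.
move=> x y.
apply: le_trans (perturb_form (w z) (sw1 w z) (sw2 w z) (sw11 w z) (sw12 w z) (sw22 w z)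
   (kelvin w z - w z) _ _ _ _ _ _ _ _ _ _ _ x y v0 _ (esym g1) (esym g2) (g3 x y)) _.
  by rewrite addrC subrK.
rewrite lerD2l.
set V := kelvin w z in v0 hv hlow *.
have VL : w0 / 2 <= V by clear -ell hlow sge epsw bw; lra.
have VC : V <= C := le_trans hv bC.
set S := x ^+ 2 + y ^+ 2; have S0 : 0 <= S by rewrite addr_ge0 ?sqr_ge0.
pose X := z.1 - c.1; pose Y := z.2 - c.2.
have dE : dsq c z = X ^+ 2 + Y ^+ 2 by [].
rewrite -/X -/Y -/E.
have T1 : 2 * (V - w z) * qf (sw11 w z) (sw12 w z) (sw22 w z) x y <= 4 * C * sg * S.
  apply: le_trans (ler_norm _) _; rewrite normrM.
  have -> : 4 * C * sg * S = (2 * sg) * (2 * C * S) by ring.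
  apply: ler_pM => //; last exact: qf_bound.
  rewrite normrM [`|2|]ger0_norm // ler_pM2l // ler_norml; apply/andP; split => //.
  by apply: le_trans (ltW sg0); rewrite subr_le0.
have T2 : - (2 * V * qf (eps * (2 * (- al * E) + 4 * X ^+ 2 * (al ^+ 2 * E)))
     (eps * (4 * (X * Y) * (al ^+ 2 * E))) (eps * (2 * (- al * E) + 4 * Y ^+ 2 * (al ^+ 2 * E))) x y)
   <= 4 * C * al * sg * S - 4 * w0 * al ^+ 2 * sg * (X * x + Y * y) ^+ 2.
  have -> : qf (eps * (2 * (- al * E) + 4 * X ^+ 2 * (al ^+ 2 * E)))
     (eps * (4 * (X * Y) * (al ^+ 2 * E))) (eps * (2 * (- al * E) + 4 * Y ^+ 2 * (al ^+ 2 * E))) x y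
    = - (2 * al * sg * S) + 4 * al ^+ 2 * sg * (X * x + Y * y) ^+ 2.
    by rewrite /qf /S /sg; ring.
  have -> : - (2 * V * (- (2 * al * sg * S) + 4 * al ^+ 2 * sg * (X * x + Y * y) ^+ 2)) =
    V * (4 * al * sg * S) - V * (8 * al ^+ 2 * sg * (X * x + Y * y) ^+ 2) by ring.
  have -> : 4 * C * al * sg * S = C * (4 * al * sg * S) by ring.
  have -> : 4 * w0 * al ^+ 2 * sg * (X * x + Y * y) ^+ 2 =
    (w0 / 2) * (8 * al ^+ 2 * sg * (X * x + Y * y) ^+ 2) by field.
  apply: lerB; apply: ler_wpM2r => //.
    by do ![apply: mulr_ge0] => //; apply: ltW.
  by apply: mulr_ge0; [apply: mulr_ge0 (ltW sg0); apply: mulr_ge0 => //; exact: sqr_ge0 | exact: sqr_ge0].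
have XY1 : `|X| <= 1 /\ `|Y| <= 1.
  split; apply: sqr_le_norm => //; rewrite expr1n; apply: le_trans R21; apply: le_trans (ltW zR2); rewrite dE.
    by rewrite lerDl sqr_ge0.
  by rewrite lerDr sqr_ge0.
have T3 : 2 * (sw1 w z * (eps * (2 * X * (- al * E))) + sw2 w z * (eps * (2 * Y * (- al * E)))) -
   ((eps * (2 * X * (- al * E))) ^+ 2 + (eps * (2 * Y * (- al * E))) ^+ 2) <= 8 * C * al * sg.
  have -> : 2 * (sw1 w z * (eps * (2 * X * (- al * E))) + sw2 w z * (eps * (2 * Y * (- al * E)))) =
    4 * al * sg * (- (sw1 w z * X) - sw2 w z * Y) by rewrite /sg; ring.
  have u1 : - (sw1 w z * X) <= C.
    apply: le_trans (ler_norm _) _; rewrite normrN normrM -[leRHS]mulr1.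
    by apply: ler_pM => //; case: XY1.
  have u2 : - (sw2 w z * Y) <= C.
    apply: le_trans (ler_norm _) _; rewrite normrN normrM -[leRHS]mulr1.
    by apply: ler_pM => //; case: XY1.
  have u3 : 4 * al * sg * (- (sw1 w z * X) - sw2 w z * Y) <= 4 * al * sg * (2 * C).
    rewrite ler_wpM2l //; last by clear -ell u1 u2; lra.
    by do ![apply: mulr_ge0] => //; apply: ltW.
  have u4 : 0 <= (eps * (2 * X * (- al * E))) ^+ 2 + (eps * (2 * Y * (- al * E))) ^+ 2.
    by rewrite addr_ge0 ?sqr_ge0.
  by clear -ell u3 u4; lra.
have T3' := ler_wpM2r S0 T3.
have T4 : 20 * C * al * sg * (K * (X / r * x + Y / r * y) ^+ 2) <=
    4 * w0 * al ^+ 2 * sg * (X * x + Y * y) ^+ 2.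
  have -> : X / r * x + Y / r * y = (X * x + Y * y) / r by field; rewrite gt_eqF.
  rewrite expr_div_n r2.
  have -> : 20 * C * al * sg * (K * ((X * x + Y * y) ^+ 2 / dsq c z)) =
    (4 * al * sg * (X * x + Y * y) ^+ 2 / dsq c z) * (5 * C * K) by field; rewrite gt_eqF.
  have -> : 4 * w0 * al ^+ 2 * sg * (X * x + Y * y) ^+ 2 =
    (4 * al * sg * (X * x + Y * y) ^+ 2 / dsq c z) * (al * w0 * dsq c z).
    by field; rewrite gt_eqF.
  apply: ler_wpM2l.
    apply: divr_ge0 (ltW d0); apply: mulr_ge0; last exact: sqr_ge0.
    by do ![apply: mulr_ge0] => //; apply: ltW.
  by apply: le_trans alK _; rewrite ler_wpM2l ?(ltW zR1) // mulr_ge0 // ltW.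
have T5 : 4 * C * sg * S <= 4 * C * al * sg * S.
  have -> : 4 * C * al * sg * S = al * (4 * C * sg * S) by ring.
  rewrite ler_peMl //; do ![apply: mulr_ge0] => //; exact: ltW.
have T6 : 0 <= C * al * sg * S by do ![apply: mulr_ge0] => //; apply: ltW.
move: T1 T2 T3' T4 T5 T6.
set A1_ := 2 * (V - w z) * _; set A2_ := 2 * V * _; set A3_ := (2 * _ - _) * S.
set A4_ := K * _; set A5_ := _ * (X * x + Y * y) ^+ 2.
clear -ell => T1 T2 T3 T4 T5 T6.
have -> : 20 * C * al * sg * (S - A4_) = 20 * C * al * sg * S - 20 * C * al * sg * A4_ by ring.
by lra.
Unshelve. all: by end_near. Qed.

End Perturbation.

(** * A uniform gap at the puncture *)

Section PunctureStrict.
Context {R : realType} {q : R} {G G1 G2 : R * R -> R} (ell : elliptic q G G1 G2).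
Notation sol := (@solution R q G).
Implicit Types (w : sol) (p z c : R * R).

Lemma norm_jet p : 0 < nsq p -> let r := Num.sqrt (nsq p) in
  jet2 (fun z => Num.sqrt (nsq z)) (fun z => z.1 / Num.sqrt (nsq z))
    (fun z => z.2 / Num.sqrt (nsq z)) p
    (p.2 ^+ 2 / r ^+ 3) (- (p.1 * p.2) / r ^+ 3) (p.1 ^+ 2 / r ^+ 3).
Proof.
move=> p0 r.
have r0 : 0 < r by rewrite sqrtr_gt0.
have r2 : r ^+ 2 = nsq p by rewrite sqr_sqrtr // ltW.
have d1 (t : R) : 0 < t -> is_derive t (1 : R) Num.sqrt ((2 * Num.sqrt t)^-1).
  exact: is_derive1_sqrt.
have nd : \forall t \near dsq (0, 0) p, is_derive t (1 : R) Num.sqrt ((2 * Num.sqrt t)^-1).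
  by rewrite dsq0; apply: filterS (lt_nbhsr p0) => t; exact: d1.
have d2 : is_derive (dsq (0, 0) p) (1 : R) (fun t : R => (2 * Num.sqrt t)^-1)
    (- (4 * r ^+ 3)^-1).
  rewrite dsq0; have h := derZ 2 _ _ _ (d1 _ p0).
  have hn : 2 * Num.sqrt (nsq p) != 0 by rewrite mulf_neq0 // gt_eqF.
  have := derV (fun t => 2 * Num.sqrt t) _ _ hn h.
  by move=> /is_derive_eq; apply; rewrite -/r; field; rewrite gt_eqF.
have [n1 g1 g2] := radial_jet (0, 0) Num.sqrt (fun t => (2 * Num.sqrt t)^-1) _ p nd d2.
have E1 : (fun z : R * R => 2 * (z.1 - 0) * (2 * Num.sqrt (dsq (0, 0) z))^-1) =
   (fun z => z.1 / Num.sqrt (nsq z)).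
  by apply/funext => z; rewrite dsq0 subr0 invfM mulrACA divff ?mul1r.
have E2 : (fun z : R * R => 2 * (z.2 - 0) * (2 * Num.sqrt (dsq (0, 0) z))^-1) =
   (fun z => z.2 / Num.sqrt (nsq z)).
  by apply/funext => z; rewrite dsq0 subr0 invfM mulrACA divff ?mul1r.
rewrite /= E1 dsq0 -/r in g1; rewrite /= E2 dsq0 -/r in g2.
have e1 : p.1 ^+ 2 = r ^+ 2 - p.2 ^+ 2 by rewrite r2 /nsq; ring.
have e2 : p.2 ^+ 2 = r ^+ 2 - p.1 ^+ 2 by rewrite r2 /nsq; ring.
split.
- apply: filterS n1 => z; rewrite /= dsq0 !subr0.
  by move=> /grad_at_eq; apply; rewrite invfM mulrACA divff ?mul1r.
- apply: (grad_at_eq _ _ _ _ _ _ g1); rewrite /= !subr0.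
    by rewrite e1; field; rewrite gt_eqF.
  by field; rewrite gt_eqF.
- apply: (grad_at_eq _ _ _ _ _ _ g2); rewrite /= !subr0.
    by field; rewrite gt_eqF.
  by rewrite e2; field; rewrite gt_eqF.
Qed.

Lemma cont_norm p : {for p, continuous (fun z => Num.sqrt (nsq z) : R)}.
Proof. by apply: cont_comp; [exact: cont_nsq | exact: sqrt_continuous]. Qed.

Lemma circle_nonempty (r : R) : 0 <= r -> [set p : R * R | r <= dsq (0, 0) p <= r] !=set0.
Proof.
move=> r0; exists (Num.sqrt r, 0).
by rewrite /= dsq0 /nsq /= expr0n addr0 sqr_sqrtr // lexx.
Qed.

(* Near the puncture the cone [- eps |z|] has one very negative second derivative, so
   [w - eps |z|] cannot touch [kelvin w] from above. *)
Lemma puncture_cone w : dominates w ->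
  (forall z, 0 < nsq z < 1 -> kelvin w z < w z) ->
  exists eps r : R, [/\ 0 < eps, 0 < r, r < 1 &
    forall z, 0 < nsq z <= r -> eps * Num.sqrt (nsq z) <= w z - kelvin w z].
Proof.
move=> dom strict.
have [C [w0 [C0 w00 bd]]] := disc_bounds w.
have cpt := compact_annulus (0, 0) 0 (1 : R).
have [K [eta [K0 eta0 cmp]]] := comparison_on_compact ell w _ cpt.
(* At distance r from the origin the Hessian of eps |z| contributes w0 eps / r in the tangential
   direction; it absorbs K s with s = 8 C eps as soon as 8 C K r <= w0. *)
pose r0 := Num.min (2^-1) (w0 / (8 * C * K)).
have r00 : 0 < r0 by rewrite lt_min invr_gt0 ltr0n divr_gt0 // !mulr_gt0.
have r01 : r0 < 1.
  apply: (@le_lt_trans _ _ 2^-1); first by rewrite ge_min lexx.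
  by rewrite invf_lt1 ?ltr1n.
have rK : 8 * C * K * r0 <= w0.
  have : r0 <= w0 / (8 * C * K) by rewrite ge_min lexx orbT.
  by rewrite ler_pdivlMr ?mulr_gt0 // mulrC.
pose rr := r0 ^+ 2.
have rr0 : 0 < rr by rewrite exprn_gt0.
have rr1 : rr < 1 by rewrite exprn_ilt1 // ltW.
have sqrr : Num.sqrt rr = r0 by rewrite sqrtr_sqr ger0_norm // ltW.
have contD_ z : 0 < nsq z -> {for z, continuous (fun z => w z - kelvin w z)}.
  move=> z0; apply: contB; first exact: sw_cont.
  by apply: cont_kelvin; rewrite gt_eqF.
have [m m0 hm] : exists2 m : R, 0 < m & forall z, nsq z = rr -> m <= w z - kelvin w z.
  have [d + hd] := min_on_compact _ (fun z => w z - kelvin w z) (circle_nonempty rr (ltW rr0))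
    (compact_annulus (0, 0) rr rr)
    (fun z hz => contD_ z (lt_le_trans rr0 (eq_ind _ (fun f => is_true (rr <= f z)) (proj1 (andP hz)) _ dsq0))).
  rewrite /= dsq0 => /andP[d1 d2].
  exists (w d - kelvin w d).
    by rewrite subr_gt0 strict // (lt_le_trans rr0 d1) (le_lt_trans d2).
  by move=> z e; apply: hd; rewrite /= dsq0 e lexx.
pose eps := Num.min (m / 2) (Num.min (w0 / 2) (eta / (16 * C))).
have e16 : 0 < 16 * C by rewrite !mulr_gt0.
have eps0 : 0 < eps by rewrite !lt_min !divr_gt0.
have epsm : eps < m.
  apply: (@le_lt_trans _ _ (m / 2)); first by rewrite ge_min lexx.
  by rewrite ltr_pdivrMr // ltr_pMr // ltr1n.
have epsw : eps <= w0 / 2 by rewrite !ge_min lexx orbT.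
have epseta : 8 * C * eps < eta.
  have : eps <= eta / (16 * C) by rewrite !ge_min lexx !orbT.
  rewrite ler_pdivlMr // => h; have : 0 < C * eps by rewrite !mulr_gt0.
  by clear -ell h; lra.
exists eps, rr; split => // p /andP[p0 pr]; rewrite leNgt; apply/negP => hp.
pose F z := eps * Num.sqrt (nsq z) - (w z - kelvin w z).
have Fp : 0 < F p by rewrite subr_gt0.
(* On the circle nsq = R' domination gives F <= eps sqrt R' < F p, which keeps the maximum away from
   the puncture. *)
pose R' := Num.min (nsq p / 2) ((F p / eps / 2) ^+ 2).
have R'0 : 0 < R' by rewrite lt_min divr_gt0 //= exprn_gt0 // !divr_gt0.
have R'p : R' < nsq p.
  apply: (@le_lt_trans _ _ (nsq p / 2)); first by rewrite ge_min lexx.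
  by rewrite ltr_pdivrMr // ltr_pMr // ltr1n.
have sR' : eps * Num.sqrt R' < F p.
  apply: (@le_lt_trans _ _ (F p / 2)); last by rewrite ltr_pdivrMr // ltr_pMr // ltr1n.
  have -> : F p / 2 = eps * (F p / eps / 2) by field; rewrite gt_eqF.
  rewrite ler_pM2l // -[leRHS]ger0_norm ?divr_ge0 ?(ltW Fp) ?(ltW eps0) //.
  by rewrite -sqrtr_sqr ler_wsqrtr // ge_min lexx orbT.
have [||||z [zr Fz near_z]] := @annulus_interior_max R (0, 0) R' rr F p.
- by rewrite dsq0 (ltW R'p) pr.
- rewrite dsq0 => z /andP[z1 _]; apply: contB; last by apply: contD_; exact: lt_le_trans z1.
  by apply: contM; [exact: cont_cst | exact: cont_norm].
- rewrite dsq0 => z e; apply: le_lt_trans sR'; rewrite /F e gerBl subr_ge0.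
  by apply: dom; rewrite e R'0 /= ltW // (lt_trans R'p) // (le_lt_trans pr).
- rewrite dsq0 => z e; apply: lt_trans Fp; rewrite subr_lt0 e sqrr.
  apply: lt_le_trans (hm z e); apply: le_lt_trans epsm.
  by rewrite ler_piMr // ltW.
rewrite dsq0 in zr; move/andP: zr => [zR' zrr].
have z0 : 0 < nsq z := lt_trans R'0 zR'.
have zn : nsq z != 0 by rewrite gt_eqF.
have z1 : nsq z <= 1 := ltW (lt_trans zrr rr1).
have v0 := kelvin_gt0 w z zn.
have [/andP[bw bC] bw1 bw2 [bw11 bw12 bw22]] := bd z z1.
have hv : kelvin w z <= w z by apply: dom; rewrite z0 z1.
set r := Num.sqrt (nsq z).
have r_gt0 : 0 < r by rewrite sqrtr_gt0.
have r2 : r ^+ 2 = nsq z by rewrite sqr_sqrtr // ltW.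
have rr0' : r <= r0 by rewrite -sqrr ler_wsqrtr // ltW.
have r1 : r <= 1 := le_trans rr0' (ltW r01).
have ere : eps * r <= eps by rewrite ler_piMr // ltW.
have hlow : - (eps * r) <= kelvin w z - w z.
  have := lt_le_trans Fp Fz; rewrite /F subr_gt0 -/r => h1.
  by clear -ell h1; lra.
have jw : jet2 w (sw1 w) (sw2 w) z (sw11 w z) (sw12 w z) (sw22 w z).
  by split; [near=> t; exact: sw_grad | exact: sw1_grad | exact: sw2_grad].
have [n1 k1 k2] := norm_jet z z0.
rewrite -/r in k1 k2.
have jbe : jet2 (fun t => eps * Num.sqrt (nsq t)) (fun t => eps * (t.1 / Num.sqrt (nsq t)))
   (fun t => eps * (t.2 / Num.sqrt (nsq t))) z
   (eps * (z.2 ^+ 2 / r ^+ 3)) (eps * (- (z.1 * z.2) / r ^+ 3)) (eps * (z.1 ^+ 2 / r ^+ 3)).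
  split; try exact: grad_atZ.
  by apply: filterS n1 => t; exact: grad_atZ.
have touch : \forall t \near z, (w z - eps * Num.sqrt (nsq z)) - kelvin w z <=
    (w t - eps * Num.sqrt (nsq t)) - kelvin w t.
  by apply: filterS near_z => t; rewrite /F; clear; lra.
have [g1 g2 g3] := jet2_touch _ _ _ _ _ _ _ _ _ _ _ _ _
  (jet2B _ _ _ _ _ _ _ _ _ _ _ _ _ jw jbe) (kelvin_jet w z zn) touch.
rewrite -/r in g1 g2.
(* The Hessian of |z| is the tangential projection divided by |z|, so e is tangential. The isotropic
   errors are 4 C eps from the gap times D^2 w and 4 C eps from the gradients. *)
apply: (cmp z _ _ _ (8 * C * eps) (- z.2 / r) (z.1 / r) _ (kelvin_good w z zn)) => //.
- by rewrite /= dsq0 nsq_ge0.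
- by rewrite !mulr_gt0.
- by rewrite !expr_div_n -mulrDl sqrrN r2 /nsq addrC divff // gt_eqF.
move=> x y.
apply: le_trans (perturb_form (w z) (sw1 w z) (sw2 w z) (sw11 w z) (sw12 w z) (sw22 w z)
   (kelvin w z - w z) _ _ _ _ _ _ _ _ _ _ _ x y v0 _ (esym g1) (esym g2) (g3 x y)) _.
  by rewrite addrC subrK.
rewrite lerD2l.
set V := kelvin w z in v0 hv hlow *.
have VL : w0 / 2 <= V by clear -ell hlow ere epsw bw; lra.
set S := x ^+ 2 + y ^+ 2; have S0 : 0 <= S by rewrite addr_ge0 ?sqr_ge0.
have T1 : 2 * (V - w z) * qf (sw11 w z) (sw12 w z) (sw22 w z) x y <= 4 * C * eps * S.
  apply: le_trans (ler_norm _) _; rewrite normrM.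
  have -> : 4 * C * eps * S = (2 * eps) * (2 * C * S) by ring.
  apply: ler_pM => //; last exact: qf_bound.
  rewrite normrM [`|2|]ger0_norm // ler_pM2l // ler_norml; apply/andP; split.
    by apply: le_trans hlow; rewrite lerN2.
  by apply: le_trans (ltW eps0); rewrite subr_le0.
pose Q := (z.1 * y - z.2 * x) ^+ 2.
have Q0 : 0 <= Q by exact: sqr_ge0.
have T2 : w0 * eps * Q / r ^+ 3 <= 2 * V * qf (eps * (z.2 ^+ 2 / r ^+ 3))
    (eps * (- (z.1 * z.2) / r ^+ 3)) (eps * (z.1 ^+ 2 / r ^+ 3)) x y.
  have -> : 2 * V * qf (eps * (z.2 ^+ 2 / r ^+ 3))
    (eps * (- (z.1 * z.2) / r ^+ 3)) (eps * (z.1 ^+ 2 / r ^+ 3)) x y =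
    V * (2 * eps * Q / r ^+ 3) by rewrite /qf /Q; field; rewrite gt_eqF.
  have -> : w0 * eps * Q / r ^+ 3 = w0 / 2 * (2 * eps * Q / r ^+ 3).
    by field; rewrite gt_eqF.
  apply: ler_wpM2r => //; apply: divr_ge0; last by rewrite exprn_ge0 // ltW.
  by apply: mulr_ge0 => //; apply: mulr_ge0 => //; exact: ltW.
have zr1 : `|z.1 / r| <= 1 /\ `|z.2 / r| <= 1.
  split; apply: sqr_le_norm => //; rewrite expr1n expr_div_n ler_pdivrMr ?exprn_gt0 // mul1r r2 /nsq.
    by rewrite lerDl sqr_ge0.
  by rewrite lerDr sqr_ge0.
have T3 : 2 * (sw1 w z * (eps * (z.1 / r)) + sw2 w z * (eps * (z.2 / r))) -
   ((eps * (z.1 / r)) ^+ 2 + (eps * (z.2 / r)) ^+ 2) <= 4 * C * eps.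
  have -> : 2 * (sw1 w z * (eps * (z.1 / r)) + sw2 w z * (eps * (z.2 / r))) =
    2 * eps * (sw1 w z * (z.1 / r) + sw2 w z * (z.2 / r)) by ring.
  have u1 : sw1 w z * (z.1 / r) <= C.
    apply: le_trans (ler_norm _) _; rewrite normrM -[leRHS]mulr1.
    by apply: ler_pM => //; case: zr1.
  have u2 : sw2 w z * (z.2 / r) <= C.
    apply: le_trans (ler_norm _) _; rewrite normrM -[leRHS]mulr1.
    by apply: ler_pM => //; case: zr1.
  have u3 : 2 * eps * (sw1 w z * (z.1 / r) + sw2 w z * (z.2 / r)) <= 2 * eps * (C + C).
    by rewrite ler_wpM2l ?lerD // mulr_ge0 // ltW.
  have u4 : 0 <= (eps * (z.1 / r)) ^+ 2 + (eps * (z.2 / r)) ^+ 2.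
    by rewrite addr_ge0 ?sqr_ge0.
  by clear -ell u3 u4; lra.
have T3' := ler_wpM2r S0 T3.
have T4 : 8 * C * eps * (K * (- z.2 / r * x + z.1 / r * y) ^+ 2) <= w0 * eps * Q / r ^+ 3.
  have -> : 8 * C * eps * (K * (- z.2 / r * x + z.1 / r * y) ^+ 2) =
    (eps * Q / r ^+ 3) * (8 * C * K * r).
    by rewrite /Q; field; rewrite gt_eqF.
  have -> : w0 * eps * Q / r ^+ 3 = (eps * Q / r ^+ 3) * w0 by field; rewrite gt_eqF.
  apply: ler_wpM2l.
    by rewrite divr_ge0 ?exprn_ge0 ?(ltW r_gt0) // mulr_ge0 // ltW.
  by apply: le_trans rK; rewrite ler_pM2l // !mulr_gt0.
move: T1 T2 T3' T4.
set A1_ := 2 * (V - w z) * _; set A2_ := 2 * V * _; set A3_ := (2 * _ - _) * S.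
set A4_ := K * _; set A5_ := _ / r ^+ 3.
clear -ell => T1 T2 T3 T4.
have -> : 8 * C * eps * (S - A4_) = 8 * C * eps * S - 8 * C * eps * A4_ by ring.
by lra.
Unshelve. all: by end_near. Qed.

(** A mean value along the segment from the origin, with continuity of the gradient of ln w there.
    It yields the affine function to which [kelvin_log_subharmonic] is applied. *)
Lemma ln_taylor w (d : R) : 0 < d -> exists2 r : R, 0 < r & forall z,
  nsq z <= r ^+ 2 ->
  `|ln (w z) - (ln (w (0, 0)) + sw1 w (0, 0) / w (0, 0) * z.1 +
     sw2 w (0, 0) / w (0, 0) * z.2)| <= d * Num.sqrt (nsq z).
Proof.
move=> d0; pose o : R * R := (0, 0).
pose a1 z := sw1 w z / w z; pose a2 z := sw2 w z / w z.
have c1 : {for o, continuous a1}.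
  apply: contM; first exact: sw1_cont.
  by apply: contV; [exact: lt0r_neq0 (sw_pos w _) | exact: sw_cont].
have c2 : {for o, continuous a2}.
  apply: contM; first exact: sw2_cont.
  by apply: contV; [exact: lt0r_neq0 (sw_pos w _) | exact: sw_cont].
have d2 : 0 < d / 2 by rewrite divr_gt0.
move/cvgrPdist_lt : c1 => /(_ _ d2) c1; move/cvgrPdist_lt : c2 => /(_ _ d2) c2.
have nb : \forall z \near o, `|a1 o - a1 z| < d / 2 /\ `|a2 o - a2 z| < d / 2.
  by near=> z; split; near: z; assumption.
have /nbhs_ballP[r /= r0 Hr] := nb.
exists (r / 2); first by rewrite divr_gt0.
move=> z zr.
pose l (t : R) := (o.1 + t * z.1, o.2 + t * z.2).
have dl (t : R) : is_derive t (1 : R) (fun t => ln (w (l t))) (a1 (l t) * z.1 + a2 (l t) * z.2).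
  have := grad_at_comp1 _ _ _ _ _ _ (is_derive1_ln (sw_pos w (l t))) (sw_grad w (l t)).
  by move=> /grad_at_line_at /is_derive_eq; apply; rewrite /a1 /a2 ![_^-1 * _]mulrC.
have [t ht] := MVT_between _ _ 0 1 dl.
rewrite !subr0 mulr1 => E; rewrite !subr0 normr1 in ht.
have l1 : l 1 = z by rewrite /l /= !mul1r !add0r -surjective_pairing.
have l0 : l 0 = o by rewrite /l /= !mul0r !addr0.
rewrite l1 l0 in E.
have z1r : `|z.1| <= Num.sqrt (nsq z) /\ `|z.2| <= Num.sqrt (nsq z).
  split; apply: sqr_le_norm; rewrite ?sqrtr_ge0 // sqr_sqrtr ?nsq_ge0 // /nsq.
    by rewrite lerDl sqr_ge0.
  by rewrite lerDr sqr_ge0.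
have sz : Num.sqrt (nsq z) <= r / 2.
  by rewrite -[leRHS]ger0_norm ?divr_ge0 ?(ltW r0) // -sqrtr_sqr ler_wsqrtr.
have r2 : r / 2 < r by rewrite ltr_pdivrMr // ltr_pMr // ltr1n.
have [k1 k2] : `|a1 o - a1 (l t)| < d / 2 /\ `|a2 o - a2 (l t)| < d / 2.
  apply: Hr; split; rewrite /= /ball /= opprD addrA subrr add0r normrN normrM.
    by apply: le_lt_trans r2; apply: le_trans sz; apply: le_trans (proj1 z1r); rewrite ler_piMl.
  by apply: le_lt_trans r2; apply: le_trans sz; apply: le_trans (proj2 z1r); rewrite ler_piMl.
have -> : ln (w z) - (ln (w o) + a1 o * z.1 + a2 o * z.2) =
   - ((a1 o - a1 (l t)) * z.1 + (a2 o - a2 (l t)) * z.2).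
  have -> : ln (w z) = ln (w o) + (a1 (l t) * z.1 + a2 (l t) * z.2) by rewrite -E addrC subrK.
  ring.
rewrite normrN (le_trans (ler_normD _ _)) // !normrM [d]splitr mulrDl.
apply: lerD; apply: ler_pM => //; [exact: ltW | by case: z1r | exact: ltW | by case: z1r].
Unshelve. all: by end_near. Qed.

Lemma ln_sub_le (x y : R) : 0 < x -> y < x -> ln (x - y) <= ln x - y / x.
Proof.
move=> x0 yx; have -> : x - y = x * (1 + - (y / x)) by field; rewrite gt_eqF.
have h : 0 < 1 + - (y / x) by rewrite subr_gt0 ltr_pdivrMr // mul1r.
rewrite lnM ?posrE // lerD2l; have := le_ln1Dx; move=> /(_ R (- (y / x))).
by apply; rewrite ltrNl opprK ltr_pdivrMr // mul1r.
Qed.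

(** A gap of order |z| degenerates at the puncture. On a fixed small circle it lowers ln (kelvin w)
    below the affine Taylor polynomial of ln w by a constant k, and log-subharmonicity carries this
    constant to all smaller radii. *)
Lemma puncture_strict w : dominates w ->
  (forall z, 0 < nsq z < 1 -> kelvin w z < w z) ->
  exists c r : R, [/\ 0 < c, 0 < r & forall z, 0 < nsq z <= r -> c <= w z - kelvin w z].
Proof.
move=> dom strict.
have [eps [r0 [eps0 r00 r01 cone_le]]] := puncture_cone w dom strict.
have [C [w0 [C0 w00 bd]]] := disc_bounds w.
have dl0 : 0 < eps / (4 * C) by rewrite divr_gt0 // mulr_gt0.
have [r1 r10 tay] := ln_taylor w _ dl0; set dl := eps / (4 * C) in dl0 tay.
set a0 := ln (w (0, 0)) in tay; set a1 := _ / _ in tay; set a2 := sw2 w _ / _ in tay.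
pose rho := Num.min r0 (r1 ^+ 2).
have rho0 : 0 < rho by rewrite lt_min r00 exprn_gt0.
have rho1 : rho <= 1 by rewrite ge_min (ltW r01).
pose r := Num.sqrt rho; have rgt0 : 0 < r by rewrite sqrtr_gt0.
(* On the circle the cone bound lowers ln w by at least eps r / C = 2 k, and the Taylor error dl r
   is k / 2, so a drop of k survives. *)
pose k := eps * r / (2 * C).
have k0 : 0 < k by rewrite divr_gt0 ?mulr_gt0.
have bdry z : nsq z = rho -> ln (kelvin w z) <= (a0 - k) + a1 * z.1 + a2 * z.2.
  move=> e; have z1 : nsq z <= 1 by rewrite e.
  have zn : nsq z != 0 by rewrite e gt_eqF.
  have v0 := kelvin_gt0 w z zn.
  have h1 : eps * r <= w z - kelvin w z.
    by rewrite /r -e; apply: cone_le; rewrite e rho0 ge_min lexx.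
  have h2 : ln (kelvin w z) <= ln (w z - eps * r).
    rewrite ler_ln ?posrE //; last by clear -ell h1 v0; lra.
    by clear -ell h1 v0; lra.
  have h3 := ln_sub_le (w z) (eps * r) (sw_pos w z).
  have {}h3 : ln (w z - eps * r) <= ln (w z) - eps * r / w z.
    by apply: h3; clear -ell h1 v0; lra.
  have [/andP[_ wC] _ _ _] := bd z z1.
  have h4 : 2 * k <= eps * r / w z.
    have -> : 2 * k = eps * r / C by rewrite /k; field; rewrite gt_eqF.
    by rewrite ler_pM2l ?mulr_gt0 // lef_pV2 ?posrE ?sw_pos.
  have := tay z; rewrite e ge_min lexx orbT => /(_ erefl).
  have -> : dl * Num.sqrt rho = k / 2 by rewrite /dl /k -/r; field; rewrite gt_eqF.
  rewrite ler_norml => /andP[_ h5].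
  by clear -ell h2 h3 h4 h5 k0; lra.
have rho01 : 0 < rho <= 1 by rewrite rho0.
have inner := kelvin_log_subharmonic ell w rho (a0 - k) a1 a2 rho01 bdry.
(* Within this radius the Taylor error is at most k / 2, so half of the drop remains after going
   back from the affine function to ln w. *)
pose r' := Num.min rho ((k / (2 * dl)) ^+ 2).
have kd0 : 0 < k / (2 * dl) by rewrite divr_gt0 // mulr_gt0.
have r'0 : 0 < r' by rewrite lt_min rho0 exprn_gt0.
exists (w0 * (1 - expR (- (k / 2)))), r'; split => //.
  by rewrite mulr_gt0 // subr_gt0 -expR0 ltr_expR oppr_lt0 divr_gt0.
move=> z /andP[z0 zr'].
have zr : nsq z <= rho by apply: le_trans zr' _; rewrite ge_min lexx.
have v0 := kelvin_gt0 w z (lt0r_neq0 z0).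
have h1 := inner z; rewrite z0 zr in h1; have {}h1 := h1 isT.
have h2 := tay z; have {}h2 := h2 (le_trans zr _).
have : rho <= r1 ^+ 2 by rewrite ge_min lexx orbT.
move=> /h2; rewrite ler_norml => /andP[{}h2 _].
have h3 : dl * Num.sqrt (nsq z) <= k / 2.
  have -> : k / 2 = dl * (k / (2 * dl)) by field; rewrite gt_eqF.
  rewrite ler_pM2l // -[leRHS]ger0_norm ?(ltW kd0) // -sqrtr_sqr ler_wsqrtr //.
  by apply: le_trans zr' _; rewrite ge_min lexx orbT.
have h4 : ln (kelvin w z) <= ln (w z) - k / 2 by clear -ell h1 h2 h3; lra.
have h5 : kelvin w z <= w z * expR (- (k / 2)).
  rewrite -[leLHS]lnK ?posrE // -[w z in leRHS]lnK ?posrE ?sw_pos // -expRD ler_expR.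
  exact: h4.
have [/andP[wz _] _ _ _] := bd z (le_trans zr rho1).
apply: (@le_trans _ _ (w z * (1 - expR (- (k / 2))))).
  rewrite ler_wpM2r // subr_ge0 -expR0 ler_expR oppr_le0 divr_ge0 // ltW //.
by rewrite mulrBr mulr1 lerD2l lerN2.
Qed.

End PunctureStrict.

(** * Strong maximum principle and boundary point lemma *)

Section StrongMaximum.
Context {R : realType} {q : R} {G G1 G2 : R * R -> R} (ell : elliptic q G G1 G2).
Notation sol := (@solution R q G).
Implicit Types (w : sol) (p z c : R * R).

(** This and the next lemma are triangle inequalities for squared distances: the difference of the
    two sides is a sum of squares. *)
Lemma nsq_lower p z : nsq p <= 2 * nsq z + 2 * dsq p z.
Proof.
rewrite -subr_ge0 /nsq /dsq.
have -> : 2 * (z.1 ^+ 2 + z.2 ^+ 2) + 2 * ((z.1 - p.1) ^+ 2 + (z.2 - p.2) ^+ 2) -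
   (p.1 ^+ 2 + p.2 ^+ 2) = (2 * z.1 - p.1) ^+ 2 + (2 * z.2 - p.2) ^+ 2 by ring.
by rewrite addr_ge0 ?sqr_ge0.
Qed.

Lemma nsq_upper p z (s : R) : 0 < s -> nsq z <= (1 + s) * nsq p + (1 + s^-1) * dsq p z.
Proof.
move=> s0; rewrite -subr_ge0 /nsq /dsq.
have -> : (1 + s) * (p.1 ^+ 2 + p.2 ^+ 2) + (1 + s^-1) * ((z.1 - p.1) ^+ 2 + (z.2 - p.2) ^+ 2) -
  (z.1 ^+ 2 + z.2 ^+ 2) = s^-1 * ((s * p.1 - (z.1 - p.1)) ^+ 2 + (s * p.2 - (z.2 - p.2)) ^+ 2).
  by field; rewrite gt_eqF.
by rewrite mulr_ge0 ?invr_ge0 ?(ltW s0) // addr_ge0 ?sqr_ge0.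
Qed.

(** Strictness holds on a small circle around [p] by continuity, and [hopf_barrier] extends it to
    the disc of squared radius R2. The bound a / 4 keeps that disc off the origin, (1 - b)^3 / 2
    keeps it inside the unit disc. R2 depends on a and b only, so finitely many such steps cover a
    segment. *)
Lemma strong_max_step w p z (a b R2 : R) : dominates w -> 0 < a -> b < 1 ->
  a <= nsq p <= b -> R2 = Num.min (a / 4) ((1 - b) ^+ 3 / 2) -> dsq p z < R2 ->
  kelvin w p < w p -> kelvin w z < w z.
Proof.
move=> dom a0 b1 /andP[pa pb] R2E pz Dp.
have b1' : 0 < 1 - b by rewrite subr_gt0.
have nb0 : 0 <= b by apply: le_trans pb; exact: nsq_ge0.
have R2a : R2 <= a / 4 by rewrite R2E ge_min lexx.
have R2b : R2 <= (1 - b) ^+ 3 / 2 by rewrite R2E ge_min lexx orbT.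
have ball_in t : dsq p t <= R2 -> 0 < nsq t <= 1.
  move=> pt; have h1 := nsq_lower p t; have h2 := nsq_upper p t (1 - b) b1'.
  apply/andP; split; first by clear -ell h1 pt R2a pa a0; lra.
  apply: le_trans h2 _.
  have k1 : (1 + (1 - b)) * nsq p <= (1 + (1 - b)) * b.
    by rewrite ler_wpM2l //; clear -ell b1; lra.
  have k2 : (1 + (1 - b)^-1) * dsq p t <= (1 + (1 - b)^-1) * ((1 - b) ^+ 3 / 2).
    rewrite ler_wpM2l ?(le_trans pt) // addr_ge0 // invr_ge0 ltW //.
  have k3 : (1 + (1 - b)^-1) * ((1 - b) ^+ 3 / 2) = ((1 - b) ^+ 3 + (1 - b) ^+ 2) / 2.
    by field; rewrite gt_eqF.
  have k4 : (1 - b) ^+ 3 <= (1 - b) ^+ 2.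
    rewrite -subr_ge0; have -> : (1 - b) ^+ 2 - (1 - b) ^+ 3 = b * (1 - b) ^+ 2 by ring.
    by rewrite mulr_ge0 ?sqr_ge0.
  have k5 : (1 + (1 - b)) * b = 1 - (1 - b) ^+ 2 by ring.
  by clear -ell k1 k2 k3 k4 k5; lra.
have p0 : 0 < nsq p := lt_le_trans a0 pa.
have [<- //|zp] := eqVneq p z.
have pz0 : 0 < dsq p z.
  rewrite lt_neqAle dsq_ge0 andbT eq_sym; apply: contra zp.
  rewrite /dsq paddr_eq0 ?sqr_ge0 // !sqrf_eq0 !subr_eq0 => /andP[/eqP e1 /eqP e2].
  by rewrite [p]surjective_pairing [z]surjective_pairing e1 e2.
have R2_1 : R2 <= 1.
  have : (1 - b) ^+ 3 <= 1 by rewrite exprn_ile1 ?(ltW b1') // gerBl.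
  by clear -ell R2b; lra.
have cD : {for p, continuous (fun t => w t - kelvin w t)}.
  by apply: contB; [exact: sw_cont | apply: cont_kelvin; rewrite gt_eqF].
have Dp' : 0 < w p - kelvin w p by rewrite subr_gt0.
have nb : \forall t \near p, 0 < w t - kelvin w t.
  by move/cvgr_gt : cD => /(_ _ Dp').
have /nbhs_ballP[r /= r0 Hr] := nb.
pose R1 := Num.min ((r / 2) ^+ 2) (dsq p z / 2).
have R10 : 0 < R1 by rewrite lt_min exprn_gt0 ?divr_gt0.
have R1z : R1 < dsq p z.
  apply: (@le_lt_trans _ _ (dsq p z / 2)); first by rewrite ge_min lexx orbT.
  by rewrite ltr_pdivrMr // ltr_pMr // ltr1n.
have circ t : dsq p t = R1 -> kelvin w t < w t.
  move=> e; rewrite -subr_gt0; apply: Hr.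
  have R1r : R1 <= (r / 2) ^+ 2 by rewrite ge_min lexx.
  have r2 : 0 <= r / 2 by rewrite divr_ge0 // ltW.
  have r2r : r / 2 < r by rewrite ltr_pdivrMr // ltr_pMr // ltr1n.
  split; rewrite /= /ball /= distrC; apply: le_lt_trans r2r; apply: sqr_le_norm => //;
    apply: le_trans R1r; rewrite -e /dsq.
    by rewrite lerDl sqr_ge0.
  by rewrite lerDr sqr_ge0.
have [eps [al [eps0 al0 H]]] := hopf_barrier ell w p R1 R2 dom R10 (lt_trans R1z pz) R2_1 ball_in circ.
rewrite -subr_gt0; apply: lt_le_trans (H z _); last by rewrite (ltW R1z) (ltW pz).
by rewrite mulr_gt0 // subr_gt0 ltr_expR ltr_nM2l // oppr_lt0.
Qed.

(** The nonnegative inner product keeps the segment away from the puncture: nsq is at least ((1 -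
    t)^2 + t^2) 2 a >= a along it. Strictness then propagates in N equal steps. *)
Lemma strong_max_segment w p z : dominates w -> 0 < nsq p < 1 -> 0 < nsq z < 1 ->
  0 <= p.1 * z.1 + p.2 * z.2 -> kelvin w p < w p -> kelvin w z < w z.
Proof.
move=> dom /andP[p0 p1] /andP[z0 z1] pz Dp.
pose a := Num.min (nsq p) (nsq z) / 2; pose b := Num.max (nsq p) (nsq z).
have a0 : 0 < a by rewrite divr_gt0 // lt_min p0 z0.
have b1 : b < 1 by rewrite gt_max p1 z1.
have ap : 2 * a <= nsq p by rewrite /a mulrC divfK // ge_min lexx.
have az : 2 * a <= nsq z by rewrite /a mulrC divfK // ge_min lexx orbT.
have bp : nsq p <= b by rewrite le_max lexx.
have bz : nsq z <= b by rewrite le_max lexx orbT.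
pose R2 := Num.min (a / 4) ((1 - b) ^+ 3 / 2).
have R20 : 0 < R2.
  rewrite lt_min; apply/andP; split; apply: divr_gt0 => //.
  by apply: exprn_gt0; rewrite subr_gt0.
pose l (t : R) : R * R := (p.1 + t * (z.1 - p.1), p.2 + t * (z.2 - p.2)).
have nl t : nsq (l t) = (1 - t) ^+ 2 * nsq p + t ^+ 2 * nsq z +
    2 * ((1 - t) * t) * (p.1 * z.1 + p.2 * z.2) by rewrite /nsq /l /=; ring.
have nl' t : nsq (l t) = (1 - t) * nsq p + t * nsq z - (1 - t) * t * dsq p z.
  by rewrite /nsq /l /dsq /=; ring.
have range (t : R) : 0 <= t <= 1 -> a <= nsq (l t) <= b.
  move=> /andP[t0 t1]; have t1' : 0 <= 1 - t by rewrite subr_ge0.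
  apply/andP; split.
    rewrite nl; have h1 : 0 <= 2 * ((1 - t) * t) * (p.1 * z.1 + p.2 * z.2).
      by rewrite mulr_ge0 // mulr_ge0 // mulr_ge0.
    have h2 := ler_wpM2l (sqr_ge0 (1 - t)) ap; have h3 := ler_wpM2l (sqr_ge0 t) az.
    have h4 : 0 <= (2 * t - 1) ^+ 2 * a by rewrite mulr_ge0 ?sqr_ge0 // ltW.
    apply: le_trans (lerD (lerD h2 h3) h1).
    rewrite addr0 -subr_ge0; move: h4; congr (0 <= _); ring.
  rewrite nl'; have h1 := ler_wpM2l t1' bp; have h2 := ler_wpM2l t0 bz.
  have h3 : 0 <= (1 - t) * t * dsq p z by rewrite !mulr_ge0 ?dsq_ge0.
  have -> : b = (1 - t) * b + t * b by ring.
  by rewrite lerBlDr (le_trans (lerD h1 h2)) // lerDl.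
have [n hn] := inv_nat_lt (R2 / (dsq p z + 1)) (divr_gt0 R20 (ltr_wpDl (dsq_ge0 p z) ltr01)).
set N := n.+1 in hn.
have N0 : 0 < N%:R :> R by rewrite ltr0n.
have step i : (i <= N)%N -> kelvin w (l (i%:R / N%:R)) < w (l (i%:R / N%:R)).
  elim: i => [|i ih] iN; first by rewrite mul0r /l !mul0r !addr0 -surjective_pairing.
  have ti : 0 <= (i%:R / N%:R : R) <= 1.
    by rewrite divr_ge0 //= ler_pdivrMr // mul1r ler_nat ltnW.
  apply: (strong_max_step w (l (i%:R / N%:R)) _ a b R2 dom a0 b1 (range _ ti) erefl) (ih (ltnW iN)).
  have -> : dsq (l (i%:R / N%:R)) (l (i.+1%:R / N%:R)) = N%:R^-1 * (N%:R^-1 * dsq p z).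
    rewrite /dsq /l /= -natr1; field; rewrite gt_eqF //.
  have N1 : N%:R^-1 <= 1 :> R by rewrite invf_le1 // ler1n.
  have d1 : 0 < dsq p z + 1 by rewrite ltr_wpDl ?dsq_ge0.
  apply: (@le_lt_trans _ _ (N%:R^-1 * dsq p z)).
    by rewrite ler_piMl // mulr_ge0 ?dsq_ge0 // invr_ge0.
  rewrite ltr_pdivlMr // in hn; apply: le_lt_trans hn.
  by rewrite ler_wpM2l ?invr_ge0 // lerDl.
have := step N (leqnn N); rewrite divff ?gt_eqF //.
by rewrite /l !mul1r [p.1 + _]addrC subrK [p.2 + _]addrC subrK -surjective_pairing.
Qed.

(** When the angle between [p] and [z] is obtuse, the detour goes through [p] turned by a quarter,
    in the direction that makes an angle of at most a right angle with [z]. *)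
Lemma strong_max w p : dominates w -> 0 < nsq p < 1 -> kelvin w p < w p ->
  forall z, 0 < nsq z < 1 -> kelvin w z < w z.
Proof.
move=> dom hp Dp z hz.
have [h|h] := lerP 0 (p.1 * z.1 + p.2 * z.2); first exact: (strong_max_segment w p).
pose m (s : R) : R * R := (- s * p.2, s * p.1).
have key s : s ^+ 2 = 1 -> 0 <= (m s).1 * z.1 + (m s).2 * z.2 -> kelvin w z < w z.
  move=> s2 hs.
  have hm : nsq (m s) = nsq p.
    by rewrite /nsq /m /= !exprMn sqrrN s2 !mul1r addrC.
  apply: (strong_max_segment w (m s)) => //; first by rewrite hm.
  apply: (strong_max_segment w p) => //; first by rewrite hm.
  by rewrite /m /= le_eqVlt; apply/orP; left; apply/eqP; ring.
have [h1|h1] := lerP 0 ((m 1).1 * z.1 + (m 1).2 * z.2).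
  by apply: key h1; rewrite expr1n.
apply: (key (-1)); first by rewrite sqrrN expr1n.
by move: h1; rewrite /m /=; clear -ell; lra.
Qed.

(** The radial derivative of w - kelvin w at [y] is 2 (y.Dw - w). The barrier lives on the disc of
    centre 3 y / 4 and radius 1 / 4, internally tangent to the unit circle at [y], and bounds w -
    kelvin w from below linearly in the distance to [y] along the radius. *)
Lemma hopf w : dominates w -> (forall z, 0 < nsq z < 1 -> kelvin w z < w z) ->
  forall y, nsq y = 1 -> y.1 * sw1 w y + y.2 * sw2 w y < w y.
Proof.
move=> dom strict y y1.
pose l (t : R) : R * R := (0 + t * y.1, 0 + t * y.2).
pose c := l (3 / 4).
have nl t : nsq (l t) = t ^+ 2 by rewrite -[RHS]mulr1 -y1 /nsq /l /=; ring.
have dl t : dsq c (l t) = (t - 3 / 4) ^+ 2.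
  have -> : dsq c (l t) = (t - 3 / 4) ^+ 2 * nsq y by rewrite /dsq /nsq /c /l /=; field.
  by rewrite y1 mulr1.
have nc : nsq c = 9 / 16 by rewrite nl; field.
have up z : nsq z <= 4 / 3 * nsq c + 4 * dsq c z.
  have := nsq_upper c z (1 / 3); rewrite divr_gt0 // => /(_ erefl).
  by rewrite invf_div divr1; clear -ell; lra.
have ball_in z : dsq c z <= 1 / 16 -> 0 < nsq z <= 1.
  move=> hz; have h1 := nsq_lower c z; have h2 := up z; rewrite nc in h1 h2.
  by apply/andP; split; clear -ell h1 h2 hz; lra.
have circ z : dsq c z = 1 / 64 -> kelvin w z < w z.
  move=> hz; apply: strict; have h1 := nsq_lower c z; have h2 := up z; rewrite nc hz in h1 h2.
  by apply/andP; split; clear -ell h1 h2; lra.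
have [eps [al [eps0 al0 H]]] := hopf_barrier ell w c (1 / 64) (1 / 16) dom
  ltac:(lra) ltac:(lra) ltac:(lra) ball_in circ.
(* At distance h <= 1 / 8 from [y] the exponent gains al (h / 2 - h^2) >= al h / 4; with exp x >= 1
   + x the barrier is at least k h. *)
pose k := eps * expR (- al * (1 / 16)) * al / 4.
have k0 : 0 < k by rewrite divr_gt0 // !mulr_gt0 // expR_gt0.
pose F t := w (l t) - kelvin w (l t).
have low (h : R) : 0 <= h <= 1 / 8 -> k * h <= F (1 - h).
  move=> /andP[h0 h8]; have hh : dsq c (l (1 - h)) = 1 / 16 - h / 2 + h ^+ 2 by rewrite dl; field.
  have h2 : h ^+ 2 <= h / 8 by have i1 := ler_wpM2l h0 h8; rewrite expr2; clear -ell i1; lra.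
  have := H (l (1 - h)); rewrite hh => HH; apply: le_trans (HH _); last first.
    have h3 := sqr_ge0 h.
    have h4 : 0 <= (1 / 8 - h) * (3 / 8 - h) by rewrite mulr_ge0 // subr_ge0 //; clear -ell h8; lra.
    apply/andP; split; last by clear -ell h2 h0; lra.
    by rewrite -subr_ge0; move: h4; congr (0 <= _); field.
  have -> : expR (- al * (1 / 16 - h / 2 + h ^+ 2)) =
      expR (- al * (1 / 16)) * expR (al * (h / 2 - h ^+ 2)) by rewrite -expRD; congr expR; ring.
  have e1 := expR_ge1Dx (al * (h / 2 - h ^+ 2)).
  have -> : k * h = eps * (expR (- al * (1 / 16)) * (al * (h / 4))) by rewrite /k; field.
  rewrite ler_pM2l // -[X in _ <= _ - X]mulr1 -mulrBr ler_pM2l ?expR_gt0 //.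
  have e2 : al * (h / 4) <= al * (h / 2 - h ^+ 2).
    by rewrite ler_pM2l //; clear -ell h2 h0; lra.
  by clear -ell e1 e2; lra.
have l1 : l 1 = y by rewrite /l !mul1r !add0r -surjective_pairing.
have n1 : nsq y != 0 by rewrite y1 oner_neq0.
have invy : inversion y = y.
  by rewrite /inversion /inv1 /inv2 y1 !divr1 -surjective_pairing.
pose d := 2 * (y.1 * sw1 w y + y.2 * sw2 w y - w y).
have dF : is_derive (1 : R) (1 : R) F d.
  have gw := sw_grad w y; have gk := kelvin_grad w y n1; rewrite -l1 in gw gk.
  have := derD _ _ _ _ _ (grad_at_line_at w (0, 0) _ _ y 1 gw)
    (derZ (-1) _ _ _ (grad_at_line_at (kelvin w) (0, 0) _ _ y 1 gk)).
  rewrite -/(l _).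
  have -> : (fun t => w (0 + t * y.1, 0 + t * y.2) + -1 * kelvin w (0 + t * y.1, 0 + t * y.2)) = F.
    by apply/funext => t; rewrite /F mulN1r.
  move=> /is_derive_eq; apply.
  rewrite l1 /kelvin1 /kelvin2 /kS invy /d /=.
  have e : y.2 ^+ 2 = 1 - y.1 ^+ 2 by rewrite -y1 /nsq; ring.
  have -> : sw1 w y * y.1 + sw2 w y * y.2 + -1 *
     ((2 * y.1 * (w y - (y.1 * sw1 w y + y.2 * sw2 w y)) + sw1 w y) * y.1 +
      (2 * y.2 * (w y - (y.1 * sw1 w y + y.2 * sw2 w y)) + sw2 w y) * y.2) =
     - 2 * (y.1 ^+ 2 + y.2 ^+ 2) * (w y - (y.1 * sw1 w y + y.2 * sw2 w y)) by ring.
  by rewrite e; ring.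
rewrite ltNge; apply/negP => wy.
have d0 : 0 <= d by rewrite mulr_ge0 // subr_ge0.
have F1 : F 1 = 0.
  by rewrite /F l1 /kelvin invy y1 mul1r subrr.
move/is_derive1_caratheodory : dF => [g [Eg cg g1]].
have gk : - k < g 1 by rewrite g1; apply: lt_le_trans d0; rewrite oppr_lt0.
have nb : \forall t \near (1 : R), - k < g t by move/cvgr_gt : cg => /(_ _ gk).
have /nbhs_ballP[r /= r0 Hr] := nb.
pose h := Num.min (1 / 8) (r / 2).
have h0 : 0 < h by rewrite lt_min !divr_gt0.
have h8 : h <= 1 / 8 by rewrite ge_min lexx.
have hr : h < r.
  apply: (@le_lt_trans _ _ (r / 2)); first by rewrite ge_min lexx orbT.
  by rewrite ltr_pdivrMr // ltr_pMr // ltr1n.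
have h08 : 0 <= h <= 1 / 8 by rewrite ltW.
have := low h h08; have := Eg (1 - h); rewrite F1 subr0 => ->.
have : - k < g (1 - h).
  by apply: Hr; rewrite /ball /= opprB addrC subrK gtr0_norm.
have -> : g (1 - h) * (1 - h - 1) = - g (1 - h) * h by ring.
rewrite ler_pM2r // => i1 i2; have := le_lt_trans i2 _; move=> /(_ k).
by rewrite ltrNl i1 ltxx => /(_ isT).
Qed.

End StrongMaximum.

(** * Moving spheres *)

Section MovingSpheres.
Context {R : realType} {q : R} {G G1 G2 : R * R -> R} (ell : elliptic q G G1 G2).
Notation sol := (@solution R q G).
Implicit Types (w : sol) (p z y : R * R).

Definition dil (t : R) z : R * R := (t * z.1, t * z.2).

Lemma nsq_dil t z : nsq (dil t z) = t ^+ 2 * nsq z.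
Proof. by rewrite /nsq /dil /=; ring. Qed.

Lemma dilA s t z : dil s (dil t z) = dil (s * t) z.
Proof. by rewrite /dil /= !mulrA. Qed.

Lemma dil1 z : dil 1 z = z.
Proof. by rewrite /dil !mul1r -surjective_pairing. Qed.

Lemma inversionE z : inversion z = dil (nsq z)^-1 z.
Proof. by rewrite /inversion /inv1 /inv2 /dil ![_^-1 * _]mulrC. Qed.

Definition centre w (l : R) (l0 : 0 < l) : sol := rescale w (0, 0) l l0.

Lemma centreE w l (l0 : 0 < l) z : centre w l l0 z = l^-1 * w (dil l z).
Proof. by rewrite /centre /= !add0r. Qed.

(* Comparison with the Kelvin transform about the sphere of radius [l]: with
   [z^l = l^2 z / |z|^2], it says [w z <= |z|^2 / l^2 * w z^l]. *)
Definition sphere w (l : R) : Prop := forall z, l ^+ 2 <= nsq z ->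
  l ^+ 2 / nsq z * w z <= w (dil (l ^+ 2 / nsq z) z).

(** Up to the factor t^-2, the derivative of t^-1 w (t z). Comparison with the sphere of radius l at
    z says that this quotient is no smaller at t = l^2 / nsq z than at t = 1. *)
Definition euler w z : R := z.1 * sw1 w z + z.2 * sw2 w z - w z.

Lemma cont_euler w z : {for z, continuous (euler w)}.
Proof.
apply: contB; last exact: sw_cont.
by apply: contD; apply: contM; [exact: cont_fst | exact: sw1_cont | exact: cont_snd | exact: sw2_cont].
Qed.

Lemma cont_dil t z : {for z, continuous (dil t)}.
Proof.
by apply: for_continuous_pair; apply: contM; [exact: cont_cst | exact: cont_fst | exact: cont_cst | exact: cont_snd].
Qed.

Lemma der_ray w z t : t != 0 ->
  is_derive t (1 : R) (fun t => t^-1 * w (dil t z)) (euler w (dil t z) / t ^+ 2).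
Proof.
move=> t0.
have lin (c : R) : is_derive t (1 : R) (fun t => t * c) c.
  have := derM _ _ _ _ _ (is_derive_id t (1 : R)) (is_derive_cst c t (1 : R)).
  by move=> /is_derive_eq; apply; rewrite mulr0 add0r mulr1.
have hw := sw_grad w (dil t z) (fun t => t * z.1) (fun t => t * z.2) t _ _ erefl erefl (lin _) (lin _).
have hV := derV id t 1 t0 (is_derive_id t (1 : R)).
have := derM _ _ _ _ _ hV hw.
move=> /is_derive_eq; apply; rewrite /euler /dil /=; field; exact: t0.
Qed.

Lemma ray_monotone w z (t : R) : 0 < t <= 1 ->
  (forall s, t <= s <= 1 -> euler w (dil s z) <= 0) -> t * w z <= w (dil t z).
Proof.
move=> /andP[t0 t1] h.
have [s hs] := MVT_seg (fun t => t^-1 * w (dil t z)) (fun t => euler w (dil t z) / t ^+ 2) t 1 t1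
  (fun s hs => der_ray w z s (lt0r_neq0 (lt_le_trans t0 (proj1 (andP hs))))).
rewrite invr1 mul1r dil1 => E.
have : w z - t^-1 * w (dil t z) <= 0.
  rewrite E mulr_le0_ge0 ?subr_ge0 // mulr_le0_ge0 ?h // invr_ge0 sqr_ge0 //.
by rewrite subr_le0 mulrC ler_pdivlMr // mulrC.
Qed.

Lemma sphere1P w : sphere w 1 <-> dominates w.
Proof.
split=> h.
- move=> y /andP[y0 y1]; have yn : nsq y != 0 by rewrite gt_eqF.
  have := h (inversion y); rewrite expr1n div1r (nsq_inversion _ yn) invrK.
  rewrite {2}inversionE dilA divff // dil1; apply.
  by rewrite invf_ge1.
- move=> z; rewrite expr1n => z1; have z0 : 0 < nsq z := lt_le_trans ltr01 z1.
  have zn : nsq z != 0 by rewrite gt_eqF.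
  have := h (inversion z); rewrite /kelvin (nsq_inversion _ zn) (inversionK _ zn).
  rewrite div1r -inversionE; apply.
  by rewrite invr_gt0 z0 /= invf_le1.
Qed.

Lemma sphere_centre w l (l0 : 0 < l) m : sphere (centre w l l0) m <-> sphere w (l * m).
Proof.
have ln : l != 0 by rewrite gt_eqF.
split=> h z hz.
- have := h (dil l^-1 z); rewrite nsq_dil.
  have zn : nsq z != 0 -> m ^+ 2 / (l^-1 ^+ 2 * nsq z) = (l * m) ^+ 2 / nsq z.
    by move=> zn; field; apply/andP.
  (* At the origin the quotient by 0 is 0 by convention, and the inequality reduces to positivity of
     w. *)
  have [e|zn'] := eqVneq (nsq z) 0.
    by rewrite e !invr0 !mulr0 mul0r => _; rewrite ltW // sw_pos.
  have e : l * ((l * m) ^+ 2 / nsq z) / l = (l * m) ^+ 2 / nsq z by field; apply/andP.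
  rewrite zn // !centreE !dilA (divff ln) dil1 e.
  rewrite mulrCA ler_pM2l ?invr_gt0 //; apply.
  by rewrite exprVn mulrC ler_pdivlMr ?exprn_gt0 // mulrC -exprMn.
- have := h (dil l z); rewrite nsq_dil.
  have [e|zn] := eqVneq (nsq z) 0.
    by rewrite e !invr0 !mulr0 mul0r => _; rewrite ltW // sw_pos.
  have -> : (l * m) ^+ 2 / (l ^+ 2 * nsq z) = m ^+ 2 / nsq z by field; apply/andP.
  rewrite !centreE !dilA [_ / nsq z * l]mulrC => hh.
  rewrite mulrCA ler_pM2l ?invr_gt0 //; apply: hh.
  by rewrite exprMn ler_pM2l ?exprn_gt0.
Qed.

(** Outside the unit disc this is [kelvin_bounded] read through the inversion; the band r <= nsq <=
    1 only costs C2 / r. *)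
Lemma growth_bound w (r : R) : 0 < r -> exists2 C : R, 0 < C &
  forall z, r <= nsq z -> w z <= C * nsq z.
Proof.
move=> r0; have [C1 C10 h1] := kelvin_bounded ell w.
have [C2 [w0 [C20 _ h2]]] := disc_bounds w.
exists (C1 + C2 / r); first by rewrite addr_gt0 ?divr_gt0.
move=> z rz; have z0 : 0 < nsq z := lt_le_trans r0 rz.
have zn : nsq z != 0 by rewrite gt_eqF.
have [z1|z1] := lerP (nsq z) 1.
  have [/andP[_ hz] _ _ _] := h2 z z1.
  apply: le_trans hz _; rewrite mulrDl; apply: (@le_trans _ _ (C2 / r * nsq z)).
    by rewrite mulrAC ler_pdivlMr // ler_pM2l.
  by rewrite lerDr mulr_ge0 // ltW.
have := h1 (inversion z); rewrite /kelvin (nsq_inversion _ zn) (inversionK _ zn).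
rewrite invr_gt0 z0 invf_le1 // (ltW z1) => /(_ isT).
rewrite mulrC ler_pdivrMr // => hz; apply: le_trans hz _.
by rewrite ler_pM2r // lerDl divr_ge0 // ltW.
Qed.

(** Near the origin [euler] is negative, being - w at 0, so rays settle the matter there. Farther
    away w z <= C nsq z, and the left side is at most l^2 C, below the minimum w0 of w on the unit
    disc, which contains the reflected point. *)
Lemma sphere_start w : exists2 l0 : R, 0 < l0 & forall l, 0 < l <= l0 -> sphere w l.
Proof.
have e0 : euler w (0, 0) < 0.
  by rewrite /euler /= !mul0r !add0r oppr_lt0 sw_pos.
have nb : \forall z \near ((0, 0) : R * R), euler w z < 0.
  by have := cont_euler w (0, 0); move/cvgr_lt => /(_ _ e0).
have /nbhs_ballP[r /= r0 Hr] := nb.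
have hr z : nsq z <= (r / 2) ^+ 2 -> euler w z <= 0.
  move=> hz; apply: ltW; apply: Hr.
  have r2 : 0 <= r / 2 by rewrite divr_ge0 // ltW.
  have r2r : r / 2 < r by rewrite ltr_pdivrMr // ltr_pMr // ltr1n.
  split; rewrite /= /ball /= sub0r normrN; apply: le_lt_trans r2r; apply: sqr_le_norm => //;
    apply: le_trans hz; rewrite /nsq.
    by rewrite lerDl sqr_ge0.
  by rewrite lerDr sqr_ge0.
have rr0 : 0 < (r / 2) ^+ 2 by rewrite exprn_gt0 // divr_gt0.
have [C C0 hC] := growth_bound w _ rr0.
have [C2 [w0 [_ w00 h2]]] := disc_bounds w.
pose l0 := Num.min 1 (w0 / C).
have l00 : 0 < l0 by rewrite lt_min ltr01 divr_gt0.
exists l0 => // l /andP[lpos ll0] z lz.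
have l1 : l <= 1 by apply: le_trans ll0 _; rewrite ge_min lexx.
have lC : l ^+ 2 * C <= w0.
  have h : l <= w0 / C by apply: le_trans ll0 _; rewrite ge_min lexx orbT.
  rewrite ler_pdivlMr // in h; apply: le_trans h; rewrite ler_pM2r //.
  by rewrite expr2 ler_piMl // ltW.
have lp : 0 < l ^+ 2 by rewrite exprn_gt0.
have z0 : 0 < nsq z := lt_le_trans lp lz.
have t01 : 0 < l ^+ 2 / nsq z <= 1 by rewrite divr_gt0 //= ler_pdivrMr // mul1r.
have [zr|zr] := lerP (nsq z) ((r / 2) ^+ 2).
  apply: ray_monotone => // s /andP[s0 s1]; apply: hr; rewrite nsq_dil.
  apply: le_trans zr; rewrite ler_piMl ?nsq_ge0 // expr_le1 //.
  by apply: le_trans s0; case/andP: t01 => /ltW.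
have := hC z (ltW zr) => wz.
have nz : nsq (dil (l ^+ 2 / nsq z) z) <= 1.
  rewrite nsq_dil; have -> : (l ^+ 2 / nsq z) ^+ 2 * nsq z = l ^+ 2 / nsq z * l ^+ 2.
    by field; rewrite gt_eqF.
  case/andP: t01 => t0 t1; rewrite mulr_ile1 //; [exact: ltW | exact: sqr_ge0 | by rewrite expr_le1 // ltW].
have [/andP[hw _] _ _ _] := h2 _ nz.
apply: le_trans hw; apply: le_trans lC.
have -> : l ^+ 2 * C = l ^+ 2 / nsq z * (C * nsq z) by field; rewrite gt_eqF.
by rewrite ler_pM2l //; case/andP: t01.
Qed.

Lemma strict_gap w (b : R) : dominates w -> (forall z, 0 < nsq z < 1 -> kelvin w z < w z) ->
  0 < b < 1 -> exists2 c : R, 0 < c & forall z, 0 < nsq z <= b -> c <= w z - kelvin w z.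
Proof.
move=> dom strict /andP[b0 b1].
have [c1 [r [c10 r0 h1]]] := puncture_strict ell w dom strict.
have [br|rb] := lerP b r.
  by exists c1 => // z /andP[z0 zb]; apply: h1; rewrite z0 (le_trans zb).
have ne : [set p : R * R | r <= dsq (0, 0) p <= b] !=set0.
  exists (Num.sqrt b, 0); rewrite /= dsq0 /nsq /= expr0n addr0 sqr_sqrtr ?(ltW b0) //.
  by rewrite lexx ltW.
have cD p : r <= dsq (0, 0) p <= b -> {for p, continuous (fun z => w z - kelvin w z)}.
  rewrite dsq0 => /andP[rp _]; apply: contB; first exact: sw_cont.
  by apply: cont_kelvin; rewrite gt_eqF // (lt_le_trans r0).
have [m + hm] := min_on_compact _ _ ne (compact_annulus (0, 0) r b) cD.
rewrite /= dsq0 => /andP[m1 m2].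
have m0 : 0 < w m - kelvin w m.
  by rewrite subr_gt0 strict // (lt_le_trans r0 m1) (le_lt_trans m2).
exists (Num.min c1 (w m - kelvin w m)); first by rewrite lt_min c10 m0.
move=> z /andP[z0 zb]; have [zr|zr] := lerP (nsq z) r.
  by apply: (@le_trans _ _ c1); [rewrite ge_min lexx | apply: h1; rewrite z0].
apply: (@le_trans _ _ (w m - kelvin w m)); first by rewrite ge_min lexx orbT.
by apply: hm; rewrite /= dsq0 (ltW zr).
Qed.

(** Compactness on nsq <= 4, with annuli of half-width 1 / (n + 1): near a point of the circle
    [euler] stays negative, near any other point the premise of [P n] fails for large n. *)
Lemma hopf_neighbourhood w : (forall y, nsq y = 1 -> euler w y < 0) ->
  exists2 d : R, 0 < d < 1 & forall z, 1 - d <= nsq z <= 1 + d -> euler w z <= 0.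
Proof.
move=> h.
pose P (n : nat) z := 1 - n.+1%:R^-1 <= nsq z <= 1 + n.+1%:R^-1 -> euler w z <= 0.
have [n hn] : exists n, forall z, [set p | 0 <= dsq (0, 0) p <= 4] z -> P n z.
  apply: compact_uniform; first exact: compact_annulus.
  - move=> n m z nm Pn /andP[h1 h2]; apply: Pn.
    have : m.+1%:R^-1 <= n.+1%:R^-1 :> R by rewrite lef_pV2 ?posrE ?ltr0n // ler_nat.
    move: h1 h2; move: (m.+1%:R^-1) (n.+1%:R^-1) => x y h1 h2 h3.
    by apply/andP; split; clear -ell h1 h2 h3; lra.
  - move=> z _; have [e|e] := eqVneq (nsq z) 1.
      exists 0%N; have := cont_euler w z; move/cvgr_lt => /(_ _ (h z e)).
      by apply: filterS => t /ltW ? _.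
    have d0 : 0 < `|nsq z - 1| / 2 by rewrite divr_gt0 // normr_gt0 subr_eq0.
    have [n hn] := inv_nat_lt _ d0; exists n.
    have := cont_nsq z; move/cvgrPdist_lt => /(_ _ d0); apply: filterS => t ht /andP[h1 h2].
    have h3 : `|nsq t - 1| <= n.+1%:R^-1.
      move: h1 h2; move: (n.+1%:R^-1) => x h1 h2.
      by rewrite ler_norml; apply/andP; split; clear -ell h1 h2; lra.
    have h4 : `|nsq z - 1| <= `|nsq z - nsq t| + `|nsq t - 1|.
      by have -> : nsq z - 1 = (nsq z - nsq t) + (nsq t - 1); [ring | exact: ler_normD].
    move: hn h3; move: (n.+1%:R^-1) => x hn h3.
    by clear -ell hn ht h3 h4; exfalso; lra.
pose d : R := Num.min (2^-1) n.+1%:R^-1.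
exists d.
  rewrite lt_min !invr_gt0 !ltr0n /=.
  by apply: (@le_lt_trans _ _ 2^-1); [rewrite ge_min lexx | rewrite invf_lt1 ?ltr1n].
have d2 : d <= 2^-1 by rewrite ge_min lexx.
have dn : d <= n.+1%:R^-1 by rewrite ge_min lexx orbT.
move=> z /andP[h1 h2]; apply: hn.
  rewrite /= dsq0 nsq_ge0 /=; move: d2 h2; move: (d) => e d2 h2.
  by clear -ell h2 d2; lra.
move: dn h1 h2; move: (d) (n.+1%:R^-1) => e x dn h1 h2.
by apply/andP; split; clear -ell h1 h2 dn; lra.
Qed.

(** For nsq z <= 1 + t the ray from z to its reflection stays where [euler] is nonpositive. Beyond,
    the reflection of z lies in a smaller disc where the gap is at least c, and passing from radius
    1 to l costs at most B (l^2 - 1). *)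
Lemma sphere_open w : dominates w -> (forall z, 0 < nsq z < 1 -> kelvin w z < w z) ->
  exists2 d : R, 0 < d & forall l, 1 <= l <= 1 + d -> sphere w l.
Proof.
move=> dom strict.
have hp y : nsq y = 1 -> euler w y < 0.
  by move=> e; rewrite /euler subr_lt0; exact: (hopf ell).
have [t /andP[t0 t1] ht] := hopf_neighbourhood w hp.
pose b := (1 + t)^-1.
have t10 : 0 < 1 + t by rewrite addr_gt0.
have b01 : 0 < b < 1 by rewrite /b invr_gt0 t10 /= invf_lt1 // ltrDl.
have [c c0 hc] := strict_gap w b dom strict b01.
(* Since l^2 <= 2, the points s y with s <= l^2 lie in the unit disc dilated by 2. *)
have [B B0 hB] := disc_norm_bound (fun z => euler w (dil 2 z)) (fun p =>
   @continuous_comp _ _ _ (dil 2) (euler w) p (cont_dil 2 p) (cont_euler w _)).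
(* The division by 3 accounts for l^2 <= 1 + 3 d when l <= 1 + d <= 4 / 3. *)
pose d := Num.min 1 (Num.min t (c / B)) / 3.
have d0 : 0 < d by rewrite divr_gt0 // !lt_min ltr01 t0 divr_gt0.
have [d1 dt dB] : [/\ 3 * d <= 1, 3 * d <= t & 3 * d <= c / B].
  by rewrite /d mulrC divfK //; split; rewrite !ge_min lexx ?orbT.
exists d => // l /andP[l1 ld] z lz.
have l2 : l ^+ 2 <= 1 + 3 * d.
  have h : l ^+ 2 <= (1 + d) ^+ 2 by rewrite ler_pXn2r // nnegrE; clear -ell l1 d0; lra.
  have h' : d * d <= d * (3^-1) by rewrite ler_pM2l //; clear -ell d1; lra.
  have h3 : (1 + d) ^+ 2 = 1 + 2 * d + d * d by ring.
  by clear -ell h h' h3 d0; lra.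
have l21 : 1 <= l ^+ 2 by rewrite expr_ge1 // ltW // (lt_le_trans ltr01).
have lp : 0 < l ^+ 2 := lt_le_trans ltr01 l21.
have z0 : 0 < nsq z := lt_le_trans lp lz.
have zn : nsq z != 0 by rewrite gt_eqF.
have s01 : 0 < l ^+ 2 / nsq z <= 1 by rewrite divr_gt0 //= ler_pdivrMr // mul1r.
have [zt|zt] := lerP (nsq z) (1 + t).
  apply: ray_monotone => // s /andP[s1 s2]; apply: ht; rewrite nsq_dil; apply/andP; split.
    have h1 : (l ^+ 2 / nsq z) ^+ 2 * nsq z <= s ^+ 2 * nsq z.
      rewrite ler_pM2r // ler_pXn2r // nnegrE; first by case/andP: s01 => /ltW.
      by apply: le_trans s1; case/andP: s01 => /ltW.
    apply: le_trans h1.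
    have -> : (l ^+ 2 / nsq z) ^+ 2 * nsq z = l ^+ 2 * l ^+ 2 / nsq z by field.
    rewrite ler_pdivlMr //.
    have h2 : (1 - t) * nsq z <= (1 - t) * (1 + t) by rewrite ler_wpM2l // subr_ge0 ltW.
    have h3 : (1 - t) * (1 + t) = 1 - t ^+ 2 by ring.
    have h4 : 1 <= l ^+ 2 * l ^+ 2 by rewrite -[leLHS]mulr1 ler_pM.
    have h5 := sqr_ge0 t.
    by clear -ell h2 h3 h4 h5; lra.
  apply: le_trans zt; rewrite ler_piMl ?nsq_ge0 // expr_le1 //.
  by apply: le_trans s1; case/andP: s01 => /ltW.
pose y := inversion z.
have ny : nsq y = (nsq z)^-1 by exact: nsq_inversion.
have yb : 0 < nsq y <= b by rewrite ny invr_gt0 z0 /= /b lef_pV2 ?posrE // ltW.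
have y1 : nsq y <= 1.
  by case/andP: yb => _ h; apply: le_trans h _; case/andP: b01 => _ /ltW.
have hy := hc y yb; rewrite /kelvin ny (inversionK z zn) in hy.
have -> : dil (l ^+ 2 / nsq z) z = dil (l ^+ 2) y by rewrite /y inversionE dilA.
have [s hs] := MVT_seg (fun t => t^-1 * w (dil t y)) (fun t => euler w (dil t y) / t ^+ 2) 1 (l ^+ 2) l21
  (fun s hs => der_ray w y s (lt0r_neq0 (lt_le_trans ltr01 (proj1 (andP hs))))).
rewrite invr1 mul1r dil1 => E.
case/andP: hs => s1 s2.
have eB : - B <= euler w (dil s y).
  have e : 2 * (s / 2) = s by field.
  have := hB (dil (s / 2) y); rewrite dilA e nsq_dil.
  have -> : (s / 2) ^+ 2 * nsq y <= 1.
    rewrite mulr_ile1 ?sqr_ge0 ?nsq_ge0 // expr_le1 //; last by clear -ell s1; lra.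
    by clear -ell s2 l2 d1; lra.
  by rewrite ler_norml => /(_ isT) /andP[].
have e1 : - B <= euler w (dil s y) / s ^+ 2.
  have s21 : 1 <= s ^+ 2 by rewrite expr_ge1 // (le_trans ler01).
  rewrite ler_pdivlMr ?(lt_le_trans ltr01) //; apply: le_trans eB.
  by rewrite mulNr lerN2 ler_peMr // ltW.
have e2 : - c <= euler w (dil s y) / s ^+ 2 * (l ^+ 2 - 1).
  have h1 : - B * (l ^+ 2 - 1) <= euler w (dil s y) / s ^+ 2 * (l ^+ 2 - 1).
    by rewrite ler_wpM2r // subr_ge0.
  apply: le_trans h1; rewrite mulNr lerN2.
  rewrite ler_pdivlMr // in dB.
  have h2 : (l ^+ 2 - 1) * B <= 3 * d * B by rewrite ler_pM2r //; clear -ell l2; lra.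
  by rewrite mulrC (le_trans h2).
rewrite -E in e2.
have e3 : (nsq z)^-1 * w z <= (l ^+ 2)^-1 * w (dil (l ^+ 2) y) by clear -ell e2 hy; lra.
by rewrite -mulrA -ler_pdivlMl.
Qed.

Lemma cont_dil_at w z (s : R) (k : R -> R) : {for s, continuous k} ->
  {for s, continuous (fun t => w (dil (k t) z))}.
Proof.
move=> ck; apply: (for_continuous_comp2 _ w (fun t => k t * z.1) (fun t => k t * z.2)).
- exact: (contM _ k (fun=> z.1) _ ck (cont_cst _ _ _)).
- exact: (contM _ k (fun=> z.2) _ ck (cont_cst _ _ _)).
- exact: sw_cont.
Qed.

Lemma sphere_closed w (l : R) : 0 < l -> (forall m, 0 < m < l -> sphere w m) -> sphere w l.
Proof.
move=> l0 h z lz; rewrite leNgt; apply/negP => bad.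
pose F (m : R) := m ^+ 2 / nsq z * w z - w (dil (m ^+ 2 / nsq z) z).
have cq : {for l, continuous (fun m : R => m ^+ 2 / nsq z)}.
  by apply: contM; [apply: contX; exact: cvg_id | exact: cont_cst].
have cF : {for l, continuous F}.
  by apply: contB; [apply: contM => //; exact: cont_cst | exact: cont_dil_at].
have F0 : 0 < F l by rewrite subr_gt0.
have nb : \forall m \near l, 0 < F m by move/cvgr_gt : cF => /(_ _ F0).
have /nbhs_ballP[r /= r0 Hr] := nb.
pose m := l - Num.min (l / 2) (r / 2).
have e0 : 0 < Num.min (l / 2) (r / 2) by rewrite lt_min !divr_gt0.
have e1 : Num.min (l / 2) (r / 2) <= l / 2 by rewrite ge_min lexx.
have e2 : Num.min (l / 2) (r / 2) <= r / 2 by rewrite ge_min lexx orbT.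
have m0 : 0 < m by rewrite /m; clear -ell e1 l0; lra.
have ml : m < l by rewrite /m ltrBlDr ltrDl.
have : 0 < F m.
  apply: Hr; rewrite /ball /= /m opprB addrC subrK gtr0_norm //.
  by apply: le_lt_trans e2 _; rewrite ltr_pdivrMr // ltr_pMr // ltr1n.
rewrite subr_gt0 ltNge; have := h m _ z _; move=> ->//; first by rewrite m0.
apply: le_trans lz; rewrite ler_pXn2r ?nnegrE ?ltW //.
Qed.

Lemma kelvin_eq_global w : (forall z, 0 < nsq z < 1 -> kelvin w z = w z) ->
  forall z, nsq z != 0 -> w z = nsq z * w (inversion z).
Proof.
move=> h z zn; have z0 : 0 < nsq z by rewrite lt_neqAle eq_sym zn nsq_ge0.
have [z1|z1|z1] := ltgtP (nsq z) 1.
- by rewrite -h ?z0.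
- have := h (inversion z); rewrite /kelvin (nsq_inversion _ zn) (inversionK _ zn) invr_gt0 z0.
  by rewrite invf_lt1 // z1 => /(_ isT) <-; rewrite mulrA divff // mul1r.
- by rewrite z1 mul1r inversionE z1 invr1 dil1.
Qed.

Lemma sphere_alternative w : (forall l, 0 < l -> sphere w l) \/
  exists2 l : R, 0 < l & forall z, nsq z != 0 ->
    w z = nsq z / l ^+ 2 * w (dil (l ^+ 2 / nsq z) z).
Proof.
have [all|] := pselect (forall l, 0 < l -> sphere w l); first by left.
move=> /existsNP[L] /not_implyP[L0 nL]; right.
have [l0 l00 hl0] := sphere_start w.
(* Requiring all smaller radii as well makes [A] an initial interval, so every radius below its
   supremum is admissible. *)
pose A : set R := [set l | 0 < l /\ forall m, 0 < m <= l -> sphere w m].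
have Al0 : A l0 by [].
have AL : ubound A L.
  move=> l [lp hl]; rewrite leNgt; apply/negP => Ll; apply: nL; apply: hl.
  by rewrite L0 ltW.
have supA : has_sup A by split; [exists l0 | exists L].
pose lb := sup A.
have lb0 : 0 < lb.
  by have := sup_upper_bound supA; move=> /(_ l0 Al0); exact: lt_le_trans.
have below m : 0 < m < lb -> sphere w m.
  move=> /andP[m0 mlb]; have e0 : 0 < lb - m by rewrite subr_gt0.
  have [l [lp hl] lm] := sup_adherent e0 supA.
  by apply: hl; rewrite m0 ltW //; move: lm; rewrite opprB addrC subrK.
have hlb := sphere_closed w lb lb0 below.
pose W := centre w lb lb0.
have domW : dominates W by apply/sphere1P/sphere_centre; rewrite mulr1.
exists lb => //.
have WE : forall z, 0 < nsq z < 1 -> kelvin W z = W z.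
  move=> z zr; apply/eqP; rewrite eq_le.
  have [z0 z1] := andP zr.
  have z01 : 0 < nsq z <= 1 by rewrite z0 ltW.
  rewrite (domW z z01) /= leNgt; apply/negP => Dz.
  have strict := strong_max ell W z domW zr Dz.
  have [d d0 hd] := sphere_open W domW strict.
  (* Radii below lb are already admissible; those up to lb (1 + d) come from [sphere_open] for the
     solution rescaled to radius 1. This exceeds the supremum. *)
  have : A (lb * (1 + d)).
    have d1 : 0 < 1 + d by rewrite addr_gt0.
    split; first by rewrite mulr_gt0.
    move=> m /andP[m0 mb]; have [mlb|mlb] := ltrP m lb; first by apply: below; rewrite m0.
    have := hd (m / lb); rewrite sphere_centre [lb * _]mulrC divfK ?gt_eqF //; apply.
    by rewrite ler_pdivlMr // mul1r mlb /= ler_pdivrMr // mulrC.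
  move=> /(sup_upper_bound supA); rewrite -/lb.
  by rewrite -[leRHS]mulr1 ler_pM2l // gerDl leNgt d0.
move=> z zn; have lbn : lb != 0 by rewrite gt_eqF.
have ne : nsq (dil lb^-1 z) != 0 by rewrite nsq_dil mulf_neq0 // expf_neq0 // invr_neq0.
have := kelvin_eq_global W WE _ ne; rewrite !centreE inversionE !dilA (divff lbn) dil1 nsq_dil.
have -> : lb * (lb^-1 ^+ 2 * nsq z)^-1 / lb = lb ^+ 2 / nsq z by field; apply/andP.
move=> h; apply: (mulfI (invr_neq0 lbn)); rewrite h; field; exact: lbn.
Qed.

End MovingSpheres.

(** * Classification *)

Section Classification.
Context {R : realType} {q : R} {G G1 G2 : R * R -> R} (ell : elliptic q G G1 G2).
Notation sol := (@solution R q G).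
Implicit Types (w : sol) (p z y x d : R * R).

Lemma is_derive_unique (f : R -> R) (s a b : R) :
  is_derive s (1 : R) f a -> is_derive s (1 : R) f b -> a = b.
Proof. by move=> [_ <-] [_ <-]. Qed.

Lemma grad_at_unique (F : R * R -> R) p (a b a' b' : R) :
  grad_at F p a b -> grad_at F p a' b' -> a = a' /\ b = b'.
Proof.
move=> h h'; split.
  exact: is_derive_unique (grad_at_axis1 _ _ _ _ h) (grad_at_axis1 _ _ _ _ h').
exact: is_derive_unique (grad_at_axis2 _ _ _ _ h) (grad_at_axis2 _ _ _ _ h').
Qed.

Lemma derive_le0_left (f : R -> R) (s a r : R) : 0 < r -> is_derive s (1 : R) f a ->
  (forall t, s - r < t < s -> f s <= f t) -> a <= 0.
Proof.
move=> r0 /is_derive1_caratheodory[g [Eg cg <-]] h; rewrite leNgt; apply/negP => g0.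
have nb : \forall t \near s, 0 < g t by move/cvgr_gt : cg => /(_ _ g0).
have /nbhs_ballP[r' /= r'0 Hr] := nb.
pose e := Num.min r r' / 2.
have m0 : 0 < Num.min r r' by rewrite lt_min r0.
have e0 : 0 < e by rewrite divr_gt0.
have : e < Num.min r r' by rewrite ltr_pdivrMr // ltr_pMr // ltr1n.
rewrite lt_min => /andP[er er'].
have h1 : f s <= f (s - e) by apply: h; rewrite ltrD2l ltrN2 er gtrBl.
have h2 : 0 < g (s - e).
  by apply: Hr; rewrite /ball /= opprB addrC subrK gtr0_norm.
have := Eg (s - e); have -> : s - e - s = - e by ring.
have h3 := mulr_gt0 h2 e0; move: h1 h3; move: (f s) (f (s - e)) (g (s - e)) => A B C h1 h3 h4.
by clear -ell h1 h3 h4; lra.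
Qed.

(** Two expansions at infinity are known to agree only for s > 0; a function differentiable at 0 is
    still determined there to first order. *)
Lemma derive_eq0_right (f : R -> R) (a r : R) : 0 < r -> is_derive (0 : R) (1 : R) f a ->
  (forall t, 0 < t < r -> f t = 0) -> f 0 = 0 /\ a = 0.
Proof.
move=> r0 df h.
have pt (e : R) : 0 < e -> 0 < Num.min r e / 2 < r /\ Num.min r e / 2 < e.
  move=> e0; have m0 : 0 < Num.min r e by rewrite lt_min r0.
  have : Num.min r e / 2 < Num.min r e by rewrite ltr_pdivrMr // ltr_pMr // ltr1n.
  by rewrite lt_min divr_gt0 // => /andP[-> ->].
have f0 : f 0 = 0.
  apply/eqP; rewrite -normr_le0 leNgt; apply/negP => e0.
  have := is_derive1_continuous _ _ _ df; move=> /cvgrPdist_lt /(_ _ e0) /nbhs_ballP[e /= e1 He].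
  have [ht te] := pt e e1; have [t0 _] := andP ht.
  have : `|f 0 - f (Num.min r e / 2)| < `|f 0|.
    by apply: He; rewrite /ball /= sub0r normrN gtr0_norm.
  by rewrite (h _ ht) subr0 ltxx.
split => //.
move/is_derive1_caratheodory : df => [g [Eg cg <-]].
apply/eqP; rewrite -normr_le0 leNgt; apply/negP => e0.
move: cg => /cvgrPdist_lt /(_ _ e0) /nbhs_ballP[e /= e1 He].
have [ht te] := pt e e1; have [t0 _] := andP ht.
have : `|g 0 - g (Num.min r e / 2)| < `|g 0|.
  by apply: He; rewrite /ball /= sub0r normrN gtr0_norm.
have := Eg (Num.min r e / 2); rewrite (h _ ht) f0 !subr0 => /esym/eqP.
by rewrite mulf_eq0 [Num.min r e / 2 == 0]gt_eqF // orbF => /eqP ->; rewrite subr0 ltxx.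
Qed.

Definition translate w x : sol := rescale w x 1 ltr01.

Lemma translateE w x z : translate w x z = w (x.1 + z.1, x.2 + z.2).
Proof. by rewrite /translate /= invr1 !mul1r. Qed.

Lemma sphere_all_ray w : (forall l, 0 < l -> sphere w l) ->
  forall z (t : R), 0 < t <= 1 -> t * w z <= w (dil t z).
Proof.
move=> h z t /andP[t0 t1].
have [zn|zn] := eqVneq (nsq z) 0.
  have z0 : z = (0, 0).
    by apply/eqP; apply: contraTT isT => /nsq_neq0; rewrite zn eqxx.
  by rewrite z0 /dil /= !mulr0 ler_piMl // ltW // sw_pos.
have z0 : 0 < nsq z by rewrite lt_neqAle eq_sym zn nsq_ge0.
(* This radius has l^2 / nsq z = t, so free choice of l means free choice of t. *)
have l0 : 0 < Num.sqrt (t * nsq z) by rewrite sqrtr_gt0 mulr_gt0.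
have := h _ l0 z; rewrite sqr_sqrtr ?mulr_ge0 ?(ltW t0) ?(ltW z0) //.
by rewrite mulfK //; apply; rewrite ler_piMl // ltW.
Qed.

Lemma sphere_all_euler w : (forall l, 0 < l -> sphere w l) -> forall z, euler w z <= 0.
Proof.
move=> h z.
have d1 := der_ray w z 1 (oner_neq0 _).
rewrite dil1 expr1n divr1 in d1.
apply: (derive_le0_left _ _ _ 1 ltr01 d1) => t; rewrite subrr => /andP[t0 t1].
rewrite invr1 mul1r dil1 mulrC ler_pdivlMr // mulrC.
by apply: sphere_all_ray => //; rewrite t0 ltW.
Qed.

Lemma not_all_infinite w : ~ (forall x l, 0 < l -> sphere (translate w x) l).
Proof.
move=> h.
have key y (s : R) : s * (sw1 w y ^+ 2 + sw2 w y ^+ 2) <= w y.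
  (* The centre x is placed at y - s Dw(y), so the inequality becomes s |Dw(y)|^2 <= w(y), for every
     s. *)
  pose g : R * R := (s * sw1 w y, s * sw2 w y).
  pose x : R * R := (y.1 - g.1, y.2 - g.2).
  have := sphere_all_euler _ (h x) g.
  rewrite /euler /translate /= invr1 !mul1r [y.1 - _ + _]subrK [y.2 - _ + _]subrK.
  rewrite -surjective_pairing subr_le0; congr (_ <= _); ring.
have gz y : sw1 w y = 0 /\ sw2 w y = 0.
  have [e|e] := eqVneq (sw1 w y ^+ 2 + sw2 w y ^+ 2) 0.
    by move/eqP: e; rewrite paddr_eq0 ?sqr_ge0 // !sqrf_eq0 => /andP[/eqP -> /eqP ->].
  have := key y ((w y + 1) / (sw1 w y ^+ 2 + sw2 w y ^+ 2)).
  by rewrite divfK // gerDl ler10.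
have E1 : sw1 w = (fun=> 0) by apply/funext => y; case: (gz y).
have E2 : sw2 w = (fun=> 0) by apply/funext => y; case: (gz y).
pose o : R * R := (0, 0).
have g1 := sw1_grad w o; rewrite E1 in g1.
have g2 := sw2_grad w o; rewrite E2 in g2.
have [e11 _] := grad_at_unique _ _ _ _ _ _ g1 (grad_at_cst 0 o).
have [_ e22] := grad_at_unique _ _ _ _ _ _ g2 (grad_at_cst 0 o).
have := good_trace ell _ _ _ (sw_good w o).
by rewrite /Adiag e11 e22 E1 E2 !mulr0 expr0n /= addr0 subr0 addr0 ltxx.
Qed.

(* [s^2 w (d / s)] is the restriction to [s > 0] of a function differentiable at [0],
   whose value and derivative at [0] do not depend on the centre [x]. *)
Lemma expansion_at_infinity w x d (l : R) : 0 < l -> nsq d != 0 ->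
  (forall z, nsq z != 0 ->
     translate w x z = nsq z / l ^+ 2 * translate w x (dil (l ^+ 2 / nsq z) z)) ->
  exists (f : R -> R) (r : R), [/\ 0 < r, forall s, 0 < s < r -> f s = s ^+ 2 * w (dil s^-1 d),
    f 0 = nsq d / l ^+ 2 * w x &
    is_derive (0 : R) (1 : R) f (sw1 w x * d.1 + sw2 w x * d.2 -
      2 * (w x / l ^+ 2) * (d.1 * x.1 + d.2 * x.2))].
Proof.
move=> l0 dn H.
have ln : l != 0 by rewrite gt_eqF.
pose N (s : R) := (d.1 - s * x.1) ^+ 2 + (d.2 - s * x.2) ^+ 2.
have N0 : N 0 = nsq d by rewrite /N !mul0r !subr0.
have lin (a b : R) (s : R) : is_derive s (1 : R) (fun s => a - s * b) (- b).
  have := derD _ _ _ _ _ (is_derive_cst a s (1 : R)) (derZ (-1) _ _ _ (derM _ _ _ _ _ (is_derive_id s (1 : R)) (is_derive_cst b s (1 : R)))).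
  have -> : (fun t : R => cst a t + -1 * (id t * cst b t)) = (fun s => a - s * b).
    by apply/funext => t; rewrite mulN1r.
  by move=> /is_derive_eq; apply; rewrite /=; ring.
have dN : is_derive (0 : R) (1 : R) N (- 2 * (d.1 * x.1 + d.2 * x.2)).
  have := derD _ _ _ _ _ (derM _ _ _ _ _ (lin d.1 x.1 0) (lin d.1 x.1 0))
    (derM _ _ _ _ _ (lin d.2 x.2 0) (lin d.2 x.2 0)).
  by move=> /is_derive_eq; apply; rewrite !mul0r; ring.
(* Coordinates of the reflection of d / s in the sphere of centre x and radius l. With N s = s^2 |d
   / s - x|^2 they contain no s^-1 and extend smoothly to s = 0, where they give x. *)
pose cu (a b c : R) (s : R) := c + l ^+ 2 * (s * (a - s * b) * (N s)^-1).
have dcu (a b c : R) : is_derive (0 : R) (1 : R) (cu a b c) (l ^+ 2 * (a / nsq d)).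
  have Nn : N 0 != 0 by rewrite N0.
  have h := derM _ _ _ _ _ (derM _ _ _ _ _ (is_derive_id (0 : R) (1 : R)) (lin a b 0)) (derV N 0 _ Nn dN).
  have := derD _ _ _ _ _ (is_derive_cst c (0 : R) (1 : R)) (derZ (l ^+ 2) _ _ _ h).
  by move=> /is_derive_eq; apply; rewrite /= N0; field.
pose f (s : R) := N s * (l ^+ 2)^-1 * w (cu d.1 x.1 x.1 s, cu d.2 x.2 x.2 s).
have cu0 (a b c : R) : cu a b c 0 = c by rewrite /cu !mul0r mulr0 addr0.
have nbN : \forall s \near (0 : R), 0 < N s.
  have := is_derive1_continuous _ _ _ dN; move/cvgr_gt; apply.
  by rewrite N0 lt_neqAle eq_sym dn nsq_ge0.
have /nbhs_ballP[r /= r0 Hr] := nbN.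
exists f, r; split; first exact: r0.
- move=> s /andP[s0 sr]; have Ns : 0 < N s.
    by apply: Hr; rewrite /ball /= sub0r normrN gtr0_norm.
  have sn : s != 0 by rewrite gt_eqF.
  pose z : R * R := (s^-1 * d.1 - x.1, s^-1 * d.2 - x.2).
  have nz : nsq z = N s / s ^+ 2 by rewrite /nsq /N /z /=; field.
  have nzn : nsq z != 0 by rewrite nz mulf_neq0 ?invr_neq0 ?expf_neq0 // gt_eqF.
  have := H z nzn; rewrite !translateE nz /=.
  rewrite [x.1 + (_ - _)]addrC subrK [x.2 + (_ - _)]addrC subrK => E.
  rewrite /dil E /f /cu.
  have -> : x.1 + l ^+ 2 / (N s / s ^+ 2) * (s^-1 * d.1 - x.1) =
     x.1 + l ^+ 2 * (s * (d.1 - s * x.1) * (N s)^-1).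
    by field; rewrite sn gt_eqF.
  have -> : x.2 + l ^+ 2 / (N s / s ^+ 2) * (s^-1 * d.2 - x.2) =
     x.2 + l ^+ 2 * (s * (d.2 - s * x.2) * (N s)^-1).
    by field; rewrite sn gt_eqF.
  by field; apply/andP.
- by rewrite /f !cu0 N0 -surjective_pairing.
have hw := sw_grad w x (cu d.1 x.1 x.1) (cu d.2 x.2 x.2) 0 _ _ (cu0 _ _ _) (cu0 _ _ _) (dcu _ _ _) (dcu _ _ _).
have := derM _ _ _ _ _ (derM _ _ _ _ _ dN (is_derive_cst (l ^+ 2)^-1 (0 : R) (1 : R))) hw.
by move=> /is_derive_eq; apply; rewrite /= !cu0 -surjective_pairing N0; field; apply/andP.
Qed.

(** Both expansions describe the same function s^2 w (d / s) for small s > 0, so values and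
    derivatives at 0 agree; the two axis directions d separate the components. *)
Lemma expansion_unique w x x' (l l' : R) : 0 < l -> 0 < l' ->
  (forall z, nsq z != 0 ->
     translate w x z = nsq z / l ^+ 2 * translate w x (dil (l ^+ 2 / nsq z) z)) ->
  (forall z, nsq z != 0 ->
     translate w x' z = nsq z / l' ^+ 2 * translate w x' (dil (l' ^+ 2 / nsq z) z)) ->
  [/\ w x / l ^+ 2 = w x' / l' ^+ 2,
   sw1 w x - 2 * (w x / l ^+ 2) * x.1 = sw1 w x' - 2 * (w x' / l' ^+ 2) * x'.1 &
   sw2 w x - 2 * (w x / l ^+ 2) * x.2 = sw2 w x' - 2 * (w x' / l' ^+ 2) * x'.2].
Proof.
move=> l0 l0' H H'.
have key d : nsq d != 0 -> w x / l ^+ 2 = w x' / l' ^+ 2 /\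
  sw1 w x * d.1 + sw2 w x * d.2 - 2 * (w x / l ^+ 2) * (d.1 * x.1 + d.2 * x.2) =
  sw1 w x' * d.1 + sw2 w x' * d.2 - 2 * (w x' / l' ^+ 2) * (d.1 * x'.1 + d.2 * x'.2).
  move=> dn.
  have [f [r [r0 Ef f0 df]]] := expansion_at_infinity w x d l l0 dn H.
  have [g [r' [r0' Eg g0 dg]]] := expansion_at_infinity w x' d l' l0' dn H'.
  have dfg := derD _ _ _ _ _ df (derZ (-1) _ _ _ dg).
  have rr0 : 0 < Num.min r r' by rewrite lt_min r0.
  have [] := derive_eq0_right _ _ _ rr0 dfg.
    move=> t; rewrite lt_min => /andP[t0 /andP[tr tr']].
    by rewrite Ef ?t0 // Eg ?t0 // mulN1r subrr.
  rewrite f0 g0 mulN1r => /eqP; rewrite subr_eq0 ![nsq d / _ * _]mulrAC -!mulrA.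
  move=> /eqP /(mulfI dn) e /eqP; rewrite mulN1r subr_eq0 => /eqP ->.
  by split.
have n1 : nsq ((1, 0) : R * R) != 0 by rewrite /nsq /= expr1n expr0n addr0 oner_neq0.
have n2 : nsq ((0, 1) : R * R) != 0 by rewrite /nsq /= expr1n expr0n add0r oner_neq0.
have [e1 e2] := key _ n1; have [_ e3] := key _ n2.
split => //.
- by move: e2; rewrite /= !mulr1 !mulr0 !mul1r !mul0r !addr0.
- by move: e3; rewrite /= !mulr1 !mulr0 !mul1r !mul0r !add0r.
Qed.

Lemma finite_everywhere w x (l : R) : 0 < l ->
  (forall z, nsq z != 0 ->
     translate w x z = nsq z / l ^+ 2 * translate w x (dil (l ^+ 2 / nsq z) z)) ->
  forall x', exists2 l' : R, 0 < l' & forall z, nsq z != 0 ->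
     translate w x' z = nsq z / l' ^+ 2 * translate w x' (dil (l' ^+ 2 / nsq z) z).
Proof.
move=> l0 H x'; have [inf|//] := sphere_alternative ell (translate w x'); exfalso.
pose d : R * R := (1, 0).
have dn : nsq d != 0 by rewrite /nsq /d /= expr1n expr0n addr0 oner_neq0.
have ray (s : R) : 0 < s <= 1 -> s * w (x'.1 + s^-1, x'.2) <= w (x'.1 + 1, x'.2).
  move=> /andP[s0 s1]; have := sphere_all_ray _ inf (dil s^-1 d) s; rewrite dilA divff ?gt_eqF // dil1.
  by rewrite s0 s1 !translateE /d /= mulr1 mulr0 addr0; apply.
(* along [x' + d / s] the function is at most linear, while [s^2 w -> w x / l^2 > 0] *)
pose N (s : R) := (1 + s * (x'.1 - x.1)) ^+ 2 + (s * (x'.2 - x.2)) ^+ 2.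
pose f (s : R) := N s * (l ^+ 2)^-1 * w (x.1 + l ^+ 2 * (s * (1 + s * (x'.1 - x.1)) * (N s)^-1),
   x.2 + l ^+ 2 * (s * (s * (x'.2 - x.2)) * (N s)^-1)).
have cid : {for (0 : R), continuous (fun s : R => s)} by exact: cvg_id.
have cs (a : R) : {for (0 : R), continuous (fun s : R => s * a)}.
  exact: (contM _ (fun s : R => s) (fun=> a) _ cid (cont_cst _ _ _)).
have cs1 (a : R) : {for (0 : R), continuous (fun s : R => 1 + s * a)}.
  exact: (contD _ (fun=> 1) (fun s : R => s * a) _ (cont_cst _ _ _) (cs a)).
have cN : {for (0 : R), continuous N}.
  exact: (contD _ _ _ _ (contX _ _ _ 2 (cs1 _)) (contX _ _ _ 2 (cs _))).
have N0 : N 0 = 1 by rewrite /N !mul0r addr0 expr1n expr0n addr0.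
have cNV : {for (0 : R), continuous (fun s : R => (N s)^-1)}.
  by apply: contV => //; rewrite N0 oner_neq0.
have f0 : f 0 = w x / l ^+ 2.
  by rewrite /f N0 !mul0r !mulr0 !addr0 mul1r -surjective_pairing mulrC.
have cf : {for (0 : R), continuous f}.
  apply: (contM _ (fun s : R => N s * (l ^+ 2)^-1)).
    exact: (contM _ N (fun=> (l ^+ 2)^-1) _ cN (cont_cst _ _ _)).
  have cc (h : R -> R) (c : R) : {for (0 : R), continuous h} ->
     {for (0 : R), continuous (fun s : R => c + l ^+ 2 * (s * h s * (N s)^-1))}.
    move=> ch.
    have h1 := contM _ (fun s : R => s) h _ cid ch.
    have h2 := contM _ (fun s : R => s * h s) (fun s : R => (N s)^-1) _ h1 cNV.
    have h3 := contM _ (fun _ : R => l ^+ 2) _ _ (cont_cst _ (l ^+ 2) _) h2.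
    exact: (contD _ (fun _ : R => c) _ _ (cont_cst _ c _) h3).
  apply: (for_continuous_comp2 _ w _ _ _ (cc _ x.1 (cs1 _)) (cc _ x.2 (cs _))).
  exact: sw_cont.
have fpos : 0 < f 0 by rewrite f0 divr_gt0 ?sw_pos // exprn_gt0.
have f2 : f 0 / 2 < f 0 by rewrite ltr_pdivrMr // ltr_pMr // ltr1n.
have nb : \forall s \near (0 : R), f 0 / 2 < f s /\ 0 < N s.
  have n1 : \forall s \near (0 : R), f 0 / 2 < f s by move/cvgr_gt : cf => /(_ _ f2).
  have N0' : 0 < N 0 by rewrite N0.
  have n2 : \forall s \near (0 : R), 0 < N s by move/cvgr_gt : cN => /(_ _ N0').
  by near=> s; split; near: s; assumption.
have /nbhs_ballP[r /= r0 Hr] := nb.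
pose M := w (x'.1 + 1, x'.2); have M0 : 0 < M by exact: sw_pos.
(* The ray bound gives f s = s^2 w <= s M <= f 0 / 2, while nearness to 0 gives f s > f 0 / 2. *)
pose s := Num.min (Num.min 1 (r / 2)) (f 0 / 2 / M).
have s0 : 0 < s by rewrite !lt_min ltr01 !divr_gt0.
have s1 : s <= 1 by rewrite !ge_min lexx.
have sr : s < r.
  apply: (@le_lt_trans _ _ (r / 2)); first by rewrite !ge_min lexx orbT.
  by rewrite ltr_pdivrMr // ltr_pMr // ltr1n.
have sM : s * M <= f 0 / 2 by rewrite -ler_pdivlMr // ge_min lexx orbT.
have [fs Ns] : f 0 / 2 < f s /\ 0 < N s.
  by apply: Hr; rewrite /ball /= sub0r normrN gtr0_norm.
have sn : s != 0 by rewrite gt_eqF.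
have E : f s = s ^+ 2 * w (x'.1 + s^-1, x'.2).
  pose z : R * R := (x'.1 - x.1 + s^-1, x'.2 - x.2).
  have nz : nsq z = N s / s ^+ 2 by rewrite /nsq /N /z /=; field.
  have nzn : nsq z != 0 by rewrite nz mulf_neq0 ?invr_neq0 ?expf_neq0 // gt_eqF.
  have := H z nzn; rewrite !translateE nz /=.
  have -> : x.1 + (x'.1 - x.1 + s^-1) = x'.1 + s^-1 by ring.
  have -> : x.2 + (x'.2 - x.2) = x'.2 by ring.
  move=> ->; rewrite /f.
  have -> : x.1 + l ^+ 2 / (N s / s ^+ 2) * (x'.1 - x.1 + s^-1) =
     x.1 + l ^+ 2 * (s * (1 + s * (x'.1 - x.1)) * (N s)^-1).
    by field; rewrite sn gt_eqF.
  have -> : x.2 + l ^+ 2 / (N s / s ^+ 2) * (x'.2 - x.2) =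
     x.2 + l ^+ 2 * (s * (s * (x'.2 - x.2)) * (N s)^-1).
    by field; rewrite sn gt_eqF.
  by field; apply/andP; split => //; rewrite gt_eqF.
have s01 : 0 < s <= 1 by rewrite s0.
have := ler_wpM2l (ltW s0) (ray s s01); rewrite mulrA -expr2 -E -/M => h.
by have := lt_le_trans fs (le_trans h sM); rewrite ltxx.
Unshelve. all: by end_near. Qed.

Lemma classification w : exists (x0 : R * R) (al c : R), [/\ 0 < al, 0 < c,
  forall z, w z = al * dsq x0 z + c & @good R q G (4 * al * c) 0 (4 * al * c)].
Proof.
have fin : forall x, exists2 l : R, 0 < l & forall z, nsq z != 0 ->
     translate w x z = nsq z / l ^+ 2 * translate w x (dil (l ^+ 2 / nsq z) z).
  have [inf|[x hx]] : (forall x l, 0 < l -> sphere (translate w x) l) \/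
      exists x, ~ forall l, 0 < l -> sphere (translate w x) l.
    by have [h|/existsNP h] := pselect (forall x l, 0 < l -> sphere (translate w x) l);
      [left | right].
    by case: (not_all_infinite w inf).
  have [//|[l l0 H]] := sphere_alternative ell (translate w x).
  exact: (finite_everywhere w x l l0 H).
pose o : R * R := (0, 0).
have [l0 l00 H0] := fin o.
pose al := w o / l0 ^+ 2.
have al0 : 0 < al by rewrite divr_gt0 ?sw_pos // exprn_gt0.
have grads x : sw1 w x = sw1 w o + 2 * al * x.1 /\ sw2 w x = sw2 w o + 2 * al * x.2.
  have [l lp H] := fin x.
  have [e1 e2 e3] := expansion_unique w x o l l0 lp l00 H H0.
  rewrite e1 -/al /= !mulr0 !subr0 in e2 e3.
  by rewrite -e2 -e3 !subrK.
(* The zero of the affine gradient Dw(o) + 2 al x. *)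
pose x0 : R * R := (- sw1 w o / (2 * al), - sw2 w o / (2 * al)).
have aln : al != 0 by rewrite gt_eqF.
have wE z : w z = w x0 + al * dsq x0 z.
  pose f (t : R) := w (x0.1 + t * (z.1 - x0.1), x0.2 + t * (z.2 - x0.2)) - al * (t ^+ 2 * dsq x0 z).
  have df t : is_derive t (1 : R) f 0.
    have h1 := grad_at_line_at w x0 _ _ (z.1 - x0.1, z.2 - x0.2) t (sw_grad w _).
    have h2 := derZ (- al) _ _ _ (derM _ _ _ _ _ (derX _ _ _ 2 (is_derive_id t (1 : R))) (is_derive_cst (dsq x0 z) t (1 : R))).
    have := derD _ _ _ _ _ h1 h2.
    have -> : (fun t => w (x0.1 + t * (z.1 - x0.1, z.2 - x0.2).1,
         x0.2 + t * (z.1 - x0.1, z.2 - x0.2).2) + - al * (id t ^+ 2 * cst (dsq x0 z) t)) = f.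
      by apply/funext => s; rewrite mulNr.
    move=> /is_derive_eq; apply.
    have [-> ->] := grads (x0.1 + t * (z.1 - x0.1, z.2 - x0.2).1, x0.2 + t * (z.1 - x0.1, z.2 - x0.2).2).
    by rewrite /= /dsq /x0 /= expr1; field.
  have := is_derive_0_is_cst 1 0 df; rewrite /f !mul1r !mul0r !addr0 expr1n expr0n /= !mul1r mul0r mulr0 subr0.
  rewrite [x0.1 + (_ - _)]addrC subrK [x0.2 + (_ - _)]addrC subrK -!surjective_pairing => <-.
  by rewrite subrK.
exists x0, al, (w x0); split => //; first exact: sw_pos.
  by move=> z; rewrite addrC.
(* The gradient being affine, uniqueness of derivatives identifies D^2 w with 2 al I; as Dw vanishes
   at [x0], the matrix there is 4 al c I. *)
have lin (g : R * R -> R) (a b c : R) : g = (fun x => c + (a * x.1 + b * x.2)) -> grad_at g x0 a b.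
  move=> ->; have := grad_atD _ _ _ _ _ _ _ (grad_at_cst c x0)
    (grad_atD _ _ _ _ _ _ _ (grad_atZ _ _ a _ _ (grad_at_fst x0)) (grad_atZ _ _ b _ _ (grad_at_snd x0))).
  by move=> /grad_at_eq; apply; ring.
have g1 : grad_at (sw1 w) x0 (2 * al) 0.
  by apply: (lin _ _ _ (sw1 w o)); apply/funext => x; rewrite mul0r addr0; case: (grads x).
have g2 : grad_at (sw2 w) x0 0 (2 * al).
  by apply: (lin _ _ _ (sw2 w o)); apply/funext => x; rewrite mul0r add0r; case: (grads x).
have [e11 e12] := grad_at_unique _ _ _ _ _ _ (sw1_grad w x0) g1.
have [_ e22] := grad_at_unique _ _ _ _ _ _ (sw2_grad w x0) g2.
have [z1 z2] : sw1 w x0 = 0 /\ sw2 w x0 = 0.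
  by have [-> ->] := grads x0; rewrite /x0 /=; split; field.
have := sw_good w x0; rewrite /Adiag /Aoff e11 e12 e22 z1 z2 mulr0 expr0n /= addr0 subr0.
by have -> : 2 * w x0 * (2 * al) = 4 * al * w x0 by ring.
Qed.

End Classification.

(** * Translation to the eigenvalue equation *)

Section Bridge.
Context {R : realType}.
Implicit Types (p q x : R * R).

Definition vec2 x : 'rV[R]_2 := \row_i (if i == 0 then x.1 else x.2).

Lemma vec2_0 x : vec2 x 0 0 = x.1. Proof. by rewrite mxE. Qed.
Lemma vec2_1 x : vec2 x 0 1 = x.2. Proof. by rewrite mxE. Qed.

Lemma vec2K (v : 'rV[R]_2) : vec2 (v 0 0, v 0 1) = v.
Proof.
apply/rowP => i; rewrite mxE /=; case: eqP => [->//|/eqP i0].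
by congr (v _ _); apply/val_inj; case: i i0 => -[|[|]].
Qed.

Lemma vec2_const (k : R) : vec2 (k, k) = const_mx k.
Proof. by apply/rowP => i; rewrite !mxE; case: ifP. Qed.

Lemma vec2_continuous : continuous vec2.
Proof.
move=> x A /nbhs_ballP[e /= e0 He]; have := nbhsx_ballx x _ e0.
apply: filterS => y [/= h1 h2]; apply: He; split=> // i j.
by rewrite !mxE; case: ifP.
Qed.

Lemma shift_vec2_0 (h : R) q : h *: delta_mx 0 0 + vec2 q = vec2 (h + q.1, q.2).
Proof.
apply/rowP => i; rewrite !mxE /=; have [_|_] := eqVneq i 0; first by rewrite mulr1.
by rewrite mulr0 add0r.
Qed.

Lemma shift_vec2_1 (h : R) q : h *: delta_mx 0 1 + vec2 q = vec2 (q.1, h + q.2).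
Proof.
apply/rowP => i; rewrite !mxE /=; have [->|i0] := eqVneq i 0; first by rewrite mulr0 add0r.
have -> : i = 1 by apply/val_inj; case: i i0 => -[|[|]].
by rewrite mulr1.
Qed.

Lemma axis_derive0 (g : 'rV[R]_2 -> R) q : derivable g (vec2 q) (delta_mx 0 0) ->
  is_derive q.1 (1 : R) (fun t => g (vec2 (t, q.2))) (partial 0 g (vec2 q)).
Proof.
have E : (fun h : R => h^-1 *: ((g \o shift (vec2 q)) (h *: delta_mx 0 0) - g (vec2 q))) =
  (fun h : R => h^-1 *: (((fun t => g (vec2 (t, q.2))) \o shift q.1) (h *: 1) - g (vec2 (q.1, q.2)))).
  apply/funext => h; rewrite /= shift_vec2_0 -surjective_pairing.
  by rewrite [h *: 1]mulr1.
by move=> d; split; [move: d; rewrite /derivable E | rewrite /partial /derive E].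
Qed.

Lemma axis_derive1 (g : 'rV[R]_2 -> R) q : derivable g (vec2 q) (delta_mx 0 1) ->
  is_derive q.2 (1 : R) (fun t => g (vec2 (q.1, t))) (partial 1 g (vec2 q)).
Proof.
have E : (fun h : R => h^-1 *: ((g \o shift (vec2 q)) (h *: delta_mx 0 1) - g (vec2 q))) =
  (fun h : R => h^-1 *: (((fun t => g (vec2 (q.1, t))) \o shift q.2) (h *: 1) - g (vec2 (q.1, q.2)))).
  apply/funext => h; rewrite /= shift_vec2_1 -surjective_pairing.
  by rewrite [h *: 1]mulr1.
by move=> d; split; [move: d; rewrite /derivable E | rewrite /partial /derive E].
Qed.

Lemma for_continuous_vec2 (g : 'rV[R]_2 -> R) q : {for vec2 q, continuous g} ->
  {for q, continuous (fun x => g (vec2 x))}.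
Proof. by move=> cg; apply: (@continuous_comp _ _ _ vec2 g) => //; exact: vec2_continuous. Qed.

Lemma cone_Gamma (p : R) x : cone (2 - p) x <-> Gamma p (vec2 x).
Proof.
rewrite /cone /Gamma /= vec2_0 vec2_1; split=> -[h1 h2]; split; clear -h1 h2; lra.
Qed.

Lemma elliptic_of (p : R) (f : 'rV[R]_2 -> R) : 1 < p -> p <= 2 ->
  C1_on (Gamma p) f -> symmetric_on (Gamma p) f ->
  (forall (i : 'I_2) (l : 'rV[R]_2), Gamma p l -> 0 < partial i f l) ->
  elliptic (2 - p) (fun x => f (vec2 x)) (fun x => partial 0 f (vec2 x))
    (fun x => partial 1 f (vec2 x)).
Proof.
move=> p1 p2 fC1 fsym finc; split.
- by rewrite subr_ge0.
- by clear -p1; lra.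
- move=> x y /cone_Gamma hl; rewrite -(fsym _ hl); congr f.
  apply/rowP => i; rewrite !mxE; have [->|i0] := eqVneq i 0; first by rewrite tpermL.
  have -> : i = 1 by apply/val_inj; case: i i0 => -[|[|]].
  by rewrite tpermR.
- by move=> l /cone_Gamma hl; apply: axis_derive0; case: (fC1 0 _ hl).
- by move=> l /cone_Gamma hl; apply: axis_derive1; case: (fC1 1 _ hl).
- by move=> l /cone_Gamma hl; split; apply: finc.
- move=> l /cone_Gamma hl; split; apply: for_continuous_vec2.
    by case: (fC1 0 _ hl).
  by case: (fC1 1 _ hl).
Qed.

Lemma grad_at_C1_on (g : 'rV[R]_2 -> R) : C1_on setT g -> forall q,
  grad_at (fun x => g (vec2 x)) q (partial 0 g (vec2 q)) (partial 1 g (vec2 q)).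
Proof.
move=> hg q; apply: (grad_at_C1 _ (fun x => partial 0 g (vec2 x)) (fun x => partial 1 g (vec2 x))).
- by move=> x; apply: axis_derive0; case: (hg 0 (vec2 x) I).
- by move=> x; apply: axis_derive1; case: (hg 1 (vec2 x) I).
- by apply: for_continuous_vec2; case: (hg 0 (vec2 q) I).
- by apply: for_continuous_vec2; case: (hg 1 (vec2 q) I).
Qed.

(** Comparison of the coefficients of the characteristic polynomial in degrees 1 and 0. *)
Lemma eigenvalues_eig (M : 'M[R]_2) (l : 'rV[R]_2) : eigenvalues_of M l ->
  l 0 0 + l 0 1 = M 0 0 + M 1 1 /\ l 0 0 * l 0 1 = M 0 0 * M 1 1 - M 0 1 * M 1 0.
Proof.
rewrite /eigenvalues_of big_ord_recr big_ord_recr big_ord0 /= mul1r.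
have -> : widen_ord (leqnSn 1) ord_max = 0 :> 'I_2 by apply/val_inj.
have -> : ord_max = 1 :> 'I_2 by apply/val_inj.
set a := l 0 0; set b := l 0 1.
have -> : ('X - a%:P) * ('X - b%:P) = 'X^2 - (a + b)%:P * 'X + (a * b)%:P.
  by rewrite polyCD polyCM expr2; ring.
move=> E; split.
- have := char_poly_trace M isT; rewrite E /= coefD coefB coefXn coefCM coefX coefC /=.
  rewrite mulr1 addr0 sub0r => /oppr_inj ->.
  by rewrite /mxtrace big_ord_recr big_ord_recr big_ord0 /= add0r; congr (M _ _ + M _ _); apply/val_inj.
- have := char_poly_det M; rewrite E coefD coefB coefXn coefCM coefX coefC /=.
  rewrite mulr0 subr0 add0r sqrrN expr1n mul1r => ->.
  rewrite (expand_det_row _ 0) big_ord_recr big_ord_recr big_ord0 /= add0r.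
  rewrite /cofactor !det_mx11 !mxE /= expr0 expr1 mul1r mulN1r mulrN.
  by congr (M _ _ * M _ _ - M _ _ * M _ _); apply/val_inj.
Qed.

(** * The solution w = exp(-u / 2) attached to u *)

Section SolutionOf.
Context {p : R} {f : 'rV[R]_2 -> R} {u : 'rV[R]_2 -> R}.
Hypothesis u_C2 : C2_on setT u.
Hypothesis u_eq : forall x : 'rV[R]_2, exists l : 'rV[R]_2,
  [/\ eigenvalues_of (Amx u x) l, Gamma p l & f l = 1].

Let u1 x := partial 0 u (vec2 x).
Let u2 x := partial 1 u (vec2 x).
Let u11 x := partial 0 (partial 0 u) (vec2 x).
Let u12 x := partial 1 (partial 0 u) (vec2 x).
Let u21 x := partial 0 (partial 1 u) (vec2 x).
Let u22 x := partial 1 (partial 1 u) (vec2 x).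

Let u_grad x : grad_at (fun y => u (vec2 y)) x (u1 x) (u2 x).
Proof. by apply: grad_at_C1_on; case: u_C2. Qed.
Let u1_grad x : grad_at u1 x (u11 x) (u12 x).
Proof. by apply: grad_at_C1_on; case: u_C2 => _; apply. Qed.
Let u2_grad x : grad_at u2 x (u21 x) (u22 x).
Proof. by apply: grad_at_C1_on; case: u_C2 => _; apply. Qed.

Let cont1 (i : 'I_2) x : {for x, continuous (fun y => partial i u (vec2 y))}.
Proof. by apply: for_continuous_vec2; case: u_C2 => + _ => /(_ i (vec2 x) I)[]. Qed.
Let cont2 (i j : 'I_2) x : {for x, continuous (fun y => partial i (partial j u) (vec2 y))}.
Proof. by apply: for_continuous_vec2; case: u_C2 => _ /(_ j i (vec2 x) I)[]. Qed.

Let u12E x : u12 x = u21 x.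
Proof. exact: (mixed_partials_eq _ _ _ _ _ _ _ x u_grad u1_grad u2_grad (cont2 1 0 x) (cont2 0 1 x)). Qed.

Definition wu x : R := expR (- 2^-1 * u (vec2 x)).
Let wu1 x : R := - 2^-1 * (u1 x * wu x).
Let wu2 x : R := - 2^-1 * (u2 x * wu x).

Let wu_grad x : grad_at wu x (wu1 x) (wu2 x).
Proof.
have h := grad_atZ _ _ (- 2^-1) _ _ (u_grad x).
apply: (grad_at_eq _ _ _ _ _ _ (grad_at_comp1 expR _ _ _ _ _ (is_derive_expR _) h));
  by rewrite /wu1 /wu2 /wu; ring.
Qed.

Let wu_cont x : {for x, continuous wu}.
Proof.
have cu : {for x, continuous (fun y => u (vec2 y))}.
  exact: (for_continuous_C1 _ u1 u2 x u_grad (cont1 0 x) (cont1 1 x)).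
apply: (cont_comp _ expR (fun y => - 2^-1 * u (vec2 y))); last exact: continuous_expR.
exact: contZ.
Qed.

Let wuM_cont (g : R * R -> R) x : {for x, continuous g} ->
  {for x, continuous (fun y => - 2^-1 * (g y * wu y))}.
Proof. by move=> cg; apply: contZ; apply: contM. Qed.

Let wu1_cont x : {for x, continuous wu1}. Proof. exact: wuM_cont (cont1 0 x). Qed.
Let wu2_cont x : {for x, continuous wu2}. Proof. exact: wuM_cont (cont1 1 x). Qed.

Let second_cont (g h k : R * R -> R) x : {for x, continuous g} -> {for x, continuous h} ->
  {for x, continuous k} ->
  {for x, continuous (fun y => - 2^-1 * (g y * wu y + h y * k y))}.
Proof.
move=> cg ch ck; apply: contZ.
exact: (contD _ (fun y => g y * wu y) (fun y => h y * k y) x (contM _ _ _ _ cg (wu_cont x)) (contM _ _ _ _ ch ck)).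
Qed.

(** Since exp(-u) = w^2, each entry of [Amx] can be rewritten in terms of w, and only its trace and
    determinant are needed. The construction is transparent so that w can be unfolded to recover
    u. *)
Definition solution_of : @solution R (2 - p) (fun x => f (vec2 x)).
Proof.
refine (@Solution R (2 - p) (fun x => f (vec2 x)) wu wu1 wu2
  (fun x => - 2^-1 * (u11 x * wu x + u1 x * wu1 x))
  (fun x => - 2^-1 * (u12 x * wu x + u1 x * wu2 x))
  (fun x => - 2^-1 * (u22 x * wu x + u2 x * wu2 x)) _ _ _ _ _ _ _ _ _ _ _).
- by move=> x; exact: expR_gt0.
- exact: wu_grad.
- move=> x; have h := grad_atZ _ _ (- 2^-1) _ _ (grad_atM _ _ _ _ _ _ _ (u1_grad x) (wu_grad x)).
  by apply: (grad_at_eq _ _ _ _ _ _ h); ring.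
- move=> x; have h := grad_atZ _ _ (- 2^-1) _ _ (grad_atM _ _ _ _ _ _ _ (u2_grad x) (wu_grad x)).
  by apply: (grad_at_eq _ _ _ _ _ _ h); rewrite ?u12E /wu1 /wu2; ring.
- exact: wu_cont.
- exact: wu1_cont.
- exact: wu2_cont.
- by move=> x; apply: second_cont; [exact: cont2 | exact: cont1 | exact: wu1_cont].
- by move=> x; apply: second_cont; [exact: cont2 | exact: cont1 | exact: wu2_cont].
- by move=> x; apply: second_cont; [exact: cont2 | exact: cont1 | exact: wu2_cont].
- move=> x; have [l [/eigenvalues_eig [h1 h2] hG hf]] := u_eq (vec2 x).
  exists (l 0 0, l 0 1); rewrite vec2K /=; split => //; last by apply/cone_Gamma; rewrite vec2K.
  have E : expR (- u (vec2 x)) = wu x ^+ 2.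
    by rewrite /wu expr2 -expRD; congr expR; field.
  have S : sqr_enorm (gradient u (vec2 x)) = u1 x ^+ 2 + u2 x ^+ 2.
    rewrite /sqr_enorm big_ord_recr big_ord_recr big_ord0 /= add0r !mxE.
    by congr (partial _ _ _ ^+ 2 + partial _ _ _ ^+ 2); apply/val_inj.
  have ent (i j : 'I_2) : Amx u (vec2 x) i j =
    - (wu x ^+ 2 * partial i (partial j u) (vec2 x)) +
     2^-1 * wu x ^+ 2 * (partial i u (vec2 x) * partial j u (vec2 x)) -
     4^-1 * wu x ^+ 2 * (u1 x ^+ 2 + u2 x ^+ 2) * (i == j)%:R.
    by rewrite /Amx E S !mxE big_ord_recr big_ord0 /= add0r !mxE.
  split; rewrite ?h1 ?h2 !ent /= /Adiag /Aoff.
    by rewrite /wu1 /wu2 -/(u1 x) -/(u2 x) -/(u11 x) -/(u22 x); field.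
  rewrite -/(u1 x) -/(u2 x) -/(u11 x) -/(u22 x) -/(u12 x) -/(u21 x) -u12E /wu1 /wu2.
  by field.
Defined.

Lemma solution_ofE x : u (vec2 x) = - 2 * ln (solution_of x).
Proof. by rewrite /= /wu expRK; field. Qed.

End SolutionOf.

End Bridge.

Theorem theorem1p5 (R : realType) (p : R) (hp1 : 1 < p) (hp2 : p <= 2)
    (f : 'rV[R]_2 -> R)
    (f_C1 : C1_on (Gamma p) f)
    (f_sym : symmetric_on (Gamma p) f)
    (f_incr : forall (i : 'I_2) (l : 'rV[R]_2), Gamma p l -> 0 < partial i f l)
    (u : 'rV[R]_2 -> R)
    (u_C2 : C2_on setT u)
    (u_eq : forall x : 'rV[R]_2, exists l : 'rV[R]_2,
       [/\ eigenvalues_of (Amx u x) l, Gamma p l & f l = 1]) :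
  exists (x0 : 'rV[R]_2) (a b : R),
    [/\ 0 < a, 0 < b,
        Gamma p (const_mx (2^-1 * a ^- 2 * b)),
        f (const_mx (2^-1 * a ^- 2 * b)) = 1 &
        forall x : 'rV[R]_2,
          u x = 2 * ln (8 * a / (8 * sqr_enorm (x - x0) + b))].
Proof.
have ell := elliptic_of p f hp1 hp2 f_C1 f_sym f_incr.
have [x0 [al [c [al0 c0 wE [[l1 l2] /= [[h1 h2] hcone hf]]]]]] :=
  classification ell (solution_of u_C2 u_eq).
have aln : al != 0 by rewrite gt_eqF.
(* The matrix is scalar, so the discriminant (l1 + l2)^2 - 4 l1 l2 vanishes. *)
have l12 : l1 = l2.
  apply/eqP; rewrite -subr_eq0 -sqrf_eq0.
  have -> : (l1 - l2) ^+ 2 = (l1 + l2) ^+ 2 - 4 * (l1 * l2) by ring.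
  by rewrite h1 h2; apply/eqP; ring.
have l1E : l1 = 4 * al * c by rewrite -l12 in h1; clear -h1; lra.
rewrite -l12 l1E in hcone hf.
(* Matching 1 / w = 1 / (al |x - x0|^2 + c) with 8 a / (8 |x - x0|^2 + b) forces a = 1 / al and b =
   8 c / al; then a^-2 b / 2 is the double eigenvalue 4 al c. *)
have kE : 2^-1 * al^-1 ^- 2 * (8 * c / al) = 4 * al * c by field.
exists (vec2 x0), al^-1, (8 * c / al); rewrite kE -vec2_const; split => //.
- by rewrite invr_gt0.
- by rewrite divr_gt0 // mulr_gt0.
- by apply/cone_Gamma.
move=> x; rewrite -[x]vec2K (solution_ofE u_C2 u_eq) wE.
set y := (x 0 0, x 0 1).
have -> : sqr_enorm (vec2 y - vec2 x0) = dsq x0 y.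
  by rewrite /sqr_enorm big_ord_recr big_ord_recr big_ord0 /= add0r !mxE.
have w0 : 0 < al * dsq x0 y + c by rewrite ltr_wpDl // mulr_ge0 ?dsq_ge0 // ltW.
have -> : 8 * al^-1 / (8 * dsq x0 y + 8 * c / al) = (al * dsq x0 y + c)^-1.
  field; rewrite aln gt_eqF //=.
  have -> : 8 * dsq x0 y * al + 8 * c = 8 * (al * dsq x0 y + c) by ring.
  by rewrite gt_eqF // mulr_gt0.
by rewrite lnV ?posrE // mulrN mulNr.
Qed.
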